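(* For all $p\ge0$, the operator $\mathcal N^2:H^p[0,2\pi]^2\to H^{p+2}[0,2\pi]^2$, where $$\mathcal N=\begin{bmatrix}I&0\\ T_0&-I\end{bmatrix}+\begin{bmatrix}E_2S_2&S_0+E_1S_2\\ \tfrac12E_1S_0+E_3S_1+E_6S_2&-E_2S_2\end{bmatrix},$$ satisfies $$\mathcal N^2\psi=(\mathcal U+\mathcal J)\psi\qquad\forall\,\psi\in H^p[0,2\pi]^2,$$ where $\mathcal J:H^p[0,2\pi]^2\to H^{p+2}[0,2\pi]^2$ is a compact operator and $\mathcal U:H^p[0,2\pi]^2\to H^{p+2}[0,2\pi]^2$ is an isomorphism given by $$\mathcal U=\begin{bmatrix}I+S_0T_0+E_1S_0S_0&0\\ 0&I+T_0S_0+E_1S_0S_0\end{bmatrix}.$$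
   Context: $\kappa>0$ is fixed. $\gamma=(\gamma_1,\gamma_2)$ is a $2\pi$-periodic analytic parametrization of a simple closed analytic curve $\Gamma=\{\gamma(t):0\le t<2\pi\}\subset\mathbb R^2$ with $|\gamma'(t)|>0$ for all $t$; $n(t)=(\gamma_2'(t),-\gamma_1'(t))^\top$. $H^p[0,2\pi]$ is the Sobolev space of $2\pi$-periodic functions (distributions if $p<0$) with norm $\|u\|_p^2=\sum_{m\in\mathbb Z}(1+m^2)^p|\hat u_m|^2<\infty$, $\hat u_m=\frac1{2\pi}\int_0^{2\pi}u(t)e^{-\mathrm imt}\,\mathrm dt$; $H^p[0,2\pi]^2$ consists of pairs with norm $\|\eta_1\|_p+\|\eta_2\|_p$. $I$ is the identity. An isomorphism is a bounded linear bijection with bounded inverse. Operators (extended by continuity to all the spaces above): $$(T_0\phi)(t)=\frac1{2\pi}\int_0^{2\pi}\cot\Big(\frac{\zeta-t}2\Big)\phi'(\zeta)\,\mathrm d\zeta+\frac{\mathrm i}{2\pi}\int_0^{2\pi}\phi(\zeta)\,\mathrm d\zeta\quad(\text{principal value}),$$ $$(S_0\phi)(t)=-\frac1{2\pi}\int_0^{2\pi}\ln\Big(4\sin^2\frac{t-\zeta}2\Big)\phi(\zeta)\,\mathrm d\zeta+\frac{\mathrm i}{2\pi}\int_0^{2\pi}\phi(\zeta)\,\mathrm d\zeta,$$ $$(S_1\phi)(t)=\frac1{4\pi}\int_0^{2\pi}\ln\Big(4\sin^2\frac{t-\zeta}2\Big)\sin(t-\zeta)\phi(\zeta)\,\mathrm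 d\zeta,$$ $$(S_2\phi)(t)=-\frac1{8\pi}\int_0^{2\pi}\ln\Big(4\sin^2\frac{t-\zeta}2\Big)\sin^2(t-\zeta)\phi(\zeta)\,\mathrm d\zeta.$$ Multiplication operators: $E_1\phi=\kappa^2|\gamma'|^2\phi$, $E_2\phi=\kappa^2(n\cdot\gamma'')\phi$, $E_3\phi=\kappa^2(\gamma'\cdot\gamma'')\phi$, $E_4\phi=(-\kappa^4|\gamma'|^4+2\kappa^2\gamma'\cdot\gamma''')\phi$, $E_5\phi=(-\frac34\kappa^4|\gamma'|^4+\kappa^2\gamma'\cdot\gamma''')\phi$, and $E_6=E_4-E_5$. *)

(* Defs.v *)
From HB Require Import structures.
From mathcomp Require Import all_boot all_order all_algebra.
From mathcomp Require Import complex ring.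
From mathcomp Require Import all_classical all_reals all_analysis.

Set Implicit Arguments.
Unset Strict Implicit.
Unset Printing Implicit Defensive.

Import Order.TTheory GRing.Theory Num.Theory numFieldNormedType.Exports.

Local Open Scope classical_set_scope.
Local Open Scope complex_scope.
Local Open Scope ring_scope.

Section sobolev_norm.
Context {R : realType}.
Implicit Types (p : R) (u v : int -> R[i]).

(* A 2pi-periodic function or distribution u is represented, for every order p,
   by the family of its Fourier coefficients m |-> u_m. *)
Definition sobolev_sqnorm p u : \bar R :=
  \esum_(m in [set: int])
    ((1 + m%:~R ^+ 2) `^ p * Normc.normc (u m) ^+ 2)%:E.

Definition sobolev_norm p u : R := Num.sqrt (fine (sobolev_sqnorm p u)).

Definition in_sobolev p : {pred int -> R[i]} :=
  fun u => `[< (sobolev_sqnorm p u < +oo)%E >].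

Let term_ge0 p u (m : int) :
  (0 <= ((1 + m%:~R ^+ 2) `^ p * Normc.normc (u m) ^+ 2)%:E)%E.
Proof. by rewrite lee_fin mulr_ge0 ?powR_ge0 ?sqr_ge0. Qed.

Let sqnorm_ge0 p u : (0 <= sobolev_sqnorm p u)%E.
Proof. by apply: esum_ge0 => m _; exact: term_ge0. Qed.

Let le_esumZ (c : R) (a : int -> \bar R) : 0 <= c -> (forall i, 0 <= a i)%E ->
  (\esum_(i in [set: int]) (c%:E * a i) <=
   c%:E * \esum_(i in [set: int]) a i)%E.
Proof.
move=> c0 a0; apply: ge_ereal_sup => _ [A [finA _] <-].
rewrite -ge0_mule_fsumr// lee_wpmul2l ?lee_fin//.
by apply: ereal_sup_ubound; exists A.
Qed.

Let sqnormZ_le p (l : R[i]) u :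
  (sobolev_sqnorm p (fun m => l * u m)%R <=
   (Normc.normc l ^+ 2)%:E * sobolev_sqnorm p u)%E.
Proof.
apply: le_trans (le_esumZ (sqr_ge0 _) _); last by move=> i; exact: term_ge0.
apply: le_esum => m _; rewrite -EFinM lee_fin Normc.normcM exprMn.
by rewrite mulrCA.
Qed.

Let normc_ge0 (z : R[i]) : 0 <= Normc.normc z.
Proof. by case: z => a b; exact: sqrtr_ge0. Qed.

Let sqnormZ p (l : R[i]) u :
  sobolev_sqnorm p (fun m => l * u m)%R =
  ((Normc.normc l ^+ 2)%:E * sobolev_sqnorm p u)%E.
Proof.
apply/eqP; rewrite eq_le sqnormZ_le /=.
have [->|l0] := eqVneq l 0.
  by rewrite Normc.normc0 expr0n/= mul0e sqnorm_ge0.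
have nl : 0 < Normc.normc l ^+ 2.
  rewrite exprn_gt0// lt_neqAle normc_ge0 andbT eq_sym.
  by apply: contra_neq l0 => /Normc.eq0_normc.
have -> : u = (fun m => l^-1 * (l * u m)).
  by apply/funext => m; rewrite mulKf.
rewrite -lee_pdivlMl// -exprVn -Normc.normcV.
rewrite (_ : (fun m => l * (l^-1 * (l * u m))) = fun m => l * u m).
  exact: sqnormZ_le.
by apply/funext => m; rewrite mulVKf.
Qed.

Let sqnormD_le p (c d : R) u v : 0 <= c -> 0 <= d ->
  (forall a b : R, 0 <= a -> 0 <= b ->
     (a + b) ^+ 2 <= c * a ^+ 2 + d * b ^+ 2) ->
  (sobolev_sqnorm p (fun m => u m + v m)%R <=
   c%:E * sobolev_sqnorm p u + d%:E * sobolev_sqnorm p v)%E.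
Proof.
move=> c0 d0 cd.
apply: le_trans (leeD (le_esumZ c0 (term_ge0 p u)) (le_esumZ d0 (term_ge0 p v))).
rewrite -esumD; last 2 first.
- by move=> i _; rewrite mule_ge0.
- by move=> i _; rewrite mule_ge0.
apply: le_esum => m _; rewrite -!EFinM -EFinD lee_fin.
rewrite !(mulrCA _ (_ `^ _)) -mulrDr ler_wpM2l ?powR_ge0//.
apply: le_trans (cd _ _ (normc_ge0 _) (normc_ge0 _)).
by rewrite lerXn2r ?nnegrE ?addr_ge0 ?normc_ge0// le_normcD.
Qed.

Lemma sobolev_submod_closed p : submod_closed (in_sobolev p).
Proof.
split=> [|a u v].
  apply/asboolP; rewrite /sobolev_sqnorm esum1// => m _.
  by rewrite Normc.normc0 expr0n mulr0.
rewrite !unfold_in => /asboolP fu /asboolP fv; apply/asboolP.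
apply: (@le_lt_trans _ _ (2%:E * sobolev_sqnorm p (fun m => a * u m)%R
                          + 2%:E * sobolev_sqnorm p v)%E).
  apply: sqnormD_le => // x y x0 y0; rewrite -subr_ge0.
  rewrite [leRHS](_ : _ = (x - y) ^+ 2) ?sqr_ge0//.
  by rewrite sqrrB sqrrD !mulr2n; ring.
by rewrite lte_add_pinfty ?lte_mul_pinfty// sqnormZ lte_mul_pinfty// lee_fin
  sqr_ge0.
Qed.

Lemma sobolev_norm_ge0 p u : 0 <= sobolev_norm p u.
Proof. exact: sqrtr_ge0. Qed.

Lemma sobolev_normZ p (l : R[i]) u :
  sobolev_norm p (l *: u) = Normc.normc l * sobolev_norm p u.
Proof.
rewrite /sobolev_norm -[l *: u]/(fun m => l * u m) sqnormZ.
have [fu|] := boolP (sobolev_sqnorm p u \is a fin_num).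
  by rewrite fineM// sqrtrM ?sqr_ge0// sqrtr_sqr ger0_norm.
rewrite ge0_fin_numE// -leNgt leye_eq => /eqP ->.
have [->|l0] := eqVneq (Normc.normc l) 0.
  by rewrite expr0n mul0e sqrtr0 mul0r.
by rewrite gt0_muley ?lte_fin ?exprn_even_gt0//= sqrtr0 mulr0.
Qed.

Let sobolev_normK p u : u \in in_sobolev p ->
  (sobolev_norm p u ^+ 2)%:E = sobolev_sqnorm p u.
Proof.
move=> /asboolP fu; rewrite sqr_sqrtr ?fine_ge0// fineK//.
by rewrite ge0_fin_numE.
Qed.

Lemma sobolev_norm_eq0 p u : u \in in_sobolev p -> sobolev_norm p u = 0 ->
  u = 0.
Proof.
move=> fu u0; apply/funext => m.
have : (((1 + m%:~R ^+ 2) `^ p * Normc.normc (u m) ^+ 2)%:E <= 0 :> \bar R)%E.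
  rewrite (_ : 0%E = sobolev_sqnorm p u); last first.
    by rewrite -sobolev_normK// u0 expr0n.
  apply: esum_ge; exists [set m]; first by split.
  by rewrite fsbig_set1.
have w0 : 0 < (1 + m%:~R ^+ 2) `^ p :> R.
  by rewrite powR_gt0 // ltr_wpDr ?sqr_ge0.
rewrite lee_fin pmulr_rle0// => h.
apply: Normc.eq0_normc; apply/eqP; rewrite -sqrf_eq0.
by rewrite eq_le h sqr_ge0.
Qed.

Lemma ler_sobolev_normD p u v : u \in in_sobolev p -> v \in in_sobolev p ->
  sobolev_norm p (u + v) <= sobolev_norm p u + sobolev_norm p v.
Proof.
move=> fu fv; set x := sobolev_norm p u; set y := sobolev_norm p v.
have [x0|x0] := eqVneq x 0.
  by rewrite (sobolev_norm_eq0 fu x0) x0 !add0r.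
have [y0|y0] := eqVneq y 0.
  by rewrite (sobolev_norm_eq0 fv y0) y0 !addr0.
have {x0} xp : 0 < x by rewrite lt_neqAle eq_sym x0 sobolev_norm_ge0.
have {y0} yp : 0 < y by rewrite lt_neqAle eq_sym y0 sobolev_norm_ge0.
have := @sqnormD_le p (1 + y / x) (1 + x / y) u v.
rewrite -(sobolev_normK fu) -(sobolev_normK fv) -/x -/y -!EFinM -EFinD => H.
have {}H : (sobolev_sqnorm p (u + v)%R <= ((x + y) ^+ 2)%:E)%E.
  rewrite (_ : (x + y) ^+ 2 = (1 + y / x) * x ^+ 2 + (1 + x / y) * y ^+ 2).
    apply: H => [||a b a0 b0].
    - by rewrite addr_ge0// divr_ge0// ltW.
    - by rewrite addr_ge0// divr_ge0// ltW.
    rewrite -subr_ge0 [leRHS](_ : _ = (y * a - x * b) ^+ 2 / (x * y)).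
      by rewrite divr_ge0 ?sqr_ge0// mulr_ge0// ltW.
    by field; rewrite !gt_eqF.
  by field; rewrite !gt_eqF.
rewrite -[leRHS]ger0_norm ?addr_ge0 ?sobolev_norm_ge0// -sqrtr_sqr.
apply: ler_wsqrtr; rewrite -lee_fin fineK// ge0_fin_numE//.
by rewrite (le_lt_trans H)// ltry.
Qed.

End sobolev_norm.

Section sobolev_space.
Context {R : realType}.

HB.instance Definition _ (p : R) :=
  GRing.isSubmodClosed.Build _ _ (in_sobolev p) (sobolev_submod_closed p).

Record sobolev (p : R) := Sobolev {
  fourier :> int -> R[i];
  fourierP : fourier \in in_sobolev p
}.

HB.instance Definition _ (p : R) := [isSub for @fourier p].
HB.instance Definition _ (p : R) := [Choice of sobolev p by <:].
HB.instance Definition _ (p : R) :=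
  [SubChoice_isSubLmodule of sobolev p by <:].

Let ler_norm (p : R) (u v : sobolev p) :
  (sobolev_norm p (u + v : sobolev p))%:C <=
  (sobolev_norm p u)%:C + (sobolev_norm p v)%:C.
Proof. by rewrite -rmorphD lecR ler_sobolev_normD// fourierP. Qed.

Let normZ (p : R) (l : R[i]) (u : sobolev p) :
  (sobolev_norm p (l *: u : sobolev p))%:C = `|l| * (sobolev_norm p u)%:C.
Proof.
rewrite (_ : fourier (l *: u) = l *: fourier u)//.
by rewrite sobolev_normZ rmorphM.
Qed.

Let norm_eq0 (p : R) (u : sobolev p) : (sobolev_norm p u)%:C = 0 -> u = 0.
Proof.
move=> /complexI u0; apply: val_inj => /=.
by rewrite (sobolev_norm_eq0 (fourierP u) u0).
Qed.

HB.instance Definition _ (p : R) := Lmodule_isNormed.Build R[i] (sobolev p)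
  (@ler_norm p) (@normZ p) (@norm_eq0 p).

(* The library norms a product by the maximum of the norms of the components;
   the alias carries their sum instead. *)
Definition sobolev2 (p : R) : Type := (sobolev p * sobolev p)%type.

HB.instance Definition _ (p : R) := GRing.Lmodule.copy (sobolev2 p)
  (sobolev p * sobolev p)%type.

Let ler_norm2 (p : R) (x y : sobolev2 p) :
  `|(x + y).1| + `|(x + y).2| <= `|x.1| + `|x.2| + (`|y.1| + `|y.2|).
Proof. by rewrite addrACA lerD// ler_normD. Qed.

Let norm2Z (p : R) (l : R[i]) (x : sobolev2 p) :
  `|(l *: x).1| + `|(l *: x).2| = `|l| * (`|x.1| + `|x.2|).
Proof. by rewrite mulrDr !normrZ. Qed.

Let norm2_eq0 (p : R) (x : sobolev2 p) : `|x.1| + `|x.2| = 0 -> x = 0.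
Proof.
case: x => u v /= /eqP.
by rewrite paddr_eq0 ?normr_ge0// !normr_eq0 => /andP[/eqP -> /eqP ->].
Qed.

HB.instance Definition _ (p : R) := Lmodule_isNormed.Build R[i] (sobolev2 p)
  (@ler_norm2 p) (@norm2Z p) (@norm2_eq0 p).

Definition fourier2 (p : R) (x : sobolev2 p) : (int -> R[i]) * (int -> R[i]) :=
  (fourier x.1, fourier x.2).

End sobolev_space.

Section operators_between_normed_spaces.
Context {K : numFieldType} {V W : normedModType K}.

Definition bounded_operator (f : V -> W) :=
  exists M : K, forall x, `|f x| <= M * `|x|.

Definition compact_operator (f : {linear V -> W}) :=
  forall B : set V, bounded_set B -> precompact (f @` B).

End operators_between_normed_spaces.

Definition isomorphism {K : numFieldType} {V W : normedModType K}
    (f : {linear V -> W}) :=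
  bounded_operator f /\
  exists g : W -> V, [/\ cancel f g, cancel g f & bounded_operator g].

Section complex_valued_functions.
Context {R : realType}.
Implicit Types f : R -> R[i].

Definition cintegral (D : set R) f : R[i] :=
  (\int[lebesgue_measure]_(x in D) complex.Re (f x))
    +i* (\int[lebesgue_measure]_(x in D) complex.Im (f x)).

Definition cderive f (t : R) : R[i] :=
  derive1 (fun s => complex.Re (f s)) t +i* derive1 (fun s => complex.Im (f s)) t.

Definition clim {T : Type} (F : set_system T) (f : T -> R[i]) : R[i] :=
  lim (complex.Re (f x) @[x --> F]) +i* lim (complex.Im (f x) @[x --> F]).

Definition period : set R := `[0, 2 * pi].

Definition expi (t : R) : R[i] := cos t +i* sin t.

Definition fourier_coef f (m : int) : R[i] :=
  ((2 * pi)^-1)%:C * cintegral period (fun t => f t * expi (- (m%:~R * t))).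

(* the partial sum over the frequencies |m| <= N *)
Definition fourier_sum (u : int -> R[i]) (N : nat) (t : R) : R[i] :=
  \sum_(j < (2 * N).+1) let m := j%:Z - N%:Z in u m * expi (m%:~R * t).

(* Extension by continuity of an operator given by a formula on smooth
   functions. The partial sums of u tend to u in every H^p that contains u, so
   if A is bounded from H^p to H^q on trigonometric polynomials, then
   A (fourier_sum u N) tends in H^q, hence coefficientwise, to the value at u
   of the continuous extension of A. *)
Definition extend (A : (R -> R[i]) -> (R -> R[i])) (u : int -> R[i]) :
    int -> R[i] :=
  fun m => clim \oo (fun N => fourier_coef (A (fourier_sum u N)) m).

End complex_valued_functions.

Section integral_operators.
Context {R : realType}.
Implicit Types phi : R -> R[i].

Definition logker (s : R) : R := ln (4 * sin (s / 2) ^+ 2).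

(* Principal value: the singularities in z are the points t + 2 k pi, so for
   t = 0 and t = 2 pi both endpoints of the period are excluded. *)
Definition away_from (t e : R) : set R :=
  [set z | period z /\ forall k : int, e <= `|z - t - 2 * pi * k%:~R|].

Definition opT0 phi (t : R) : R[i] :=
  ((2 * pi)^-1)%:C *
    clim 0^'+ (fun e => cintegral (away_from t e) (fun z =>
      (cos ((z - t) / 2) / sin ((z - t) / 2))%:C * cderive phi z))
  + (0 +i* 1) * ((2 * pi)^-1)%:C * cintegral period phi.

Definition opS0 phi (t : R) : R[i] :=
  - ((2 * pi)^-1)%:C * cintegral period (fun z => (logker (t - z))%:C * phi z)
  + (0 +i* 1) * ((2 * pi)^-1)%:C * cintegral period phi.

Definition opS1 phi (t : R) : R[i] :=
  ((4 * pi)^-1)%:C *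
    cintegral period (fun z => (logker (t - z) * sin (t - z))%:C * phi z).

Definition opS2 phi (t : R) : R[i] :=
  - ((8 * pi)^-1)%:C *
    cintegral period (fun z => (logker (t - z) * sin (t - z) ^+ 2)%:C * phi z).

Definition T0 : (int -> R[i]) -> int -> R[i] := extend opT0.
Definition S0 : (int -> R[i]) -> int -> R[i] := extend opS0.
Definition S1 : (int -> R[i]) -> int -> R[i] := extend opS1.
Definition S2 : (int -> R[i]) -> int -> R[i] := extend opS2.

End integral_operators.

Section curve.
Context {R : realType}.
Implicit Types (g : R -> R * R) (f : R -> R).

Definition real_analytic f := forall t0 : R, exists (a : nat -> R) (r : R),
  0 < r /\ forall t, `|t - t0| < r -> pseries a (t - t0) @ \oo --> f t.

Definition dot (x y : R * R) : R := x.1 * y.1 + x.2 * y.2.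

Definition enorm (x : R * R) : R := Num.sqrt (dot x x).

Definition curve_deriv (n : nat) g (t : R) : R * R :=
  (derive1n n (fst \o g) t, derive1n n (snd \o g) t).

Definition normal_vector g (t : R) : R * R :=
  ((curve_deriv 1 g t).2, - (curve_deriv 1 g t).1).

Definition analytic_closed_curve g :=
  [/\ real_analytic (fst \o g) /\ real_analytic (snd \o g),
      forall t, g (t + 2 * pi) = g t,
      {in `[0, 2 * pi[ &, injective g} &
      forall t, 0 < enorm (curve_deriv 1 g t)].

End curve.

Section system_operators.
Context {R : realType}.
Variables (kappa : R) (g : R -> R * R).

Local Notation g' := (curve_deriv 1 g).
Local Notation g'' := (curve_deriv 2 g).
Local Notation g''' := (curve_deriv 3 g).

Definition mulop (a : R -> R) : (int -> R[i]) -> int -> R[i] :=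
  extend (fun phi t => (a t)%:C * phi t).

Definition E1 := mulop (fun t => kappa ^+ 2 * enorm (g' t) ^+ 2).
Definition E2 := mulop (fun t => kappa ^+ 2 * dot (normal_vector g t) (g'' t)).
Definition E3 := mulop (fun t => kappa ^+ 2 * dot (g' t) (g'' t)).
Definition E4 := mulop (fun t => - (kappa ^+ 4 * enorm (g' t) ^+ 4)
  + 2 * kappa ^+ 2 * dot (g' t) (g''' t)).
Definition E5 := mulop (fun t => - (3 / 4 * kappa ^+ 4 * enorm (g' t) ^+ 4)
  + kappa ^+ 2 * dot (g' t) (g''' t)).
Definition E6 := E4 \- E5.

Definition blockop {V : zmodType} (A B C D : V -> V) (x : V * V) : V * V :=
  (A x.1 + B x.2, C x.1 + D x.2).

Definition calN : (int -> R[i]) * (int -> R[i]) ->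
    (int -> R[i]) * (int -> R[i]) :=
  (blockop idfun  (fun=> 0)
           T0     -%R)
  \+
  (blockop (E2 \o S2)
           (S0 \+ (E1 \o S2))
           ((2^-1 \*: (E1 \o S0)) \+ (E3 \o S1) \+ (E6 \o S2))
           (-%R \o (E2 \o S2))).

Definition calU : (int -> R[i]) * (int -> R[i]) ->
    (int -> R[i]) * (int -> R[i]) :=
  blockop (idfun \+ (S0 \o T0) \+ (E1 \o S0 \o S0))  (fun=> 0)
          (fun=> 0)  (idfun \+ (T0 \o S0) \+ (E1 \o S0 \o S0)).

End system_operators.

(* Main.v *)
From HB Require Import structures.
Require Import Defs.
From mathcomp Require Import all_boot all_order all_algebra.
From mathcomp Require Import complex ring lra zify.
From mathcomp Require Import all_classical all_reals all_analysis.
From mathcomp Require Import measurable_realfun.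
Import Order.TTheory GRing.Theory Num.Theory numFieldNormedType.Exports.

(** Everything is read off Fourier coefficients. The operators T0, S0, S1, S2
    are convolutions, so they multiply the coefficient of frequency m by a
    symbol ([T0E], [S0E], [S1E], [S2E]). For large |m| the symbols of T0 and S0
    are - |m| and 1 / |m|, that of S1 has order - 2 and that of S2 order - 3.
    The analytic input is the value of two families of integrals: the Fourier
    coefficients of the logarithmic kernel ([fourier_logker]) and the principal
    values of the cotangent against sin (m s) ([cvg_pvcoef]).

    The symbols of S0 and T0 multiply to - 1 at every frequency, 0 included
    ([S0T0symb]); this is the role of the two rank one terms. Hence
    I + S0 T0 = I + T0 S0 = 0, and U is E1 S0 S0 on both components. Its inverse
    is T0 T0 preceded by multiplication by the inverse of kappa^2 |gamma'|^2,
    which is smooth because the parametrization is regular.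

    In the square of N the operators of order at least - 1 cancel, and those of
    order - 2 add up to E1 S0 S0, up to three kinds of remainders, all of order
    - 3 ([square_entries]): products that gain three orders outright;
    commutators of T0 with the multiplications E1 and E2, composed with
    operators gaining three orders; and S2 T0 - S0 S0 / 2, multiplied by E1,
    where the leading symbols 1 / (2 m^2) cancel ([opr_D]). So J = N^2 - U maps
    H^p boundedly into H^(p+3), which is compactly embedded in H^(p+2)
    ([compact_operator_gain]).

    Multiplication by a function a is the infinite matrix with entries
    a_(m-k). The coefficients of the curve are analytic, hence smooth
    ([real_analytic_smooth]), and their Fourier coefficients decay rapidly, so
    that Peetre's inequality and the Cauchy-Schwarz inequality bound the matrix
    on every H^q with q >= 0 ([opr_matrix]). The commutator with T0 has the
    entries (tau_m - tau_k) a_(m-k), and tau is Lipschitz, so it is bounded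
    without loss of an order ([opr_commutator]). That multiplications by a and
    by 1 / a are inverse to each other is checked on the exponentials, with the
    uniform convergence of their Fourier series ([mulop_inverse]). *)

Set Implicit Arguments.
Unset Strict Implicit.
Unset Printing Implicit Defensive.

Local Open Scope classical_set_scope.
Local Open Scope complex_scope.
Local Open Scope ring_scope.

(** * Affine substitutions and periodic integrands *)

Section change_of_variables.
Context {R : realType}.
Notation mu := (@lebesgue_measure R).

Lemma measurable_affine (a b : R) :
  measurable_fun [set: measurableTypeR R] (fun x : R => a * x + b : measurableTypeR R).
Proof. by apply: measurable_funD => //; exact: measurable_funM. Qed.

Lemma preimage_affine_oc (a b x y : R) : a != 0 ->
  mu ((fun z => a * z + b) @^-1` `]x, y]%classic) = (`|a|^-1%:E * mu `]x, y]%classic)%E.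
Proof.
move=> a0; rewrite !lebesgue_measure_itv/= !lte_fin.
have [agt0|alt0] := ltP 0 a.
  have -> : (fun z => a * z + b) @^-1` `]x, y] = `](x - b) / a, (y - b) / a]%classic.
    apply/seteqP; split => z/=; rewrite !in_itv/= ltr_pdivrMr// ler_pdivlMr// -ltrBlDr -lerBrDr (mulrC z)//.
  rewrite lebesgue_measure_itv/= lte_fin ltr_pM2r ?invr_gt0// ltrD2r gtr0_norm//.
  case: ifP => _; last by rewrite mule0.
  rewrite -EFinM -!EFinB; congr EFin; field. by rewrite gt_eqF.
have {}alt0 : a < 0 by rewrite lt_neqAle a0.
have -> : (fun z => a * z + b) @^-1` `]x, y] = `[(y - b) / a, (x - b) / a[%classic.
  apply/seteqP; split => z/=; rewrite !in_itv/= ler_ndivrMr// ltr_ndivlMr// -ltrBlDr -lerBrDr (mulrC z) andbC//.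
rewrite lebesgue_measure_itv/= lte_fin ltr_nM2r ?invr_lt0// ltrD2r ltr0_norm//.
case: ifP => _; last by rewrite mule0.
rewrite -EFinM -!EFinB; congr EFin; field. by rewrite lt_eqF.
Qed.

(** Lebesgue measure is determined by its values on half-open intervals; this is
    applied to the measure nu multiplied by c. *)
Lemma lebesgue_measure_unique_scale (nu : {measure set (measurableTypeR R) -> \bar R}) (c : R) :
  0 < c -> (forall x y : R, nu `]x, y]%classic = (c^-1%:E * mu `]x, y]%classic)%E) ->
  forall A : set R, measurable A -> nu A = (c^-1%:E * mu A)%E.
Proof.
move=> c0 H A mA.
have := @lebesgue_measure_unique R (mscale (PosNum c0)%:num%:nng nu) _ A mA.
rewrite /mscale/= => ->.
  by rewrite muleA -EFinM mulVf ?gt_eqF// mul1e.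
move=> _ [[x y] _ <-] /=.
by rewrite /mscale/= (H x y) muleA -EFinM mulfV ?gt_eqF// mul1e.
Qed.

Lemma lebesgue_measure_affine (a b : R) (A : set R) : a != 0 -> measurable A ->
  pushforward mu ((fun x => a * x + b) : _ -> measurableTypeR R) A = (`|a|^-1%:E * mu A)%E.
Proof.
move=> a0 mA; apply: lebesgue_measure_unique_scale => //.
- exact: measurable_affine.
- by rewrite normr_gt0.
- by move=> mphi x y; exact: preimage_affine_oc.
Qed.

Lemma ge0_integral_affine (a b : R) (D : set R) (f : R -> \bar R) : a != 0 -> measurable D ->
  measurable_fun D f -> (forall y, 0 <= f y)%E ->
  (\int[mu]_(x in D) f x =
  `|a|%:E * \int[mu]_(x in (fun z => (a * z + b)%R) @^-1` D) f (a * x + b)%R)%E.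
Proof.
move=> a0 mD mf f0.
have ap : 0 <= `|a|^-1 by rewrite invr_ge0.
have := @ge0_integral_pushforward _ _ _ (measurableTypeR R) R _ (measurable_affine a b) (@lebesgue_measure R) D f mD mf (fun x _ => f0 x).
rewrite /comp => <-.
rewrite [X in (_ * X)%E](@eq_measure_integral _ _ _ _ (mscale (NngNum ap) mu)); last first.
  by move=> mphi A mA _ /=; exact: lebesgue_measure_affine.
  exact: measurable_affine.
by rewrite ge0_integral_mscale//= muleA -EFinM mulfV ?normr_eq0// mul1e.
Qed.

Section periodic.
Variables (T : R) (T0 : 0 < T).

Lemma ge0_integral_shift (b : R) (D : set R) (f : R -> \bar R) : measurable D ->
  measurable_fun D f -> (forall y, 0 <= f y)%E ->
  (\int[mu]_(x in D) f x =
   \int[mu]_(x in (fun z => (z + b)%R) @^-1` D) f (x + b)%R)%E.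
Proof.
move=> mD mf f0; rewrite (@ge0_integral_affine 1 b)// ?oner_neq0//.
rewrite normr1 mul1e.
have -> : (fun z : R => 1 * z + b) = (fun z => z + b) by apply/funext => z; rewrite mul1r.
by under eq_integral do rewrite mul1r.
Qed.

Lemma shift_itv_oc (a x y : R) : (fun z => z + a) @^-1` `]x, y] = `]x - a, y - a]%classic.
Proof.
by apply/seteqP; split => z/=; rewrite !in_itv/= ltrBlDr lerBrDr.
Qed.

(** A translation by the largest multiple of T below c turns the interval of
    integration into [r, r + T] with 0 <= r < T. The part beyond T, moved back by
    T, fills the gap [0, r]. *)
Lemma ge0_integral_periodic (f : R -> \bar R) (c : R) :
  measurable_fun setT f -> (forall y, 0 <= f y)%E -> (forall y, f (y + T)%R = f y) ->
  (\int[mu]_(x in `[c, (c + T)%R]) f x = \int[mu]_(x in `[0%R, T]) f x)%E.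
Proof.
move=> mf f0 fT.
have mfS (D : set R) : measurable_fun D f by exact: measurable_funTS.
have fTn n y : f (y + n%:R * T) = f y.
  by elim: n y => [|n IH] y; rewrite ?mul0r ?addr0// -natr1 mulrDl mul1r addrA fT.
have fTz (m : int) y : f (y + m%:~R * T) = f y.
  case: m => n; first exact: fTn.
  by rewrite NegzE mulrNz mulNr -{2}(subrK (n.+1%:~R * T) y) fTn.
rewrite -!integral_itv_obnd_cbnd//.
pose m := Num.floor (c / T); pose r := c - m%:~R * T.
have r0 : 0 <= r by rewrite subr_ge0 -ler_pdivlMr// Num.Theory.floor_le_tmp.
have rT : r < T.
  rewrite ltrBlDl -{2}(mul1r T) -mulrDl -ltr_pdivrMr// -intrD1.
  exact: Num.Theory.floorD1_gt.
rewrite (@ge0_integral_shift (m%:~R * T) `]c, c + T])// shift_itv_oc.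
under eq_integral do rewrite fTz.
rewrite (addrAC c) -/r.
have -> : `]r, r + T]%classic = `]r, T] `|` `]T, r + T].
  by rewrite -itv_bndbnd_setU// bnd_simp ?lerDr// ltW.
have -> : `]0, T]%classic = `]0, r] `|` `]r, T].
  by rewrite -itv_bndbnd_setU// bnd_simp // ltW.
have disj a b : [disjoint `]a, b] & `]b, r + T] ]%classic /\ [disjoint `]a, b] & `]b, T] ]%classic.
  split; apply/disj_set2P; rewrite -subset0 => z/=; rewrite !in_itv/= => -[/andP[_ zr] /andP[]].
    by rewrite ltNge zr.
  by rewrite ltNge zr.
rewrite !ge0_integral_setU//; try by [exact: mfS | exact: (disj _ _).1 | exact: (disj _ _).2].
rewrite addeC; congr (_ + _)%E.
rewrite (@ge0_integral_shift T `]T, r + T])// shift_itv_oc subrr addrK.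
by apply: eq_integral => x _; exact: fT.
Qed.

Lemma integral_periodic (f : R -> \bar R) (c : R) :
  measurable_fun setT f -> (forall y, f (y + T)%R = f y) ->
  (\int[mu]_(x in `[c, (c + T)%R]) f x = \int[mu]_(x in `[0%R, T]) f x)%E.
Proof.
move=> mf fT; rewrite [LHS]integralE [RHS]integralE.
congr (_ - _)%E; apply: ge0_integral_periodic => //.
- exact: measurable_funepos.
- by move=> y; rewrite !funeposE fT.
- exact: measurable_funeneg.
- by move=> y; rewrite !funenegE fT.
Qed.

Lemma integral_affine (a b : R) (D : set R) (f : R -> \bar R) : a != 0 -> measurable D ->
  mu.-integrable D f ->
  (\int[mu]_(x in D) f x =
  `|a|%:E * \int[mu]_(x in (fun z => (a * z + b)%R) @^-1` D) f (a * x + b)%R)%E.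
Proof.
move=> a0 mD intf; have mf := measurable_int _ intf.
have fp := integrable_pos_fin_num _ intf.
have fn := integrable_neg_fin_num _ intf.
have hp := @ge0_integral_affine a b D f^\+%E a0 mD (measurable_funepos mf) (funepos_ge0 _).
have hn := @ge0_integral_affine a b D f^\-%E a0 mD (measurable_funeneg mf) (funeneg_ge0 _).
rewrite [LHS]integralE [X in (_ * X)%E]integralE.
have a1 : (`|a|%:E \is a fin_num)%E by [].
have ep : (fun x => f (a * x + b)%R)^\+%E = (fun x => f^\+ (a * x + b)%R)%E.
  by apply/funext => x; rewrite !funeposE.
have en : (fun x => f (a * x + b)%R)^\-%E = (fun x => f^\- (a * x + b)%R)%E.
  by apply/funext => x; rewrite !funenegE.
rewrite ep en muleBr//; first by rewrite -hp -hn.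
apply: fin_num_adde_defr.
move: fp => /(_ mD); rewrite hp.
have := @integral_ge0 _ _ _ mu ((fun z => (a * z + b)%R) @^-1` D) (fun x => f^\+ (a * x + b)%R)%E (fun x _ => funepos_ge0 _ _).
case: (integral _ _ _) => [r| |]//.
by rewrite gt0_muley// lte_fin normr_gt0.
Qed.

Lemma integral_periodic_reflect (f : R -> \bar R) (t : R) :
  measurable_fun setT f -> (forall y, f (y + T)%R = f y) ->
  (\int[mu]_(x in `[0%R, T]) f (t - x)%R = \int[mu]_(x in `[0%R, T]) f x)%E.
Proof.
move=> mf fT.
rewrite -(@integral_periodic f (t - T))// subrK.
have h g : measurable_fun setT g -> (forall y, 0 <= g y)%E ->
  (\int[mu]_(x in `[0%R, T]) g (t - x)%R = \int[mu]_(x in `[(t - T)%R, t]) g x)%E.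
  move=> mg g0; rewrite (@ge0_integral_affine (- 1) t `[t - T, t])//.
  - rewrite normrN normr1 mul1e.
    have -> : (fun z => -1 * z + t) @^-1` `[t - T, t] = `[0, T]%classic.
      by apply/seteqP; split => z/=; rewrite !in_itv/= mulN1r [- z + t]addrC lerD2l lerN2 gerBl andbC.
    by under [in RHS]eq_integral do rewrite mulN1r addrC.
  - exact: measurable_funTS.
rewrite [LHS]integralE [RHS]integralE.
rewrite -h//; last exact: measurable_funepos.
rewrite -h//; last exact: measurable_funeneg.
by congr (_ - _)%E; apply: eq_integral => x _; rewrite ?funeposE ?funenegE.
Qed.
End periodic.
End change_of_variables.

(** * Integration of complex functions *)

Section complex_integral.
Context {R : realType}.
Notation mu := (@lebesgue_measure R).
Notation normc := Normc.normc.
Implicit Types (f g : R -> R[i]) (D : set R) (M : R) (c : R[i]).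

Definition cintegrable D f :=
  mu.-integrable D (EFin \o (fun x => complex.Re (f x))) /\
  mu.-integrable D (EFin \o (fun x => complex.Im (f x))).

Definition cmeasurable f :=
  measurable_fun setT (fun x => complex.Re (f x)) /\
  measurable_fun setT (fun x => complex.Im (f x)).

Lemma ReM (x y : R[i]) : complex.Re (x * y) = complex.Re x * complex.Re y - complex.Im x * complex.Im y.
Proof. by case: x; case: y. Qed.
Lemma ImM (x y : R[i]) : complex.Im (x * y) = complex.Re x * complex.Im y + complex.Im x * complex.Re y.
Proof. by case: x; case: y. Qed.
Lemma ReD (x y : R[i]) : complex.Re (x + y) = complex.Re x + complex.Re y.
Proof. by case: x; case: y. Qed.
Lemma ImD (x y : R[i]) : complex.Im (x + y) = complex.Im x + complex.Im y.
Proof. by case: x; case: y. Qed.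
Lemma ReN (x : R[i]) : complex.Re (- x) = - complex.Re x.
Proof. by case: x. Qed.
Lemma ImN (x : R[i]) : complex.Im (- x) = - complex.Im x.
Proof. by case: x. Qed.
Lemma eq_ReIm (x y : R[i]) : complex.Re x = complex.Re y -> complex.Im x = complex.Im y -> x = y.
Proof. by case: x => a b; case: y => c d /= -> ->. Qed.

Lemma normc_ge0 (z : R[i]) : 0 <= normc z.
Proof. by case: z => a b; exact: sqrtr_ge0. Qed.

Lemma normRe (z : R[i]) : `|complex.Re z| <= normc z.
Proof.
by case: z => a b /=; rewrite -sqrtr_sqr ler_wsqrtr// lerDl sqr_ge0.
Qed.

Lemma normIm (z : R[i]) : `|complex.Im z| <= normc z.
Proof.
by case: z => a b /=; rewrite -sqrtr_sqr ler_wsqrtr// lerDr sqr_ge0.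
Qed.

Lemma normc_real (a : R) : normc a%:C = `|a|.
Proof. by rewrite /normc/= expr0n addr0 sqrtr_sqr. Qed.

Lemma normc_imag (a : R) : normc (0 +i* a) = `|a|.
Proof. by rewrite /normc/= expr0n add0r sqrtr_sqr. Qed.

Lemma normc_leReIm (z : R[i]) : normc z <= `|complex.Re z| + `|complex.Im z|.
Proof.
case: z => a b.
have -> : a +i* b = a%:C + (0 +i* b) by apply: eq_ReIm; rewrite /= ?addr0 ?add0r.
by rewrite (le_trans (le_normcD _ _))// normc_real normc_imag /= addr0 add0r.
Qed.

Lemma normc_sum (I : Type) (r : seq I) (P : pred I) (F : I -> R[i]) :
  normc (\sum_(i <- r | P i) F i) <= \sum_(i <- r | P i) normc (F i).
Proof.
elim/big_ind2 : _ => // [|x1 x2 y1 y2 h1 h2]; first by rewrite Normc.normc0.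
by rewrite (le_trans (le_normcD _ _))// lerD.
Qed.

Lemma eq_cintegral D f g : (forall x, D x -> f x = g x) ->
  cintegral D f = cintegral D g.
Proof.
move=> fg; rewrite /cintegral; congr (_ +i* _); apply: eq_Rintegral => x;
  by rewrite inE => Dx; rewrite fg.
Qed.

Lemma eq_cintegrable D f g : measurable D -> (forall x, D x -> f x = g x) ->
  cintegrable D f -> cintegrable D g.
Proof.
move=> mD fg [f1 f2]; split.
  by apply: eq_integrable f1 => // x; rewrite inE => Dx /=; rewrite fg.
by apply: eq_integrable f2 => // x; rewrite inE => Dx /=; rewrite fg.
Qed.

Lemma cintegrableD D f g : measurable D -> cintegrable D f -> cintegrable D g ->
  cintegrable D (fun x => f x + g x).
Proof.
move=> mD [f1 f2] [g1 g2]; split.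
  rewrite (_ : _ \o _ = (EFin \o (fun x => complex.Re (f x))) \+ (EFin \o (fun x => complex.Re (g x))))%E.
    exact: integrableD.
  by apply/funext => x /=; rewrite ReD EFinD.
rewrite (_ : _ \o _ = (EFin \o (fun x => complex.Im (f x))) \+ (EFin \o (fun x => complex.Im (g x))))%E.
  exact: integrableD.
by apply/funext => x /=; rewrite ImD EFinD.
Qed.

Lemma cintegralD D f g : measurable D -> cintegrable D f -> cintegrable D g ->
  cintegral D (fun x => f x + g x) = cintegral D f + cintegral D g.
Proof.
move=> mD [f1 f2] [g1 g2]; apply: eq_ReIm => /=.
  by under eq_Rintegral do rewrite ReD; rewrite RintegralD.
by under eq_Rintegral do rewrite ImD; rewrite RintegralD.
Qed.

Lemma integrableZR D (h : R -> R) (c : R) : measurable D ->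
  mu.-integrable D (EFin \o h) -> mu.-integrable D (EFin \o (fun x => c * h x)).
Proof.
move=> mD ih.
rewrite (_ : _ \o _ = (fun x => c%:E * (EFin \o h) x))%E; last by apply/funext => x; rewrite /= EFinM.
exact: integrableZl.
Qed.

Lemma cintegrableZ D f c : measurable D -> cintegrable D f -> cintegrable D (fun x => c * f x).
Proof.
move=> mD [f1 f2]; split.
  rewrite (_ : _ \o _ = (EFin \o (fun x => complex.Re c * complex.Re (f x))%R) \+ (EFin \o (fun x => - complex.Im c * complex.Im (f x))%R))%E.
    by apply: integrableD => //; exact: integrableZR.
  by apply/funext => x /=; rewrite ReM -EFinD mulNr.
rewrite (_ : _ \o _ = (EFin \o (fun x => complex.Re c * complex.Im (f x))%R) \+ (EFin \o (fun x => complex.Im c * complex.Re (f x))%R))%E.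
  by apply: integrableD => //; exact: integrableZR.
by apply/funext => x /=; rewrite ImM -EFinD.
Qed.

Lemma cintegralZ D f c : measurable D -> cintegrable D f ->
  cintegral D (fun x => c * f x) = c * cintegral D f.
Proof.
move=> mD [f1 f2]; apply: eq_ReIm.
  rewrite ReM /=; under eq_Rintegral do rewrite ReM -mulNr.
  by rewrite RintegralD//; try exact: integrableZR; rewrite !RintegralZl// mulNr.
rewrite ImM /=; under eq_Rintegral do rewrite ImM.
by rewrite RintegralD//; try exact: integrableZR; rewrite !RintegralZl.
Qed.

Lemma cintegrable0 D : cintegrable D (fun=> 0).
Proof. by split; exact: integrable0. Qed.

Lemma cintegral0 D : cintegral D (fun=> 0) = 0.
Proof.
rewrite /cintegral /Rintegral.
by congr (_ +i* _); rewrite /= integral0.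
Qed.

Lemma cintegrable_sum D (I : Type) (r : seq I) (F : I -> R -> R[i]) : measurable D ->
  (forall i, cintegrable D (F i)) -> cintegrable D (fun x => \sum_(i <- r) F i x).
Proof.
move=> mD iF; elim: r => [|i r IH].
  by apply: eq_cintegrable (cintegrable0 D) => // x _; rewrite big_nil.
apply: eq_cintegrable (cintegrableD mD (iF i) IH) => // x _.
by rewrite big_cons.
Qed.

Lemma cintegral_sum D (I : Type) (r : seq I) (F : I -> R -> R[i]) : measurable D ->
  (forall i, cintegrable D (F i)) ->
  cintegral D (fun x => \sum_(i <- r) F i x) = \sum_(i <- r) cintegral D (F i).
Proof.
move=> mD iF; elim: r => [|i r IH].
  by rewrite big_nil -[RHS](cintegral0 D); apply: eq_cintegral => x _; rewrite big_nil.
rewrite big_cons -IH -cintegralD//; last exact: cintegrable_sum.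
by apply: eq_cintegral => x _; rewrite big_cons.
Qed.

Lemma cmeasurableD f g : cmeasurable f -> cmeasurable g -> cmeasurable (fun x => f x + g x).
Proof.
move=> [f1 f2] [g1 g2]; split.
  by under eq_fun do rewrite ReD; exact: measurable_funD.
by under eq_fun do rewrite ImD; exact: measurable_funD.
Qed.

Lemma cmeasurableM f g : cmeasurable f -> cmeasurable g -> cmeasurable (fun x => f x * g x).
Proof.
move=> [f1 f2] [g1 g2]; split.
  by under eq_fun do rewrite ReM; apply: measurable_funB; exact: measurable_funM.
by under eq_fun do rewrite ImM; apply: measurable_funD; exact: measurable_funM.
Qed.

Lemma cmeasurable_cst (c : R[i]) : cmeasurable (fun=> c).
Proof. by split; exact: measurable_cst. Qed.

Lemma cmeasurable_real (h : R -> R) : measurable_fun setT h -> cmeasurable (fun x => (h x)%:C).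
Proof. by move=> mh; split => //=; exact: measurable_cst. Qed.

Lemma bounded_by D (h : R -> R) M : (forall x, D x -> `|h x| <= M) -> [bounded h x | x in D].
Proof.
move=> hM; exists M; split; first exact: num_real.
by move=> y My x Dx /=; apply: le_trans (hM _ Dx) _; exact: ltW.
Qed.

Lemma cintegrable_bounded D f M : measurable D -> (mu D < +oo)%E -> cmeasurable f ->
  (forall x, D x -> normc (f x) <= M) -> cintegrable D f.
Proof.
move=> mD Dfin [f1 f2] fM; split; apply: measurable_bounded_integrable => //.
- exact: measurable_funTS.
- by apply: (@bounded_by _ _ M) => x Dx; rewrite (le_trans (normRe _))// fM.
- exact: measurable_funTS.
- by apply: (@bounded_by _ _ M) => x Dx; rewrite (le_trans (normIm _))// fM.
Qed.

Lemma cintegrableM D f g M : measurable D -> cintegrable D f -> cmeasurable g ->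
  (forall x, D x -> normc (g x) <= M) -> cintegrable D (fun x => f x * g x).
Proof.
move=> mD [f1 f2] [g1 g2] gM.
have b1 : [bounded (fun x => complex.Re (g x)) x | x in D].
  by apply: (@bounded_by _ _ M) => x Dx; rewrite (le_trans (normRe _))// gM.
have b2 : [bounded (fun x => complex.Im (g x)) x | x in D].
  by apply: (@bounded_by _ _ M) => x Dx; rewrite (le_trans (normIm _))// gM.
have m1 := measurable_funTS g1 (D := D); have m2 := measurable_funTS g2 (D := D).
have h11 := @integrableMl _ _ _ mu D mD _ _ f1 m1 b1; have h12 := @integrableMl _ _ _ mu D mD _ _ f1 m2 b2.
have h21 := @integrableMl _ _ _ mu D mD _ _ f2 m1 b1; have h22 := @integrableMl _ _ _ mu D mD _ _ f2 m2 b2.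
split.
  by apply: eq_integrable (@integrableB _ _ _ mu D mD _ _ h11 h22) => // x _ /=; rewrite ReM.
by apply: eq_integrable (@integrableD _ _ _ mu D mD _ _ h12 h21) => // x _ /=; rewrite ImM.
Qed.

Lemma normr_Rintegral_le D (h : R -> R) M : measurable D -> (mu D < +oo)%E ->
  mu.-integrable D (EFin \o h) ->
  (forall x, D x -> `|h x| <= M) -> `|(\int[mu]_(x in D) h x)| <= M * fine (mu D).
Proof.
move=> mD Dfin ih hM.
rewrite (le_trans (le_normr_Rintegral _ _))//.
rewrite -Rintegral_cst//; apply: le_Rintegral => //.
  exact: (integrable_norm ih).
apply: measurable_bounded_integrable => //; apply: (@bounded_by _ _ `|M|) => x _.
exact: lexx.
Qed.

(** Real and imaginary parts are bounded separately, whence the factor 2. *)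
Lemma normc_cintegral D f M : measurable D -> (mu D < +oo)%E -> cintegrable D f ->
  (forall x, D x -> normc (f x) <= M) ->
  normc (cintegral D f) <= 2 * (M * fine (mu D)).
Proof.
move=> mD Dfin [f1 f2] fM; rewrite (le_trans (normc_leReIm _))//= mulr2n mulrDl mul1r.
apply: lerD; apply: normr_Rintegral_le => // x Dx.
  by rewrite (le_trans (normRe _))// fM.
by rewrite (le_trans (normIm _))// fM.
Qed.

End complex_integral.

(** * Periodic functions and exponentials *)

Section periodic_functions.
Context {R : realType}.
Notation mu := (@lebesgue_measure R).
Notation normc := Normc.normc.
Implicit Types (f g : R -> R[i]).

Lemma twopi_gt0 : 0 < 2 * pi :> R.
Proof. by rewrite mulr_gt0// pi_gt0. Qed.
Hint Resolve twopi_gt0 : core.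

Lemma measurable_period : measurable (@period R).
Proof. exact: measurable_itv. Qed.
Hint Resolve measurable_period : core.

Lemma mu_period : mu period = (2 * pi)%:E.
Proof. by rewrite /period lebesgue_measure_itv/= lte_fin twopi_gt0 oppr0 adde0. Qed.

Lemma mu_period_fin : (mu period < +oo)%E.
Proof. by rewrite mu_period ltry. Qed.
Hint Resolve mu_period_fin : core.

Definition periodic {T} (f : R -> T) := forall x, f (x + 2 * pi) = f x.

Lemma periodicz {T} (f : R -> T) (k : int) x : periodic f -> f (x + 2 * pi * k%:~R) = f x.
Proof.
move=> fT.
have fTn (n : nat) y : f (y + 2 * pi * n%:R) = f y.
  by elim: n y => [|n IH] y; rewrite ?mulr0 ?addr0// -[n.+1%:R]natr1 mulrDr mulr1 addrA fT.
case: k => n; first exact: fTn.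
by rewrite NegzE mulrNz mulrN -{2}(subrK (2 * pi * n.+1%:~R) x) fTn.
Qed.

Lemma periodic_reduce (x : R) : exists k : int, `|x - 2 * pi * k%:~R| <= pi.
Proof.
exists (Num.floor ((x + pi) / (2 * pi))).
set k := Num.floor _.
have h1 : k%:~R <= (x + pi) / (2 * pi) by exact: Num.Theory.floor_le_tmp.
have h2 : (x + pi) / (2 * pi) < k%:~R + 1 by rewrite -intrD1; exact: Num.Theory.floorD1_gt.
rewrite ler_pdivlMr// in h1; rewrite ltr_pdivrMr// in h2.
by rewrite ler_norml; apply/andP; split; lra.
Qed.

Lemma cintegral_reflect f (t : R) : cmeasurable f -> periodic f ->
  cintegral period (fun z => f (t - z)) = cintegral period f.
Proof.
move=> [m1 m2] pf.
have h (h : R -> R) : measurable_fun setT h -> periodic h ->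
    \int[mu]_(x in period) h (t - x) = \int[mu]_(x in period) h x.
  move=> mh ph; rewrite /Rintegral.
  have mh' : measurable_fun setT (EFin \o h) by exact/measurable_EFinP.
  congr fine; apply: (integral_periodic_reflect twopi_gt0 (f := EFin \o h) t mh').
  by move=> y /=; rewrite ph.
rewrite /cintegral; congr (_ +i* _).
  by apply: (h (fun x => complex.Re (f x))) => // x; rewrite pf.
by apply: (h (fun x => complex.Im (f x))) => // x; rewrite pf.
Qed.

Lemma cintegrable_reflect f (t : R) : cmeasurable f -> periodic f ->
  cintegrable period f -> cintegrable period (fun z => f (t - z)).
Proof.
move=> mf pf [i1 i2].
have h (h : R -> R) : measurable_fun setT h -> periodic h ->
    mu.-integrable period (EFin \o h) -> mu.-integrable period (EFin \o (fun z => h (t - z))).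
  move=> mh ph /integrableP[_ ih].
  have mh' : measurable_fun setT (EFin \o h) by exact/measurable_EFinP.
  apply/integrableP; split.
    apply/measurable_EFinP; apply: measurable_funTS.
    apply: (measurableT_comp mh); apply: measurable_funB => //; exact: measurable_cst.
  rewrite (integral_periodic_reflect twopi_gt0 (f := fun x => `|(EFin \o h) x|%E) t)//.
    exact: measurableT_comp.
  by move=> y /=; rewrite ph.
have [m1 m2] := mf; split.
  by apply: (h (fun x => complex.Re (f x))) => // x; rewrite pf.
by apply: (h (fun x => complex.Im (f x))) => // x; rewrite pf.
Qed.

Lemma expiD (a b : R) : expi (a + b) = expi a * expi b.
Proof. by apply: eq_ReIm; rewrite ?ReM ?ImM /= ?cosD ?sinD// addrC. Qed.

Lemma expi0 : expi 0 = 1 :> R[i].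
Proof. by rewrite /expi cos0 sin0. Qed.

Lemma normc_expi (a : R) : normc (expi a) = 1.
Proof. by rewrite /= cos2Dsin2 sqrtr1. Qed.

Lemma periodic_cos : periodic (@cos R).
Proof. by move=> x; rewrite mulrC mulr_natr cosD2pi. Qed.

Lemma periodic_sin : periodic (@sin R).
Proof. by move=> x; rewrite mulrC mulr_natr sinD2pi. Qed.

Lemma expi_twopi (m : int) : expi (m%:~R * (2 * pi)) = 1 :> R[i].
Proof.
by rewrite /expi -[X in cos X]add0r -[X in sin X]add0r ![m%:~R * _]mulrC
  (periodicz _ _ periodic_cos) (periodicz _ _ periodic_sin) cos0 sin0.
Qed.

Lemma periodic_expi (m : int) : periodic (fun t : R => expi (m%:~R * t)).
Proof. by move=> x; rewrite mulrDr expiD expi_twopi mulr1. Qed.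

Lemma cmeasurable_expi (a : R) : cmeasurable (fun t => expi (a * t)).
Proof.
split => /=; apply: continuous_measurable_fun => x.
  apply: (@continuous_comp _ _ _ (fun t => a * t) cos); last exact: continuous_cos.
  by apply: continuousM => //; exact: cst_continuous.
apply: (@continuous_comp _ _ _ (fun t => a * t) sin); last exact: continuous_sin.
by apply: continuousM => //; exact: cst_continuous.
Qed.

Lemma der1D (f g : R -> R) (x a b : R) : is_derive x 1 f a -> is_derive x 1 g b ->
  is_derive x 1 (fun t => f t + g t) (a + b).
Proof. by move=> ? ?; exact: is_deriveD. Qed.

Lemma der1B (f g : R -> R) (x a b : R) : is_derive x 1 f a -> is_derive x 1 g b ->
  is_derive x 1 (fun t => f t - g t) (a - b).
Proof. by move=> ? ?; exact: is_deriveB. Qed.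

Lemma der1M (f g : R -> R) (x a b : R) : is_derive x 1 f a -> is_derive x 1 g b ->
  is_derive x 1 (fun t => f t * g t) (a * g x + f x * b).
Proof.
move=> ? ?; apply: is_derive_eq; rewrite addrC; congr (_ + _).
by rewrite mulrC.
Qed.

Lemma der1_comp (f g : R -> R) (x a b : R) : is_derive (g x) 1 f a -> is_derive x 1 g b ->
  is_derive x 1 (fun t => f (g t)) (b * a).
Proof. by move=> ? ?; rewrite mulrC; exact: is_derive1_comp. Qed.

Lemma der1_cst (c x : R) : is_derive x 1 (fun _ : R => c) 0.
Proof. exact: is_derive_cst. Qed.

Lemma der1_id (x : R) : is_derive x 1 (fun t : R => t) 1.
Proof. exact: is_derive_id. Qed.

Lemma der1Z (c : R) (f : R -> R) (x a : R) : is_derive x 1 f a ->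
  is_derive x 1 (fun t => c * f t) (c * a).
Proof.
by move=> df; have := der1M (der1_cst c x) df; rewrite mul0r add0r.
Qed.

Lemma der1_cosM (a x : R) : is_derive x 1 (fun t => cos (a * t)) (- (a * sin (a * x))).
Proof.
have := der1_comp (is_derive_cos (a * x)) (der1Z a (der1_id x)).
by rewrite mulr1 mulrN.
Qed.

Lemma der1_sinM (a x : R) : is_derive x 1 (fun t => sin (a * t)) (a * cos (a * x)).
Proof.
by have := der1_comp (is_derive_sin (a * x)) (der1Z a (der1_id x)); rewrite mulr1.
Qed.

Lemma der1_continuous (f : R -> R) (x a : R) : is_derive x 1 f a -> {for x, continuous f}.
Proof.
by move=> [df _]; apply: differentiable_continuous; apply/derivable1_diffP.
Qed.

Definition cder (f : R -> R[i]) (x : R) (d : R[i]) :=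
  is_derive x 1 (fun t => complex.Re (f t)) (complex.Re d) /\
  is_derive x 1 (fun t => complex.Im (f t)) (complex.Im d).

Definition ccontinuous (f : R -> R[i]) :=
  continuous (fun t => complex.Re (f t)) /\ continuous (fun t => complex.Im (f t)).

Lemma cder_cderive f x d : cder f x d -> cderive f x = d.
Proof.
move=> [h1 h2]; rewrite /cderive !derive1E; apply: eq_ReIm => /=; exact: derive_val.
Qed.

Lemma cder_cst (c : R[i]) x : cder (fun=> c) x 0.
Proof. by split; exact: der1_cst. Qed.

Lemma cderD f g x a b : cder f x a -> cder g x b -> cder (fun t => f t + g t) x (a + b).
Proof.
move=> [f1 f2] [g1 g2]; split.
  by under eq_fun do rewrite ReD; rewrite ReD; exact: der1D.
by under eq_fun do rewrite ImD; rewrite ImD; exact: der1D.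
Qed.

Lemma cderM f g x a b : cder f x a -> cder g x b -> cder (fun t => f t * g t) x (a * g x + f x * b).
Proof.
move=> [f1 f2] [g1 g2]; split.
  under eq_fun do rewrite ReM; have := der1B (der1M f1 g1) (der1M f2 g2).
  by congr is_derive; rewrite !(ReM, ReD, ImM, ImD)/=; ring.
under eq_fun do rewrite ImM; have := der1D (der1M f1 g2) (der1M f2 g1).
by congr is_derive; rewrite !(ReM, ReD, ImM, ImD)/=; ring.
Qed.

Lemma cderZ f x c a : cder f x a -> cder (fun t => c * f t) x (c * a).
Proof. by move=> df; have := cderM (cder_cst c x) df; rewrite mul0r add0r. Qed.

Lemma cder_sum (I : Type) (r : seq I) (F : I -> R -> R[i]) x (a : I -> R[i]) :
  (forall i, cder (F i) x (a i)) -> cder (fun t => \sum_(i <- r) F i t) x (\sum_(i <- r) a i).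
Proof.
move=> dF; elim: r => [|i r IH].
  rewrite big_nil (_ : (fun t => _) = fun=> 0); first exact: cder_cst.
  by apply/funext => t; rewrite big_nil.
rewrite big_cons (_ : (fun t => _) = fun t => F i t + \sum_(i <- r) F i t); first exact: cderD.
by apply/funext => t; rewrite big_cons.
Qed.

Lemma cder_expi (a x : R) : cder (fun t => expi (a * t)) x ((0 +i* a) * expi (a * x)).
Proof.
split => /=; rewrite !mul0r ?sub0r ?add0r.
  exact: der1_cosM.
exact: der1_sinM.
Qed.

Lemma cder_real (f : R -> R) (x a : R) : is_derive x 1 f a -> cder (fun t => (f t)%:C) x a%:C.
Proof. by move=> df; split => //=; exact: der1_cst. Qed.

Lemma cder_continuous f f' : (forall x, cder f x (f' x)) -> ccontinuous f.
Proof.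
by move=> df; split=> x; [case: (df x) => + _|case: (df x) => _ +]; exact: der1_continuous.
Qed.

Lemma continuousMf (f g : R -> R) : continuous f -> continuous g -> continuous (fun t => f t * g t).
Proof. by move=> cf cg x; apply: cvgM; [exact: cf|exact: cg]. Qed.

Lemma continuousDf (f g : R -> R) : continuous f -> continuous g -> continuous (fun t => f t + g t).
Proof. by move=> cf cg x; apply: cvgD; [exact: cf|exact: cg]. Qed.

Lemma continuousNf (f : R -> R) : continuous f -> continuous (fun t => - f t).
Proof. by move=> cf x; apply: cvgN; exact: cf. Qed.

Lemma ccontinuousM f g : ccontinuous f -> ccontinuous g -> ccontinuous (fun t => f t * g t).
Proof.
move=> [f1 f2] [g1 g2]; split.
  under eq_fun do rewrite ReM; apply: continuousDf; last apply: continuousNf; exact: continuousMf.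
by under eq_fun do rewrite ImM; apply: continuousDf; exact: continuousMf.
Qed.

Lemma ccontinuousD f g : ccontinuous f -> ccontinuous g -> ccontinuous (fun t => f t + g t).
Proof.
move=> [f1 f2] [g1 g2]; split.
  by under eq_fun do rewrite ReD; apply: continuousDf.
by under eq_fun do rewrite ImD; apply: continuousDf.
Qed.

Lemma ccontinuous_cst (c : R[i]) : ccontinuous (fun=> c).
Proof. by split => x; exact: cst_continuous. Qed.

Lemma ccontinuous_expi (a : R) : ccontinuous (fun t => expi (a * t)).
Proof. exact: (cder_continuous (cder_expi a)). Qed.

Lemma ccontinuous_real (f : R -> R) : continuous f -> ccontinuous (fun t => (f t)%:C).
Proof. by move=> cf; split => //= x; exact: cst_continuous. Qed.

Lemma ccontinuous_measurable f : ccontinuous f -> cmeasurable f.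
Proof. by move=> [f1 f2]; split; exact: continuous_measurable_fun. Qed.

Lemma ccontinuous_integrable f : ccontinuous f -> cintegrable period f.
Proof.
move=> [f1 f2]; split; apply: continuous_compact_integrable.
- exact: segment_compact.
- exact: continuous_subspaceT.
- exact: segment_compact.
- exact: continuous_subspaceT.
Qed.

Lemma Rintegral_FTC2 (F F' : R -> R) (a b : R) : a < b ->
  (forall x : R, is_derive x 1 F (F' x)) -> continuous F' ->
  \int[mu]_(x in `[a, b]) F' x = F b - F a.
Proof.
move=> ab dF cF'.
have cF : continuous F by move=> x; exact: der1_continuous.
rewrite /Rintegral (@continuous_FTC2 _ F' F)//.
- exact: continuous_subspaceT.
- split => //.
  + by apply: cvg_at_right_filter; exact: cF.
  + by apply: cvg_at_left_filter; exact: cF.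
- by move=> x _; rewrite derive1E; apply: derive_val.
Qed.

Lemma cintegral_FTC2 (F F' : R -> R[i]) :
  (forall x : R, cder F x (F' x)) -> ccontinuous F' ->
  cintegral period F' = F (2 * pi) - F 0.
Proof.
move=> dF [cr ci]; apply: eq_ReIm; rewrite /= ?ReD ?ImD ?ReN ?ImN /period.
  by apply: (@Rintegral_FTC2 (fun x => complex.Re (F x)) (fun x => complex.Re (F' x))) => // x; case: (dF x).
by apply: (@Rintegral_FTC2 (fun x => complex.Im (F x)) (fun x => complex.Im (F' x))) => // x; case: (dF x).
Qed.

Lemma cintegral_expi (m : int) :
  cintegral period (fun t => expi (m%:~R * t)) = (if m == 0 then 2 * pi else 0 : R)%:C.
Proof.
case: eqP => [->|/eqP m0].
  transitivity (cintegral period (fun=> 1 : R[i])).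
    by apply: eq_cintegral => x _; rewrite mul0r expi0.
  have h : fine ((lebesgue_measure : {measure set _ -> \bar R}) period) = 2 * pi by exact: (congr1 fine mu_period).
  by apply: eq_ReIm; rewrite /= Rintegral_cst// h ?mul1r ?mul0r.
have mR : m%:~R != 0 :> R by rewrite intr_eq0.
have m0i : (0 +i* m%:~R) != 0 :> R[i] by apply: contra mR => /eqP [] ->.
rewrite (@cintegral_FTC2 (fun t => (0 +i* m%:~R)^-1 * expi (m%:~R * t))).
- by rewrite expi_twopi mulr0 expi0 subrr.
- move=> x; have := cderZ (0 +i* m%:~R)^-1 (cder_expi m%:~R x).
  by rewrite mulKf.
- exact: ccontinuous_expi.
Qed.

End periodic_functions.

(** * Integrands unbounded at the endpoints *)

Section improper.
Context {R : realType}.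
Notation mu := (@lebesgue_measure R).

(** On the open interval the integral function of f and F have the same
    derivative; both are continuous up to the endpoints, so their difference is
    constant on the closed interval. Only the interior behaviour of f enters,
    which is what a logarithmic singularity at the endpoints requires. *)
Lemma improper_FTC2 (f F : R -> R) (a b : R) : a < b ->
  mu.-integrable `[a, b] (EFin \o f) ->
  (forall x, a < x < b -> is_derive x 1 F (f x)) ->
  (forall x, a < x < b -> {for x, continuous f}) ->
  continuous F -> \int[mu]_(x in `[a, b]) f x = F b - F a.
Proof.
move=> ab fi dF cf cF.
pose G x := \int[mu]_(t in `[a, x]) f t.
have dG x : a < x < b -> is_derive x 1 G (f x).
  move=> /[dup] xab /andP[ax xb].
  have [h1 h2] := @continuous_FTC1_closed R f a x b xb fi ax (cf x xab).
  by apply: DeriveDef; [exact: h1|rewrite -derive1E; exact: h2].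
have cG : {within `[a, b], continuous G}.
  exact: (parameterized_integral_continuous (ltW ab) fi).
have [||c _] := @MVT R (fun x => F x - G x) (fun=> 0) a b ab.
- move=> x; rewrite in_itv/= => xab; rewrite -(subrr (f x)).
  by apply: der1B; [exact: dF|exact: dG].
- move=> x; apply: cvgB; last exact: cG.
  exact: (continuous_subspaceT cF).
rewrite mul0r => /eqP; rewrite subr_eq0 => /eqP.
have -> : G a = 0 by rewrite /G set_itv1 Rintegral_set1.
by rewrite subr0 => <-; rewrite subKr.
Qed.

(** The integrals of f over an exhausting sequence of compact subintervals are
    increments of F, hence at most the oscillation of F on [a, b]; monotone
    convergence does the rest. *)
Lemma improper_integrable (f F : R -> R) (a b : R) : a < b ->
  (forall x, a < x < b -> 0 <= f x) -> measurable_fun setT f ->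
  (forall x, a < x < b -> is_derive x 1 F (f x)) ->
  (forall x, a < x < b -> {for x, continuous f}) ->
  continuous F -> mu.-integrable `[a, b] (EFin \o f).
Proof.
move=> ab f0 mf dF cf cF.
have mfE (D : set R) : measurable_fun D (EFin \o f) by exact/measurable_funTS/measurable_EFinP.
apply/integrableP; split; first exact: mfE.
have mfA (D : set R) : measurable_fun D (fun x => `|(EFin \o f) x|%E) by apply: measurableT_comp => //; exact: mfE.
rewrite -(@integral_itv_obnd_cbnd R a (BRight b) (fun x => `|(EFin \o f) x|%E) (mfA _)).
rewrite -(@integral_itv_bndo_bndc R (BRight a) b (fun x => `|(EFin \o f) x|%E) (mfA _)).
pose e n : R := (b - a) / 2 / n.+2%:R.
have e0 n : 0 < e n by rewrite /e !divr_gt0// subr_gt0.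
have e1 n : e n < (b - a) / 2.
  by rewrite /e ltr_pdivrMr// ltr_pMr ?divr_gt0 ?subr_gt0// ltr1n.
pose I n : set R := `[a + e n, b - e n]%classic.
have IE : `]a, b[%classic = \bigcup_n I n.
  apply/seteqP; split => x /=; last first.
    move=> [n _]; rewrite /I/= !in_itv/= => /andP[h1 h2]; have := e0 n; lra.
  rewrite in_itv/= => /andP[ax xb].
  pose d := Num.min (x - a) (b - x).
  have d0 : 0 < d by rewrite lt_min !subr_gt0 ax xb.
  exists (Num.trunc ((b - a) / 2 / d)) => //; rewrite /I/= in_itv/=.
  have : e (Num.trunc ((b - a) / 2 / d)) <= d.
    rewrite /e ler_pdivrMr// -ler_pdivrMl// mulrC.
    apply: le_trans (ltW (truncnS_gt _)) _; by rewrite ler_nat.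
  rewrite /d le_min => /andP[h1 h2]; apply/andP; split; lra.
rewrite IE.
have nnI : nondecreasing_seq I.
  move=> m n mn; apply/subsetPset => x; rewrite /I/= !in_itv/= => /andP[h1 h2].
  have : e n <= e m.
    rewrite /e ler_pM2l ?divr_gt0 ?subr_gt0// lef_pV2 ?posrE// ler_nat//.
  by move=> h; apply/andP; split; lra.
have mI n : measurable (I n) by exact: measurable_itv.
have cvgI := @ge0_nondecreasing_set_cvg_integral _ (measurableTypeR R) R I (fun x => `|(EFin \o f) x|%E) mu nnI mI (fun i => mfA (I i)) (fun i x _ => abse_ge0 _).
have cFab : {within `[a, b], continuous F} by exact: continuous_subspaceT.
have [x1 _ x1P] := EVT_max (ltW ab) cFab; have [x2 _ x2P] := EVT_min (ltW ab) cFab.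
apply: (@le_lt_trans _ _ (F x1 - F x2)%:E); last exact: ltry.
rewrite -(cvg_lim _ cvgI)//; apply: lime_le; first by apply/cvg_ex; eexists; exact: cvgI.
apply: nearW => n /=.
have abn : a + e n < b - e n by have := e1 n; lra.
have sub x : a + e n <= x <= b - e n -> a < x < b by have := e0 n; lra.
have -> : (\int[mu]_(x in I n) `|f x|%:E = \int[mu]_(x in I n) (f x)%:E)%E.
  apply: eq_integral => x; rewrite inE /I/= in_itv/= => /sub /f0 h.
  by rewrite ger0_norm.
rewrite (@continuous_FTC2 _ f F)//.
- rewrite lee_fin lerB//; [apply: x1P|apply: x2P]; rewrite in_itv/=; have := e0 n; lra.
- apply: continuous_in_subspaceT => x; rewrite inE/= in_itv/= => /sub; exact: cf.
- split.
  + by move=> x; rewrite in_itv/= => /andP[h1 h2]; case: (dF x) => //; apply: sub; rewrite !ltW.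
  + by apply: cvg_at_right_filter; exact: cF.
  + by apply: cvg_at_left_filter; exact: cF.
- move=> x; rewrite in_itv/= => /andP[h1 h2]; rewrite derive1E.
  by case: (dF x) => //; apply: sub; rewrite !ltW.
Qed.
End improper.

(** * Fourier coefficients of the logarithmic kernel *)

Section log_kernel.
Context {R : realType}.
Notation mu := (@lebesgue_measure R).
Notation normc := Normc.normc.

(** A logarithmic singularity times a simple zero. With ln 0 = 0 the value at 0
    is the limit, so that this is a continuous function. *)
Definition ylny2 (y : R) := y * ln (y ^+ 2).

(** In terms of x = sqrt |y| the product is 4 x (x ln x), and - ln x <= 1 / x. *)
Lemma ylny2_le (y : R) : `|y| < 1 -> `|ylny2 y| <= 4 * Num.sqrt `|y|.
Proof.
move=> y1; have [->|y0] := eqVneq y 0; first by rewrite /ylny2 mul0r normr0 mulr_ge0.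
set x := Num.sqrt `|y|.
have x0 : 0 < x by rewrite sqrtr_gt0 normr_gt0.
have yx : `|y| = x ^+ 2 by rewrite sqr_sqrtr.
have x1 : x < 1 by rewrite -sqrtr1 ltr_sqrt.
rewrite /ylny2 normrM -(real_normK (num_real y)) yx -exprM lnXn//.
have lx0 : ln x < 0 by rewrite ln_lt0// x0.
rewrite (ler0_norm (mulrn_wle0 _ (ltW lx0))).
have h : - ln x <= x^-1.
  by rewrite -lnV ?posrE//; apply/ltW/ln_sublinear; rewrite invr_gt0.
have -> : x ^+ 2 * - (ln x *+ (2 * 2)) = (4 * x) * (x * - ln x).
  by rewrite -mulr_natl; ring.
rewrite -[leRHS]mulr1 ler_pM2l ?mulr_gt0//.
have x00 : x != 0 by rewrite gt_eqF.
by rewrite -(mulfV x00) ler_pM2l.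
Qed.

Lemma ylny2_continuous : continuous ylny2.
Proof.
move=> y; have [->|y0] := eqVneq y 0.
  rewrite /continuous_at {2}/ylny2 mul0r.
  apply/cvgr0Pnorm_le => e e0.
  have h : 4 * Num.sqrt `|z| @[z --> (0 : R)] --> 4 * Num.sqrt `|0 : R|.
    apply: cvgMr; apply: (@continuous_comp _ _ _ (fun z : R => `|z|) Num.sqrt).
      exact: norm_continuous.
    exact: sqrt_continuous.
  rewrite normr0 sqrtr0 mulr0 in h.
  near=> z.
  apply: (@le_trans _ _ (4 * Num.sqrt `|z|)).
    apply: ylny2_le; near: z; apply/nbhs_ballP; exists 1 => //= z.
    by rewrite /ball/= sub0r normrN.
  rewrite -[leLHS]ger0_norm ?mulr_ge0//; near: z.
  by move/cvgr0Pnorm_le : h; apply.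
have p : 0 < y * y by rewrite -expr2 exprn_even_gt0.
apply: cvgM; first exact: cvg_id.
exact: (der1_continuous (@der1_comp _ (@ln R) (fun t => t * t) y _ _ (is_derive1_ln p) (der1M (der1_id y) (der1_id y)))).
Unshelve. all: by end_near. Qed.

Lemma continuous_compf (f h : R -> R) : continuous f -> continuous h -> continuous (fun x => f (h x)).
Proof. by move=> cf ch x; apply: (@continuous_comp _ _ _ h f); [exact: ch|exact: cf]. Qed.

(** The quotient of sin (m s) by 2 sin (s / 2), without the division. *)
Definition sumcos (m : nat) (s : R) := \sum_(j < m) cos (j%:R * s + s / 2).

Lemma sin_sumcos m s : sin (m%:R * s) = 2 * sin (s / 2) * sumcos m s.
Proof.
rewrite /sumcos; elim: m => [|m IH]; first by rewrite big_ord0 mul0r sin0 mulr0.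
rewrite big_ord_recr/= mulrDr -IH.
have -> : m.+1%:R * s = m%:R * s + s / 2 + s / 2 by rewrite -natr1; field.
have -> : m%:R * s = m%:R * s + s / 2 - s / 2 :> R by field.
rewrite -![m%:R * s + s / 2 - s / 2 + s / 2]addrA addNr addr0.
by rewrite sinD sinB; ring.
Qed.

Lemma cos_sumcos m s : 2 * cos (s / 2) * sumcos m s =
  \sum_(j < m) (cos (j%:R * s) + cos (j.+1%:R * s)).
Proof.
rewrite /sumcos mulr_sumr; apply: eq_bigr => j _.
have -> : j.+1%:R * s = j%:R * s + s / 2 + s / 2 by rewrite -natr1; field.
have -> : j%:R * s = j%:R * s + s / 2 - s / 2 :> R by field.
rewrite -![j%:R * s + s / 2 - s / 2 + s / 2]addrA addNr addr0.
by move: (j%:R * s + s / 2) => A; rewrite (cosB A) (cosD A); ring.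
Qed.

Lemma sumcos_continuous m : continuous (sumcos m).
Proof.
elim: m => [|m IH]; rewrite /sumcos.
  rewrite (_ : (fun s => _) = fun=> 0); first by move=> x; exact: cst_continuous.
  by apply/funext => s; rewrite big_ord0.
rewrite (_ : (fun s => _) = fun s => sumcos m s + cos ((m%:R + 2^-1) * s)).
  apply: continuousDf => // x; exact: der1_continuous (der1_cosM _ _).
by apply/funext => s; rewrite big_ord_recr/= [in RHS]mulrDl [_^-1 * s]mulrC.
Qed.

Lemma cos_half (s : R) : cos s = 1 - 2 * sin (s / 2) ^+ 2.
Proof.
have -> : s = s / 2 + s / 2 by field.
rewrite cosD (_ : (s / 2 + s / 2) / 2 = s / 2); last by field.
by rewrite -expr2 -expr2 cos2sin2; ring.
Qed.

Lemma sin_half_gt0 (s : R) : 0 < s < 2 * pi -> 0 < sin (s / 2).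
Proof.
move=> /andP[s0 s2]; apply: sin_gt0_pi; rewrite divr_gt0//=.
by rewrite ltr_pdivrMr// mulrC.
Qed.

Lemma periodic_logker : periodic (@logker R).
Proof.
move=> s; rewrite /logker (_ : (s + 2 * pi) / 2 = s / 2 + pi); last by field.
by rewrite sinDpi sqrrN.
Qed.

Lemma logkerN (s : R) : logker (- s) = logker s.
Proof. by rewrite /logker mulNr sinN sqrrN. Qed.

Lemma logkerE (s : R) : logker s = ln ((2 * sin (s / 2)) ^+ 2).
Proof. by rewrite /logker exprMn -natrX. Qed.

Lemma measurable_logker : measurable_fun setT (@logker R).
Proof.
apply: (measurableT_comp (@measurable_ln R)).
apply: measurable_funM; first exact: measurable_cst.
apply: measurable_funX; apply: continuous_measurable_fun => x.
have -> : (fun s : R => sin (s / 2)) = fun s => sin (2^-1 * s) by apply/funext => s; rewrite mulrC.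
exact: der1_continuous (der1_sinM _ _).
Qed.

Lemma der1_logker (s : R) : 0 < s < 2 * pi -> is_derive s 1 (@logker R) (cos (s / 2) / sin (s / 2)).
Proof.
move=> /sin_half_gt0 h.
have d1 : is_derive s 1 (fun s : R => sin (s / 2)) (2^-1 * cos (s / 2)).
  rewrite (_ : (fun s : R => sin (s / 2)) = fun s => sin (2^-1 * s)); last by apply/funext => t; rewrite mulrC.
  by rewrite [s / 2]mulrC; exact: der1_sinM.
have p : 0 < 4 * (sin (s / 2) * sin (s / 2)) by rewrite !mulr_gt0.
have := @der1_comp _ (@ln R) (fun t => 4 * (sin (t / 2) * sin (t / 2))) s _ _ (is_derive1_ln p) (der1Z 4 (der1M d1 d1)).
rewrite (_ : (fun t => _) = @logker R); last by apply/funext => t; rewrite /logker expr2.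
by congr is_derive; field; rewrite gt_eqF.
Qed.

(** The product of sin (m s) with the kernel, arranged so that the zeros of
    sin (s / 2) appear as the argument of [ylny2]: this makes it continuous on the
    whole period, endpoints included. *)
Definition sinlog m (s : R) := sumcos m s * ylny2 (2 * sin (s / 2)).

Lemma sinlogE m s : sinlog m s = sin (m%:R * s) * logker s.
Proof. by rewrite sin_sumcos logkerE /sinlog /ylny2; ring. Qed.

Lemma sinlog_continuous m : continuous (sinlog m).
Proof.
apply: continuousMf; first exact: sumcos_continuous.
apply: (@continuous_compf ylny2 (fun t => 2 * sin (t / 2))); first exact: ylny2_continuous.
move=> x; apply: cvgMr; have -> : (fun s : R => sin (s / 2)) = fun s => sin (2^-1 * s) by apply/funext => s; rewrite mulrC.
by rewrite [x / 2]mulrC; exact: (der1_continuous (der1_sinM 2^-1 x)).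
Qed.

Lemma der1_sinlog m s : 0 < s < 2 * pi ->
  is_derive s 1 (sinlog m) (m%:R * (cos (m%:R * s) * logker s) + 2 * cos (s / 2) * sumcos m s).
Proof.
move=> sp; rewrite (_ : sinlog m = fun s => sin (m%:R * s) * logker s); last by apply/funext => t; rewrite sinlogE.
have := der1M (der1_sinM m%:R s) (der1_logker sp).
congr is_derive; rewrite sin_sumcos; field; by rewrite gt_eqF// sin_half_gt0.
Qed.

Lemma logker_at (s : R) : 0 < s < 2 * pi -> {for s, continuous (@logker R)}.
Proof. by move=> sp; exact: der1_continuous (der1_logker sp). Qed.

Lemma logker_le (s : R) : logker s <= ln 4.
Proof.
have s1 : sin (s / 2) ^+ 2 <= 1 by rewrite -[leRHS](cos2Dsin2 (s / 2)) lerDr sqr_ge0.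
have [|h] := leP (4 * sin (s / 2) ^+ 2) 0.
  by move=> h; rewrite /logker ln0// ln_ge0// ler1n.
by rewrite /logker ler_ln ?posrE// ger_pMr.
Qed.

(** Where cos s >= 0 this follows from logker s <= ln 4; where cos s < 0 the square
    of sin (s / 2) exceeds 1 / 2 and the kernel is positive. *)
Lemma coslog_ge0 (s : R) : 0 < s < 2 * pi -> 0 <= ln 4 - cos s * logker s.
Proof.
move=> sp; have c1 := cos_le1 s.
have [c0|c0] := leP 0 (cos s).
  rewrite subr_ge0; have [l0|l0] := leP 0 (logker s).
    by rewrite (le_trans _ (logker_le s))// ler_piMl.
  by rewrite (@le_trans _ _ 0)// ?ln_ge0 ?ler1n// mulr_ge0_le0// ltW.
rewrite addr_ge0// ?ln_ge0 ?ler1n// -mulNr mulr_ge0 ?oppr_ge0 ?(ltW c0)//.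
rewrite /logker ln_ge0//.
by have := cos_half s; lra.
Qed.

(** An explicit primitive is s ln 4 - sin s * logker s + s + sin s; it is
    continuous up to the endpoints by [sinlog_continuous]. *)
Lemma integrable_coslog : mu.-integrable period (EFin \o (fun s : R => ln 4 - cos s * logker s)).
Proof.
apply: (@improper_integrable R _ (fun s => s * ln 4 - (sinlog 1 s - (s + sin s)))) => //.
- exact: twopi_gt0.
- exact: coslog_ge0.
- apply: measurable_funB; first exact: measurable_cst.
  apply: measurable_funM; last exact: measurable_logker.
  by apply: continuous_measurable_fun => x; exact: continuous_cos.
- move=> s sp.
  have := der1B (der1M (der1_id s) (der1_cst (ln 4) s)) (der1B (der1_sinlog 1 sp) (der1D (der1_id s) (is_derive_sin s))).
  congr is_derive.
  rewrite cos_sumcos big_ord1 !mul1r mul0r cos0; ring.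
- move=> s sp; apply: cvgB; first exact: cvg_cst.
  apply: cvgM; [exact: continuous_cos|exact: logker_at].
- apply: continuousDf.
    by apply: continuousMf => x; [exact: cvg_id|exact: cst_continuous].
  apply: continuousNf; apply: continuousDf; first exact: sinlog_continuous.
  apply: continuousNf; apply: continuousDf => x; [exact: cvg_id|exact: continuous_sin].
Qed.

Lemma integrable_logker : mu.-integrable period (EFin \o (@logker R)).
Proof.
(* where cos s >= 1/2, |logker s| <= 2 (|ln 4 - cos s * logker s| + ln 4);
   elsewhere logker is bounded *)
have h : mu.-integrable period (EFin \o (fun s : R => 2 * (ln 4 - cos s * logker s) + 4 * ln 4)).
  rewrite (_ : _ \o _ = (EFin \o (fun s : R => 2 * (ln 4 - cos s * logker s))%R) \+ (EFin \o (fun s : R => 4 * ln 4)%R))%E; last first.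
    by apply/funext => s /=; rewrite EFinD.
  apply: integrableD.
  - exact: measurable_period.
  - apply: integrableZR; [exact: measurable_period|exact: integrable_coslog].
  - apply: continuous_compact_integrable; first exact: segment_compact.
    by apply: continuous_subspaceT => x; exact: cst_continuous.
have : mu.-integrable `]0, (2 * pi)[ (EFin \o (@logker R)).
  apply: le_integrable (integrableS _ _ _ h) => //.
  - by apply/measurable_EFinP; apply: measurable_funTS; exact: measurable_logker.
  - move=> s; rewrite /= in_itv/= => sp; rewrite lee_fin.
    have sn := sin_half_gt0 sp; have cge := coslog_ge0 sp.
    have c1 := cos_le1 s; have cm1 := cos_geN1 s.
    have L4 := logker_le s.
    have ln4 : 0 <= ln (4 : R) by rewrite ln_ge0 ?ler1n.
    rewrite [leRHS]ger0_norm; last by rewrite addr_ge0 ?mulr_ge0.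
    have hc := cos_half s.
    have [ch|ch] := leP (2^-1) (cos s).
      rewrite ler_norml; apply/andP; split; last by nra.
      have [l0|l0] := leP 0 (logker s); nra.
    have : 0 <= logker s by rewrite /logker ln_ge0//; lra.
    move=> l0; rewrite ger0_norm//; lra.
  - exact: measurable_period.
  - by apply: subset_itv_oo_cc.
rewrite /period => /integrableP[_ hi]; apply/integrableP.
have mf (D : set R) : measurable_fun D (EFin \o @logker R) by apply/measurable_EFinP; apply: measurable_funTS; exact: measurable_logker.
have mfA (D : set R) : measurable_fun D (fun x => `|(EFin \o @logker R) x|%E) by apply: measurableT_comp => //; exact: mf.
split; first exact: mf.
rewrite -(@integral_itv_obnd_cbnd R 0 (BRight (2 * pi)) (fun x => `|(EFin \o @logker R) x|%E) (mfA _)).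
by rewrite -(@integral_itv_bndo_bndc R (BRight 0) (2 * pi) (fun x => `|(EFin \o @logker R) x|%E) (mfA _)).
Qed.

Lemma integrable_mul_bounded (h k : R -> R) (M : R) : mu.-integrable period (EFin \o h) ->
  continuous k -> (forall x, `|k x| <= M) -> mu.-integrable period (EFin \o (fun s => h s * k s)).
Proof.
move=> ih ck kM.
have mk : measurable_fun period k by apply: measurable_funTS; exact: continuous_measurable_fun.
have bk : [bounded k x | x in period] by apply: (@bounded_by _ _ _ M).
have := @integrableMl _ _ _ mu period (@measurable_period R) _ _ ih mk bk.
by [].
Qed.

(** The integrand is 1 plus cosines of positive frequency: in [cos_sumcos] only
    the term cos 0 contributes to the integral over a period. *)
Lemma sumcos_primitive (m : nat) : (0 < m)%N ->
  exists2 F : R -> R, forall s : R, is_derive s 1 F (2 * cos (s / 2) * sumcos m s) & F (2 * pi) - F 0 = 2 * pi.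
Proof.
move=> m0; have [m' ->] : exists m', m = m'.+1 by exists m.-1; rewrite prednK.
pose F (s : R) : R := s + \sum_(j < m') ((j.+1%:R)^-1 * sin (j.+1%:R * s)) + \sum_(j < m'.+1) ((j.+1%:R)^-1 * sin (j.+1%:R * s)).
have dsum k (a : R) : is_derive a 1 (fun s : R => \sum_(j < k) ((j.+1%:R)^-1 * sin (j.+1%:R * s))) (\sum_(j < k) cos (j.+1%:R * a)).
  elim: k => [|k IH].
    rewrite big_ord0 (_ : (fun s : R => _) = fun=> 0); first exact: der1_cst.
    by apply/funext => s; rewrite big_ord0.
  rewrite big_ord_recr (_ : (fun s : R => _) = fun s : R => \sum_(j < k) ((j.+1%:R)^-1 * sin (j.+1%:R * s)) + (k.+1%:R)^-1 * sin (k.+1%:R * s)); last first.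
    by apply/funext => s; rewrite big_ord_recr.
  apply: der1D => //.
  have := der1Z k.+1%:R^-1 (der1_sinM k.+1%:R a).
  by rewrite mulKf// pnatr_eq0.
exists F.
  move=> s; rewrite cos_sumcos big_split/= big_ord_recl/= mul0r cos0.
  exact: der1D (der1D (der1_id s) (dsum m' s)) (dsum m'.+1 s).
have z k (a : R) : (forall j : nat, sin (j%:R * a) = 0) -> \sum_(j < k) ((j.+1%:R)^-1 * sin (j.+1%:R * a)) = 0.
  by move=> ha; rewrite big1// => j _; rewrite ha mulr0.
have s0 (j : nat) : sin (j%:R * 0 : R) = 0 by rewrite mulr0 sin0.
have s2 (j : nat) : sin (j%:R * (2 * pi) : R) = 0.
  have := expi_twopi (R := R) j; rewrite /expi => -[_]; exact.
by rewrite /F !z// !addr0 subr0.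
Qed.

(** Integration by parts: sin (m s) * logker s vanishes at both ends of the period,
    and its derivative is m cos (m s) * logker s plus the trigonometric polynomial
    of [sumcos_primitive], whose integral is 2 pi. *)
Lemma Rintegral_coslog (m : nat) : (0 < m)%N ->
  \int[mu]_(s in period) (logker s * cos (m%:R * s)) = - (2 * pi) / m%:R.
Proof.
move=> m0.
have mR : m%:R != 0 :> R by rewrite pnatr_eq0 -lt0n.
have cD : continuous (fun s : R => 2 * cos (s / 2) * sumcos m s).
  rewrite (_ : (fun s => _) = fun s => 2 * cos (2^-1 * s) * sumcos m s); last by apply/funext => s; rewrite [s / 2]mulrC.
  apply: continuousMf; last exact: sumcos_continuous.
  apply: continuousMf => x; first exact: cst_continuous.
  exact: der1_continuous (der1_cosM _ _).
have cc : continuous (fun s : R => cos (m%:R * s)) by move=> x; exact: der1_continuous (der1_cosM _ _).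
have ic : mu.-integrable period (EFin \o (fun s : R => logker s * cos (m%:R * s))).
  apply: (@integrable_mul_bounded _ _ 1) => //; first exact: integrable_logker.
  by move=> x; exact: cos_max.
have iD : mu.-integrable period (EFin \o (fun s : R => 2 * cos (s / 2) * sumcos m s)).
  apply: continuous_compact_integrable; first exact: segment_compact.
  exact: continuous_subspaceT.
have ID : \int[mu]_(s in period) (2 * cos (s / 2) * sumcos m s) = 2 * pi.
  have [F dF FE] := sumcos_primitive m0.
  by rewrite /period (Rintegral_FTC2 (F := F) twopi_gt0 dF cD) FE.
have ic' : mu.-integrable period (EFin \o (fun s : R => m%:R * (cos (m%:R * s) * logker s))).
  apply: integrableZR; first exact: measurable_period.
  by under eq_fun do rewrite mulrC.
have key : \int[mu]_(s in period) (m%:R * (cos (m%:R * s) * logker s) + 2 * cos (s / 2) * sumcos m s) = sinlog m (2 * pi) - sinlog m 0.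
  apply: improper_FTC2.
  - exact: twopi_gt0.
  - rewrite (_ : _ \o _ = (EFin \o (fun s => m%:R * (cos (m%:R * s) * logker s))%R) \+ (EFin \o (fun s => 2 * cos (s / 2) * sumcos m s)%R))%E; last first.
      by apply/funext => s /=; rewrite EFinD.
    exact: (@integrableD _ _ _ mu period (@measurable_period R)).
  - exact: der1_sinlog.
  - move=> s sp; apply: cvgD; last exact: cD.
    apply: cvgMr; apply: cvgM; [exact: cc|exact: logker_at].
  - exact: sinlog_continuous.
rewrite (@RintegralD _ _ _ mu period _ _ (@measurable_period R) ic' iD) ID !sinlogE mulr0 sin0 mul0r subr0 in key.
have s2 : sin (m%:R * (2 * pi) : R) = 0.
  by have := expi_twopi (R := R) m; rewrite /expi => -[_]; exact.
rewrite s2 mul0r RintegralZl in key; last 2 first.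
- exact: measurable_period.
- by under eq_fun do rewrite mulrC.
under eq_Rintegral do rewrite mulrC.
apply: (mulfI mR); rewrite mulrCA mulfV// mulr1.
by apply/eqP; rewrite -addr_eq0 key.
Qed.

(** The integrand is periodic and odd. *)
Lemma Rintegral_sinlog (m : int) :
  \int[mu]_(s in period) (logker s * sin (m%:~R * s)) = 0.
Proof.
have mf : cmeasurable (fun s : R => (logker s * sin (m%:~R * s))%:C).
  apply: cmeasurable_real; apply: measurable_funM; first exact: measurable_logker.
  by apply: continuous_measurable_fun => x; exact: der1_continuous (der1_sinM _ _).
have pf : periodic (fun s : R => (logker s * sin (m%:~R * s))%:C).
  move=> s; rewrite periodic_logker; congr ((_ * _)%:C).
  by have := periodic_expi (R := R) m s; rewrite /expi => -[_ ->].
have := congr1 (@complex.Re R) (cintegral_reflect 0 mf pf).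
rewrite /=; under eq_Rintegral do rewrite sub0r logkerN mulrN sinN mulrN -mulN1r.
rewrite RintegralZl.
- by rewrite mulN1r => /eqP; rewrite eq_sym -addr_eq0 -mulr2n -mulr_natl mulf_eq0 pnatr_eq0/= => /eqP.
- exact: measurable_period.
- apply: (@integrable_mul_bounded _ _ 1); first exact: integrable_logker.
  + by move=> x; exact: der1_continuous (der1_sinM _ _).
  + by move=> x; exact: sin_max.
Qed.

Lemma logker_double (s : R) : sin s != 0 -> logker (2 * s) = logker s + logker (s + pi).
Proof.
move=> s0.
have e : sin s = 2 * sin (s / 2) * cos (s / 2).
  have {1}-> : s = s / 2 + s / 2 by field.
  by rewrite sinD; ring.
move: s0; rewrite e !mulf_eq0 !negb_or -andbA => /and3P[_ s0 c0].
rewrite /logker [2 * s]mulrC mulfK ?pnatr_eq0// [(s + pi) / 2]mulrDl sinDpihalf.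
have p (x : R) : x != 0 -> 0 < 4 * x ^+ 2 by move=> x0; rewrite mulr_gt0// exprn_even_gt0.
rewrite -lnM ?posrE; [|exact: p..].
by congr ln; rewrite e; ring.
Qed.

(** By the duplication formula [logker_double], the substitution s -> 2 s turns the
    integral I into twice the integral over half a period of logker s +
    logker (s + pi), that is 2 I. Hence I = 2 I. *)
Lemma Rintegral_logker : \int[mu]_(s in period) (logker s : R) = 0.
Proof.
have pipos := pi_gt0 R.
have pre : (fun z : R => 2 * z + 0) @^-1` period = `[0, pi]%classic.
  apply/seteqP; split => z/=; rewrite /period/= !in_itv/= => /andP[h1 h2]; apply/andP; split; lra.
set I := Rintegral _ _ _.
pose f2 (s : R) := logker s + logker (- pi - s).
have f2E s : f2 s = logker s + logker (s + pi).
  by rewrite /f2 -(logkerN (- pi - s)) opprB opprK.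
have mlk : cmeasurable (fun s : R => (logker s)%:C) by apply: cmeasurable_real; exact: measurable_logker.
have plk : periodic (fun s : R => (logker s)%:C) by move=> s; rewrite periodic_logker.
have ilk : cintegrable period (fun s : R => (logker s)%:C).
  by split; [exact: integrable_logker|exact: integrable0].
have [ilk2 _] := cintegrable_reflect (- pi) mlk plk ilk.
have Ilk2 : \int[mu]_(s in period) logker (- pi - s) = I.
  by have := congr1 (@complex.Re R) (cintegral_reflect (- pi) mlk plk).
have if2 : mu.-integrable period (EFin \o f2).
  rewrite (_ : _ \o _ = (EFin \o (fun s => logker s)) \+ (EFin \o (fun s => logker (- pi - s)%R)))%E; last first.
    by apply/funext => s /=; rewrite EFinD.
  apply: integrableD => //; first exact: measurable_period.
  exact: integrable_logker.
have If2 : \int[mu]_(s in period) f2 s = I + I.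
  by rewrite /f2 (@RintegralD _ _ _ mu period _ _ (@measurable_period R) integrable_logker ilk2) Ilk2.
have mf2 : measurable_fun setT f2.
  apply: measurable_funD; first exact: measurable_logker.
  apply: (measurableT_comp measurable_logker); apply: measurable_funB => //; exact: measurable_cst.
have mf2E (D : set R) : measurable_fun D (EFin \o f2) by apply/measurable_EFinP; exact: measurable_funTS.
have pf2 s : (EFin \o f2) (s + pi) = (EFin \o f2) s.
  rewrite /= !f2E addrC -addrA (_ : pi + pi = 2 * pi); last by ring.
  by rewrite periodic_logker.
have subp : `[0, pi]%classic `<=` @period R.
  by apply: subset_itvl; rewrite bnd_simp; lra.
have subp2 : `]pi, 2 * pi]%classic `<=` @period R.
  by apply: subset_itvr; rewrite bnd_simp; lra.
have split_f2 : \int[mu]_(s in period) f2 s = \int[mu]_(s in `[0, pi]) f2 s + \int[mu]_(s in `[0, pi]) f2 s.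
  rewrite /period (@itv_bndbnd_setU _ _ (BLeft 0) (BRight pi) (BRight (2 * pi))); [|by rewrite bnd_simp; lra..].
  rewrite Rintegral_setU//=; last 2 first.
  - by rewrite -itv_bndbnd_setU// bnd_simp; lra.
  - apply/disj_set2P; rewrite -subset0 => z/=; rewrite !in_itv/= => -[/andP[_ zr] /andP[]].
    by rewrite ltNge zr.
  congr (_ + _); rewrite /Rintegral; congr fine.
  rewrite -(@integral_periodic R pi pipos _ pi (mf2E setT) pf2).
  rewrite (_ : pi + pi = 2 * pi); last by ring.
  by rewrite integral_itv_obnd_cbnd//; exact: mf2E.
have dbl : (\int[mu]_(s in `[0%R, pi]) (logker (2 * s)%R)%:E = \int[mu]_(s in `[0%R, pi]) (f2 s)%:E)%E.
  have m2 (D : set R) : measurable_fun D (EFin \o (fun s : R => logker (2 * s))).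
    apply/measurable_EFinP; apply: measurable_funTS; apply: (measurableT_comp measurable_logker).
    exact: mulrl_measurable.
  rewrite -(@integral_itv_obnd_cbnd R 0 (BRight pi) _ (m2 _)).
  rewrite -(@integral_itv_bndo_bndc R (BRight 0) pi _ (m2 _)).
  rewrite -(@integral_itv_obnd_cbnd R 0 (BRight pi) _ (mf2E _)).
  rewrite -(@integral_itv_bndo_bndc R (BRight 0) pi _ (mf2E _)).
  apply: eq_integral => s; rewrite inE /= in_itv/= => sp.
  by rewrite f2E logker_double// gt_eqF// sin_gt0_pi.
have half : I = 2 * \int[mu]_(s in `[0, pi]) f2 s.
  rewrite /I {1}/Rintegral (@integral_affine R 2 0 period (EFin \o @logker R))//; last exact: integrable_logker.
    rewrite normr_nat.
    rewrite pre; under eq_integral do rewrite /= addr0.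
    rewrite dbl fineM//.
    apply: (@integrable_fin_num _ _ _ mu `[0, pi]%classic); first exact: measurable_itv.
    by apply: integrableS if2 => //; exact: measurable_itv.
  exact: measurable_period.
move: half; rewrite -[2]/(1 + 1) mulrDl mul1r -split_f2 If2 => /eqP.
by rewrite -subr_eq0 opprD addrA subrr sub0r oppr_eq0 => /eqP.
Qed.

Definition logcoef (m : int) : R := if m == 0 then 0 else `|m%:~R|^-1.

Lemma fourier_logker (m : int) :
  fourier_coef (fun s : R => (logker s)%:C) m = (- logcoef m)%:C.
Proof.
rewrite /fourier_coef.
have i1 : cintegral period (fun t => (logker t)%:C * expi (- (m%:~R * t))) =
   (\int[mu]_(s in period) (logker s * cos (m%:~R * s)))%:C.
  apply: eq_ReIm => /=.
    by apply: eq_Rintegral => s _; rewrite ?ReM ?ImM /= mul0r subr0 cosN.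
  rewrite -[RHS](Rintegral_sinlog (- m)); apply: eq_Rintegral => s _.
  by rewrite ?ReM ?ImM /= mul0r addr0 rmorphN/= mulNr.
rewrite i1 -rmorphM /logcoef /=; congr (_%:C).
have [->|m0] := eqVneq m 0.
  under eq_Rintegral do rewrite mul0r cos0 mulr1.
  by rewrite Rintegral_logker mulr0 oppr0.
have -> : \int[mu]_(s in period) (logker s * cos (m%:~R * s)) =
    \int[mu]_(s in period) (logker s * cos (`|m|%N%:R * s)).
  apply: eq_Rintegral => s _; congr (_ * _).
  case: (intP m) => // n; rewrite ?abszN absz_nat//.
  by rewrite mulrNz mulNr cosN.
rewrite Rintegral_coslog ?absz_gt0//.
have pin : pi != 0 :> R by rewrite gt_eqF// pi_gt0.
have mn : `|m|%N%:R != 0 :> R by rewrite pnatr_eq0 absz_eq0.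
rewrite -intr_norm -[`|m|%:~R]/(`|m|%N%:~R).
rewrite natr_absz; move: (@pi R) pin => p pin; field.
by apply/andP; split; [exact: mn|exact: pin].
Qed.

End log_kernel.

(** * The symbols of S0, S1 and S2 *)

Section multipliers.
Context {R : realType}.
Notation mu := (@lebesgue_measure R).
Notation normc := Normc.normc.
Implicit Types (u : int -> R[i]) (m k : int).

Notation imc := (0 +i* 1 : R[i]).

(** Componentwise, to match [clim]. *)
Definition cvgc {T : Type} (F : set_system T) (f : T -> R[i]) (l : R[i]) :=
  (complex.Re (f x) @[x --> F] --> complex.Re l) /\ (complex.Im (f x) @[x --> F] --> complex.Im l).

Lemma cvgc_clim {T : Type} (F : set_system T) {FF : ProperFilter F} (f : T -> R[i]) l :
  cvgc F f l -> clim F f = l.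
Proof.
move=> [h1 h2]; apply: eq_ReIm => /=; exact: cvg_lim.
Qed.

Lemma near_cvgc {T : Type} (F : set_system T) {FF : Filter F} (f : T -> R[i]) l :
  (\forall x \near F, f x = l) -> cvgc F f l.
Proof.
move=> h; split; apply: cvg_near_cst; apply: filterS h => x -> //.
Qed.

Lemma cvgcM_cst {T : Type} (F : set_system T) {FF : Filter F} (f : T -> R[i]) l c :
  cvgc F f l -> cvgc F (fun x => c * f x) (c * l).
Proof.
move=> [h1 h2]; split.
  under eq_fun do rewrite ReM; rewrite ReM; apply: cvgB; exact: cvgMr.
under eq_fun do rewrite ImM; rewrite ImM; apply: cvgD; exact: cvgMr.
Qed.

Lemma cvgcD {T : Type} (F : set_system T) {FF : Filter F} (f g : T -> R[i]) l l' :
  cvgc F f l -> cvgc F g l' -> cvgc F (fun x => f x + g x) (l + l').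
Proof.
move=> [h1 h2] [h3 h4]; split.
  under eq_fun do rewrite ReD; rewrite ReD; exact: cvgD.
under eq_fun do rewrite ImD; rewrite ImD; exact: cvgD.
Qed.

Lemma cvgc_cst {T : Type} (F : set_system T) {FF : Filter F} (l : R[i]) : cvgc F (fun=> l) l.
Proof. by split; exact: cvg_cst. Qed.

Lemma cvgc_sum {T : Type} (F : set_system T) {FF : Filter F} (I : Type) (r : seq I) (f : I -> T -> R[i]) (l : I -> R[i]) :
  (forall i, cvgc F (f i) (l i)) -> cvgc F (fun x => \sum_(i <- r) f i x) (\sum_(i <- r) l i).
Proof.
move=> h; elim: r => [|i r IH].
  rewrite big_nil (_ : (fun x => _) = fun=> 0); first exact: cvgc_cst.
  by apply/funext => x; rewrite big_nil.
rewrite big_cons (_ : (fun x => _) = fun x => f i x + \sum_(i <- r) f i x); first exact: cvgcD.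
by apply/funext => x; rewrite big_cons.
Qed.

(** The frequency of the j-th term of [fourier_sum]. *)
Definition freq (N : nat) (j : 'I_(2 * N).+1) : int := j%:Z - N%:Z.

Lemma freq_inj N : injective (@freq N).
Proof. by move=> i j /addIr [] /val_inj. Qed.

Lemma freq_le N (j : 'I_(2 * N).+1) : (`|freq j| <= N)%N.
Proof. by rewrite /freq; have := ltn_ord j; lia. Qed.

Lemma freqP N m : (`|m| <= N)%N -> exists j : 'I_(2 * N).+1, freq j = m.
Proof.
move=> mN; have h : (`|(m + N%:Z)%R| < (2 * N).+1)%N by lia.
by exists (Ordinal h); rewrite /freq/=; lia.
Qed.

Definition zpart {V : nmodType} (f : int -> V) N : V := \sum_(j < (2 * N).+1) f (freq j).

Lemma zpartS {V : nmodType} (f : int -> V) N :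
  zpart f N.+1 = zpart f N + (f N.+1%:Z + f (- N.+1%:Z)).
Proof.
rewrite /zpart /freq.
have -> : (2 * N.+1).+1 = (2 * N).+3 by rewrite mulnS.
rewrite big_ord_recr big_ord_recl /=.
rewrite (eq_bigr (fun j : 'I_(2 * N).+1 => f (j%:Z - N%:Z))); last first.
  by move=> j _; congr f; rewrite /bump/=; lia.
rewrite (_ : 0 - N.+1%:Z = - N.+1%:Z); last by lia.
rewrite (_ : (2 * N).+2%:Z - N.+1%:Z = N.+1%:Z); last by lia.
by rewrite addrAC addrC [f (- _) + _]addrC.
Qed.

Lemma fourier_sumE u N t : fourier_sum u N t = \sum_(j < (2 * N).+1) u (freq j) * expi ((freq j)%:~R * t).
Proof. by []. Qed.

Lemma sum_freq_eq (F : int -> R[i]) N m :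
  \sum_(j < (2 * N).+1) F (freq j) * (freq j == m)%:R = if (`|m| <= N)%N then F m else 0.
Proof.
case: ifP => mN.
  have [j0 <-] := freqP mN.
  rewrite (bigD1 j0)//= eqxx mulr1 big1 ?addr0// => j jj0.
  by rewrite (inj_eq (@freq_inj N)) (negbTE jj0) mulr0.
rewrite big1// => j _; case: eqP => [h|_]; last by rewrite mulr0.
by move: mN; rewrite -h freq_le.
Qed.

Lemma fourier_coef_expi k m : fourier_coef (fun t : R => expi (k%:~R * t)) m = (k == m)%:R.
Proof.
rewrite /fourier_coef.
have -> : cintegral period (fun t : R => expi (k%:~R * t) * expi (- (m%:~R * t))) =
   cintegral period (fun t : R => expi ((k - m)%:~R * t)).
  by apply: eq_cintegral => t _; rewrite -expiD -mulrBl -rmorphB.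
rewrite cintegral_expi subr_eq0; case: eqP => _; last by rewrite mulr0.
by rewrite -rmorphM mulVf// gt_eqF// twopi_gt0.
Qed.

Lemma fourier_coefZ f c m : cintegrable period f ->
  fourier_coef (fun t : R => c * f t) m = c * fourier_coef f m.
Proof.
move=> fi; rewrite /fourier_coef mulrCA; congr (_ * _).
rewrite -cintegralZ; last 2 first.
- exact: measurable_period.
- apply: (@cintegrableM _ _ _ _ 1) => //; first exact: measurable_period.
    have := cmeasurable_expi (- m%:~R : R); congr cmeasurable.
    by apply/funext => t; rewrite mulNr.
  by move=> x _; rewrite normc_expi.
by apply: eq_cintegral => t _; rewrite mulrA.
Qed.

Lemma cintegrable_expi k : cintegrable period (fun t : R => expi (k%:~R * t)).
Proof. by apply: ccontinuous_integrable; exact: ccontinuous_expi. Qed.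

Lemma cintegrable_mul_expi (f : R -> R[i]) (a : R) : cintegrable period f ->
  cintegrable period (fun t => f t * expi (a * t)).
Proof.
move=> fi; apply: (@cintegrableM _ _ _ _ 1) => //; first exact: measurable_period.
  exact: cmeasurable_expi.
by move=> x _; rewrite normc_expi.
Qed.

Lemma cintegrable_mul_expiN (f : R -> R[i]) (m : int) : cintegrable period f ->
  cintegrable period (fun t => f t * expi (- (m%:~R * t))).
Proof.
move=> fi; have := cintegrable_mul_expi (- m%:~R) fi.
by under eq_fun do rewrite mulNr.
Qed.

Lemma fourier_coef_sum (I : Type) (r : seq I) (f : I -> R -> R[i]) m :
  (forall i, cintegrable period (f i)) ->
  fourier_coef (fun t => \sum_(i <- r) f i t) m = \sum_(i <- r) fourier_coef (f i) m.
Proof.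
move=> fi; rewrite /fourier_coef -mulr_sumr -cintegral_sum; last 2 first.
- exact: measurable_period.
- by move=> i; exact: cintegrable_mul_expiN.
by congr (_ * _); apply: eq_cintegral => t _; rewrite mulr_suml.
Qed.

Lemma eq_fourier_coef (f h : R -> R[i]) m : (forall t, period t -> f t = h t) ->
  fourier_coef f m = fourier_coef h m.
Proof. by move=> fh; congr (_ * _); apply: eq_cintegral => t pt; rewrite fh. Qed.

Lemma fourier_coef_trig (c : int -> R[i]) N m :
  fourier_coef (fun t => \sum_(j < (2 * N).+1) c (freq j) * expi ((freq j)%:~R * t)) m =
  if (`|m| <= N)%N then c m else 0.
Proof.
rewrite fourier_coef_sum => [|j]; last first.
  by apply: cintegrableZ; [exact: measurable_period|exact: cintegrable_expi].
rewrite -sum_freq_eq; apply: eq_bigr => j _.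
by rewrite fourier_coefZ ?fourier_coef_expi//; exact: cintegrable_expi.
Qed.

(** As soon as N >= |m|, the coefficient of frequency m of the N-th approximation
    has its final value, so the limit in [extend] is that of an eventually
    constant sequence. *)
Lemma extend_multiplier (A : (R -> R[i]) -> R -> R[i]) (s : int -> R[i]) u :
  (forall N t, period t -> A (fourier_sum u N) t =
     \sum_(j < (2 * N).+1) (s (freq j) * u (freq j)) * expi ((freq j)%:~R * t)) ->
  extend A u = fun m => s m * u m.
Proof.
move=> h; apply/funext => m; apply: cvgc_clim; apply: near_cvgc.
exists `|m|%N => // N /= mN.
rewrite (eq_fourier_coef _ (h N)) (@fourier_coef_trig (fun m => s m * u m)).
by rewrite mN.
Qed.

(** Exponentials are eigenfunctions of convolutions. *)
Lemma cintegral_conv_expi (K : R -> R) (t : R) m : measurable_fun setT K -> periodic K ->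
  mu.-integrable period (EFin \o K) ->
  cintegral period (fun z => (K (t - z))%:C * expi (m%:~R * z)) =
  (2 * pi)%:C * fourier_coef (fun s => (K s)%:C) m * expi (m%:~R * t).
Proof.
move=> mK pK iK.
pose h (s : R) := (K s)%:C * expi (- (m%:~R * s)).
have hE : (fun s => expi (- m%:~R * s)) = (fun s => expi (- (m%:~R * s))) :> (R -> R[i]).
  by apply/funext => s; rewrite mulNr.
have mh : cmeasurable h.
  apply: cmeasurableM; first exact: cmeasurable_real.
  by rewrite -hE; exact: cmeasurable_expi.
have ph : periodic h.
  move=> s; rewrite /h pK; congr (_ * _).
  by have := periodic_expi (- m) s; rewrite rmorphN/= !mulNr.
have ih : cintegrable period h.
  by apply: cintegrable_mul_expiN; split => //; exact: integrable0.
rewrite /fourier_coef mulrA -rmorphM mulfV; last by rewrite gt_eqF// twopi_gt0.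
rewrite mul1r -(cintegral_reflect t mh ph) mulrC -cintegralZ; last 2 first.
- exact: measurable_period.
- exact: cintegrable_reflect.
apply: eq_cintegral => z _; rewrite /h mulrCA -expiD; congr (_ * expi _).
by rewrite mulrBr opprB addrC subrK.
Qed.

Lemma cintegrable_conv_expi (K : R -> R) (t : R) m : measurable_fun setT K -> periodic K ->
  mu.-integrable period (EFin \o K) ->
  cintegrable period (fun z => (K (t - z))%:C * expi (m%:~R * z)).
Proof.
move=> mK pK iK; apply: cintegrable_mul_expi.
apply: (@cintegrable_reflect _ (fun s => (K s)%:C)).
- exact: cmeasurable_real.
- by move=> s; rewrite pK.
- by split => //; exact: integrable0.
Qed.

Lemma cintegral_conv (K : R -> R) (t : R) u N : measurable_fun setT K -> periodic K ->
  mu.-integrable period (EFin \o K) ->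
  cintegral period (fun z => (K (t - z))%:C * fourier_sum u N z) =
  \sum_(j < (2 * N).+1) ((2 * pi)%:C * fourier_coef (fun s => (K s)%:C) (freq j) * u (freq j)) * expi ((freq j)%:~R * t).
Proof.
move=> mK pK iK.
have mp : measurable (@period R) by exact: (@measurable_period R).
transitivity (cintegral period (fun z => \sum_(j < (2 * N).+1) u (freq j) * ((K (t - z))%:C * expi ((freq j)%:~R * z)))).
  by apply: eq_cintegral => z _; rewrite fourier_sumE mulr_sumr; apply: eq_bigr => j _; rewrite mulrCA.
rewrite cintegral_sum//; last first.
  by move=> j; apply: cintegrableZ => //; exact: cintegrable_conv_expi.
apply: eq_bigr => j _; rewrite cintegralZ//; last exact: cintegrable_conv_expi.
by rewrite cintegral_conv_expi// mulrCA !mulrA.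
Qed.

Lemma cintegral_fourier_sum u N : cintegral period (fourier_sum u N) = (2 * pi)%:C * u 0.
Proof.
have mp : measurable (@period R) by exact: (@measurable_period R).
rewrite (@cintegral_sum _ _ 'I_(2 * N).+1 _ (fun j t => u (freq j) * expi ((freq j)%:~R * t)))//; last first.
  by move=> j; apply: cintegrableZ => //; exact: cintegrable_expi.
transitivity (\sum_(j < (2 * N).+1) (2 * pi)%:C * u (freq j) * (freq j == 0)%:R).
  apply: eq_bigr => j _; rewrite cintegralZ//; last exact: cintegrable_expi.
  by rewrite cintegral_expi; case: eqP => _; rewrite ?mulr1 ?mulr0//= mulrC.
by rewrite (sum_freq_eq (fun m => (2 * pi)%:C * u m)).
Qed.

(** The rank one terms of S0 and T0 only see the frequency 0. *)
Lemma sum_freq0 u N (c : R[i]) (t : R) : c * u 0 =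
  \sum_(j < (2 * N).+1) ((freq j == 0)%:R * c * u (freq j)) * expi ((freq j)%:~R * t).
Proof.
have -> : c * u 0 = if (`|0 : int|%N <= N)%N then c * u 0 * expi (0%:~R * t) else 0.
  by rewrite mul0r expi0 mulr1.
rewrite -[RHS](eq_bigr _ (fun j _ => _ : (c * u (freq j) * expi ((freq j)%:~R * t)) * (freq j == 0)%:R = _)).
  by rewrite (sum_freq_eq (fun m => c * u m * expi (m%:~R * t))).
by move=> j _; rewrite mulrC !mulrA.
Qed.

Definition S0symb m : R[i] := (logcoef m)%:C + (m == 0)%:R * imc.

Lemma twopi_neq0 : (2 * pi)%:C != 0 :> R[i].
Proof. by apply/eqP => /complexI /eqP; rewrite gt_eqF// twopi_gt0. Qed.

Lemma S0E u : S0 u = fun m => S0symb m * u m.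
Proof.
apply: extend_multiplier => N t pt.
rewrite /opS0 cintegral_conv; last 3 first.
- exact: measurable_logker.
- exact: periodic_logker.
- exact: integrable_logker.
rewrite cintegral_fourier_sum rmorphV/= ?unitfE ?gt_eqF ?twopi_gt0//.
rewrite mulrA mulfVK ?twopi_neq0// (sum_freq0 u N imc t) mulr_sumr -big_split/=.
apply: eq_bigr => j _; rewrite fourier_logker /S0symb rmorphN/=.
by rewrite mulrN !mulNr mulrN opprK -!mulrA mulKf ?twopi_neq0// !mulrDl !mulrA.
Qed.

Lemma fourier_coef_mul_expi (f : R -> R[i]) (k m : int) :
  fourier_coef (fun s => f s * expi (k%:~R * s)) m = fourier_coef f (m - k).
Proof.
rewrite /fourier_coef; congr (_ * _); apply: eq_cintegral => s _.
by rewrite -mulrA -expiD rmorphB/=; congr (_ * expi _); ring.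
Qed.

Lemma sin_expi (s : R) : (sin s)%:C = (- imc / 2) * (expi (1%:~R * s) - expi ((-1)%:~R * s)).
Proof.
have -> : 1%:~R * s = s by rewrite mul1r.
have -> : (-1)%:~R * s = - s by rewrite mulN1r.
have -> : expi s - expi (- s) = (0 +i* (2 * sin s)).
  by apply: eq_ReIm; rewrite /= ?cosN ?sinN ?subrr//; ring.
have -> : 0 +i* (2 * sin s) = 2 * imc * (sin s)%:C by apply: eq_ReIm; rewrite !(ReM, ImM) /=; ring.
have i2 : imc * imc = -1 by apply: eq_ReIm; rewrite ?ReM ?ImM /=; ring.
have {1}-> : (sin s)%:C = - (imc * imc) * (sin s)%:C by rewrite i2 opprK mul1r.
by field.
Qed.

(** Multiplication of a kernel by sine is a difference of shifts of its
    coefficients; this is how the smoothing of S1 and S2 arises. *)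
Lemma fourier_coef_mul_sin (K : R -> R) m : mu.-integrable period (EFin \o K) ->
  fourier_coef (fun s => (K s * sin s)%:C) m =
  (- imc / 2) * (fourier_coef (fun s => (K s)%:C) (m - 1) - fourier_coef (fun s => (K s)%:C) (m + 1)).
Proof.
move=> iK; set f := fun s => (K s)%:C.
have fi : cintegrable period f by split => //; exact: integrable0.
have mp : measurable (@period R) by exact: measurable_period.
transitivity (fourier_coef (fun s => (- imc / 2) * (f s * expi (1%:~R * s) + - 1 * (f s * expi ((-1)%:~R * s)))) m).
  apply: eq_fourier_coef => s _; rewrite rmorphM/= sin_expi -/(f s); ring.
have h1 := cintegrable_mul_expi 1%:~R fi; have h2 := cintegrable_mul_expi (-1)%:~R fi.
have h3 : cintegrable period (fun s => - 1 * (f s * expi ((-1)%:~R * s))) by exact: cintegrableZ.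
rewrite fourier_coefZ; last exact: cintegrableD.
congr (_ * _).
transitivity (fourier_coef (fun t => \sum_(b <- [:: true; false]) (if b then f t * expi (1%:~R * t) else - 1 * (f t * expi ((-1)%:~R * t)))) m).
  by apply: eq_fourier_coef => s _; rewrite !big_cons big_nil addr0.
rewrite fourier_coef_sum; last by case.
rewrite !big_cons big_nil addr0 fourier_coefZ// !fourier_coef_mul_expi opprK mulN1r//.
Qed.

Definition S1symb m : R[i] := imc / 4 * (logcoef (m - 1) - logcoef (m + 1))%:C.
Definition S2symb m : R := (2 * logcoef m - logcoef (m - 2) - logcoef (m + 2)) / 16.

Lemma continuous_sinf : continuous (@sin R). Proof. by move=> x; exact: continuous_sin. Qed.

Lemma integrable_logsin : mu.-integrable period (EFin \o (fun s : R => logker s * sin s)).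
Proof.
apply: (@integrable_mul_bounded _ _ _ 1); first exact: integrable_logker.
  exact: continuous_sinf.
by move=> x; exact: sin_max.
Qed.

Lemma extend_conv (K : R -> R) (A : (R -> R[i]) -> R -> R[i]) (c : R[i]) (s : int -> R[i]) u :
  measurable_fun setT K -> periodic K -> mu.-integrable period (EFin \o K) ->
  (forall phi t, A phi t = c * cintegral period (fun z => (K (t - z))%:C * phi z)) ->
  (forall m, s m = c * ((2 * pi)%:C * fourier_coef (fun s => (K s)%:C) m)) ->
  extend A u = fun m => s m * u m.
Proof.
move=> mK pK iK AE sE; apply: extend_multiplier => N t pt.
rewrite AE cintegral_conv// mulr_sumr; apply: eq_bigr => j _.
by rewrite sE !mulrA.
Qed.

Lemma S1E u : S1 u = fun m => S1symb m * u m.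
Proof.
apply: (@extend_conv (fun s => logker s * sin s) _ ((4 * pi)^-1)%:C).
- apply: measurable_funM; first exact: measurable_logker.
  by apply: continuous_measurable_fun; exact: continuous_sinf.
- by move=> s; rewrite periodic_logker periodic_sin.
- exact: integrable_logsin.
- by [].
- move=> m; rewrite fourier_coef_mul_sin; last exact: integrable_logker.
  rewrite !fourier_logker /S1symb mulrA -rmorphM/= (_ : (4 * pi)^-1 * (2 * pi) = 2^-1); last first.
    by have := pi_gt0 R => /lt0r_neq0; move: (@pi R) => p p0; field.
  by rewrite rmorphV ?unitfE ?pnatr_eq0// rmorph_nat !rmorphN rmorphB/=; field.
Qed.

Lemma S2E u : S2 u = fun m => (S2symb m)%:C * u m.
Proof.
apply: (@extend_conv (fun s => logker s * sin s * sin s) _ (- ((8 * pi)^-1)%:C)).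
- apply: measurable_funM; last by apply: continuous_measurable_fun; exact: continuous_sinf.
  apply: measurable_funM; first exact: measurable_logker.
  by apply: continuous_measurable_fun; exact: continuous_sinf.
- by move=> s; rewrite periodic_logker periodic_sin.
- apply: (@integrable_mul_bounded _ _ _ 1); first exact: integrable_logsin.
    exact: continuous_sinf.
  by move=> x; exact: sin_max.
- move=> phi t; rewrite /opS2; congr (_ * _); apply: eq_cintegral => z _.
  by rewrite expr2 mulrA.
- move=> m; rewrite fourier_coef_mul_sin; last exact: integrable_logsin.
  rewrite !fourier_coef_mul_sin; try exact: integrable_logker.
  rewrite !fourier_logker /S2symb mulrA -rmorphN -rmorphM/= (_ : - (8 * pi)^-1 * (2 * pi) = - 4^-1); last first.
    by have := pi_gt0 R => /lt0r_neq0; move: (@pi R) => p p0; field.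
  rewrite (_ : m - 1 - 1 = m - 2); last by ring.
  rewrite subrK addrK (_ : m + 1 + 1 = m + 2); last by ring.
  have i2 : imc * imc = -1 by apply: eq_ReIm; rewrite ?ReM ?ImM /=; ring.
  rewrite !(rmorphN, rmorphB, rmorphM, rmorphD)/= !rmorphV ?unitfE ?pnatr_eq0//= !rmorph_nat.
  move: (logcoef m)%:C (logcoef (m - 2))%:C (logcoef (m + 2))%:C => a b c.
  transitivity ((imc * imc) * ((b + c - 2 * a) / 16)); first by rewrite i2; field.
  by field.
Qed.

End multipliers.

(** * The symbol of T0 *)

Section T0_symbol.
Context {R : realType}.
Notation mu := (@lebesgue_measure R).
Notation imc := (0 +i* 1 : R[i]).
Implicit Types (u : int -> R[i]) (m k : int).

(** The cotangent cut off at distance e from its poles 2 pi k. By [cos_ge_dist] the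
    condition on cos s is that distance condition, in a periodic form. *)
Definition truncated_cot (e s : R) : R := if cos s <= cos e then cos (s / 2) / sin (s / 2) else 0.

(** The cosine decreases with the distance to the nearest multiple of 2 pi, as long
    as that distance is at most pi. *)
Lemma cos_ge_dist (e t z : R) : 0 < e < pi ->
  (forall k : int, e <= `|z - t - 2 * pi * k%:~R|) <-> cos (z - t) <= cos e.
Proof.
move=> /andP[e0 epi]; set x := z - t.
have cosx (k : int) : cos x = cos `|x - 2 * pi * k%:~R|.
  rewrite -(periodicz (- k) x (@periodic_cos R)) rmorphN mulrN.
  by have [h|h] := leP 0 (x - 2 * pi * k%:~R); [rewrite ger0_norm|rewrite ltr0_norm// cosN].
have [k hk] := periodic_reduce x.
have ep : e \in `[0, pi] by rewrite in_itv/= !ltW.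
have kp : `|x - 2 * pi * k%:~R| \in `[0, pi] by rewrite in_itv/= normr_ge0 hk.
split => [h|h j].
  by rewrite (cosx k) leNgt ltr_cos// -leNgt.
rewrite (cosx k) leNgt ltr_cos// -leNgt in h.
have [->//|jk] := eqVneq j k.
(* k is a nearest multiple: |x - 2 pi j| >= 2 pi |j - k| - |x - 2 pi k| >= pi *)
have jk1 : 1 <= `|j%:~R - k%:~R| :> R.
  by rewrite -rmorphB/= -intr_norm -[1]/(1%:~R) ler_int; lia.
have h3 : 2 * pi * `|j%:~R - k%:~R| <= `|x - 2 * pi * j%:~R| + `|x - 2 * pi * k%:~R|.
  rewrite -{1}(ger0_norm (ltW twopi_gt0 : 0 <= 2 * pi :> R)) -normrM -[`|x - 2 * pi * j%:~R|]normrN.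
  by apply: le_trans (ler_normD _ _); rewrite le_eqVlt; apply/orP; left; apply/eqP; congr (`|_|); ring.
have pip := pi_gt0 R.
nra.
Qed.

Lemma truncated_cotN e s : truncated_cot e (- s) = - truncated_cot e s.
Proof.
rewrite /truncated_cot cosN; case: ifP => _; last by rewrite oppr0.
by rewrite mulNr cosN sinN invrN mulrN.
Qed.

Lemma periodic_cot : periodic (fun s : R => cos (s / 2) / sin (s / 2)).
Proof.
move=> s; rewrite (_ : (s + 2 * pi) / 2 = s / 2 + pi); last by field.
by rewrite cosDpi sinDpi invrN mulrNN.
Qed.

Lemma periodic_truncated_cot e : periodic (truncated_cot e).
Proof.
move=> s; rewrite /truncated_cot periodic_cos; case: ifP => _ //.
exact: periodic_cot.
Qed.

(** The identity y^-1 = y * exp (- ln (y^2)) also holds at 0, where both sides are 0. *)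
Lemma measurable_invR : measurable_fun [set: R] (@GRing.inv R).
Proof.
rewrite (_ : @GRing.inv R = fun y => y * expR (- ln (y ^+ 2))).
  apply: measurable_funM => //; apply: (measurableT_comp (@measurable_expR R)).
  apply: measurable_funN; apply: (measurableT_comp (@measurable_ln R)).
  exact: measurable_funX.
apply/funext => y; have [->|y0] := eqVneq y 0; first by rewrite invr0 mul0r.
by rewrite expRN lnK ?posrE ?exprn_even_gt0// expr2 invfM mulVKf.
Qed.

Lemma measurable_truncated_cot e : measurable_fun setT (truncated_cot e).
Proof.
have c : (fun s : R => cos (s / 2)) = fun s => cos (2^-1 * s) by apply/funext => s; rewrite mulrC.
have d : (fun s : R => sin (s / 2)) = fun s => sin (2^-1 * s) by apply/funext => s; rewrite mulrC.
apply: measurable_fun_ifT.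
- apply: measurable_fun_ler; last exact: measurable_cst.
  by apply: continuous_measurable_fun => x; exact: continuous_cos.
- apply: measurable_funM.
    by rewrite c; apply: continuous_measurable_fun => x; exact: der1_continuous (der1_cosM _ _).
  apply: (measurableT_comp measurable_invR).
  by rewrite d; apply: continuous_measurable_fun => x; exact: der1_continuous (der1_sinM _ _).
- exact: measurable_cst.
Qed.

Lemma truncated_cot_le e s : 0 < e < pi -> `|truncated_cot e s| <= 2 / (1 - cos e).
Proof.
move=> /andP[e0 epi].
have ce : 0 < 1 - cos e.
  rewrite subr_gt0 -cos0 ltr_cos//; rewrite in_itv/= ?lexx ?pi_ge0//.
  by rewrite !ltW.
rewrite /truncated_cot; case: ifP => [h|_]; last by rewrite normr0 divr_ge0// ltW.
have hs := cos_half s.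
have s1 : `|sin (s / 2)| <= 1 by exact: sin_max.
have c1 : `|cos (s / 2)| <= 1 by exact: cos_max.
have sn : 0 <= `|sin (s / 2)| by [].
have h2 : (1 - cos e) / 2 <= `|sin (s / 2)|.
  rewrite ler_pdivrMr//; have : `|sin (s / 2)| ^+ 2 = sin (s / 2) ^+ 2 by rewrite real_normK// num_real.
  nra.
have s0 : 0 < `|sin (s / 2)| by apply: lt_le_trans h2; rewrite divr_gt0.
rewrite normrM normfV ler_pdivrMr// mulrAC ler_pdivlMr//.
nra.
Qed.

Lemma integrable_truncated_cot e : 0 < e < pi -> mu.-integrable period (EFin \o truncated_cot e).
Proof.
move=> ep; apply: measurable_bounded_integrable.
- exact: measurable_period.
- exact: mu_period_fin.
- by apply: measurable_funTS; exact: measurable_truncated_cot.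
- by apply: (@bounded_by _ _ _ (2 / (1 - cos e))) => x _; exact: truncated_cot_le.
Qed.

Lemma cintegral_away (f : R -> R[i]) (e t : R) : 0 < e < pi ->
  cintegral (away_from t e) (fun z => (cos ((z - t) / 2) / sin ((z - t) / 2))%:C * f z) =
  cintegral period (fun z => (truncated_cot e (z - t))%:C * f z).
Proof.
move=> ep.
have -> : away_from t e = period `&` [set z | cos (z - t) <= cos e].
  apply/seteqP; split => z [pz h]; split => //=; first exact/cos_ge_dist.
  by move: h => /= /(cos_ge_dist t z ep).
rewrite /cintegral !Rintegral_mkcondr; congr (_ +i* _); apply: eq_Rintegral => z _.
  rewrite patchE /truncated_cot; have [h|h] := boolP (cos (z - t) <= cos e).
    by rewrite ifT// inE.
  by rewrite ifF ?mul0r//; apply/negbTE; rewrite notin_setE; apply/negP.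
rewrite patchE /truncated_cot; have [h|h] := boolP (cos (z - t) <= cos e).
  by rewrite ifT// inE.
by rewrite ifF ?mul0r//; apply/negbTE; rewrite notin_setE; apply/negP.
Qed.

(** The cotangent is odd, so only the sine part of its coefficients survives. *)
Definition pvcoef (e : R) m : R := \int[mu]_(s in period) (truncated_cot e s * sin (m%:~R * s)).

Lemma fourier_truncated_cot e m : 0 < e < pi ->
  (2 * pi)%:C * fourier_coef (fun s => (truncated_cot e (- s))%:C) m = imc * (pvcoef e m)%:C.
Proof.
move=> ep; rewrite /fourier_coef mulrA -rmorphM mulfV ?mul1r; last by rewrite gt_eqF// twopi_gt0.
have ic : mu.-integrable period (EFin \o (fun s => truncated_cot e s * cos (m%:~R * s))).
  apply: (@integrable_mul_bounded _ _ _ 1); first exact: integrable_truncated_cot.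
    by move=> x; exact: der1_continuous (der1_cosM _ _).
  by move=> x; exact: cos_max.
have mp := @measurable_period R.
have c0 : \int[mu]_(s in period) (truncated_cot e s * cos (m%:~R * s)) = 0.
  have mf : cmeasurable (fun s : R => (truncated_cot e s * cos (m%:~R * s))%:C).
    apply: cmeasurable_real; apply: measurable_funM; first exact: measurable_truncated_cot.
    by apply: continuous_measurable_fun => x; exact: der1_continuous (der1_cosM _ _).
  have pf : periodic (fun s : R => (truncated_cot e s * cos (m%:~R * s))%:C).
    move=> s; rewrite periodic_truncated_cot; congr ((_ * _)%:C).
    by have := periodic_expi (R := R) m s; rewrite /expi => -[->].
  have := congr1 (@complex.Re R) (cintegral_reflect 0 mf pf).
  rewrite /=; under eq_Rintegral do rewrite sub0r truncated_cotN mulrN cosN mulNr -mulN1r.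
  rewrite RintegralZl//.
  by rewrite mulN1r => /eqP; rewrite eq_sym -addr_eq0 -mulr2n -mulr_natl mulf_eq0 pnatr_eq0/= => /eqP.
apply: eq_ReIm; rewrite !(ReM, ImM) /= ?mul0r ?subr0 ?add0r ?mul1r ?mulr0 ?subrr ?addr0.
  under eq_Rintegral do rewrite mul0r subr0 cosN truncated_cotN mulNr -mulN1r.
  by rewrite RintegralZl// c0 mulr0 oppr0.
by apply: eq_Rintegral => s _; rewrite mul0r addr0 sinN truncated_cotN mulrNN.
Qed.

Lemma pvcoefN e m : 0 < e < pi -> pvcoef e (- m) = - pvcoef e m.
Proof.
move=> ep; rewrite /pvcoef.
under eq_Rintegral do rewrite rmorphN/= mulNr sinN mulrN -mulN1r.
rewrite RintegralZl ?mulN1r//; first exact: measurable_period.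
apply: (@integrable_mul_bounded _ _ _ 1); first exact: integrable_truncated_cot.
  by move=> x; exact: der1_continuous (der1_sinM _ _).
by move=> x; exact: sin_max.
Qed.

Lemma period_cos_le (e : R) : 0 < e < pi -> period `&` [set s | cos s <= cos e] = `[e, 2 * pi - e]%classic.
Proof.
move=> ep; apply/seteqP; split => s.
  move=> [/= ps]; rewrite -[s]subr0 => /(cos_ge_dist 0 s ep) h.
  move: ps; rewrite /period/= !in_itv/= => /andP[s0 s2].
  have := h 0; have := h 1; rewrite mulr0 mulr1 !subr0 => h1 h0.
  rewrite ger0_norm// in h0; rewrite ler0_norm ?subr_le0// in h1.
  by rewrite h0/=; lra.
rewrite /= in_itv/= => /andP[h1 h2]; have /andP[e0 epi] := ep; split.
  by rewrite /period/= in_itv/=; apply/andP; split; lra.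
have := (cos_ge_dist 0 s ep).1; rewrite subr0; apply => k.
rewrite ler_normr; have [k0|k0] := leP k 0.
  apply/orP; left; rewrite -mulrN -rmorphN/=.
  have : 0 <= (- k)%:~R :> R by rewrite ler0z oppr_ge0.
  have := twopi_gt0 (R := R); nra.
apply/orP; right.
have : 1 <= k%:~R :> R by rewrite -[1]/(1%:~R) ler_int; lia.
have := twopi_gt0 (R := R); nra.
Qed.

(** After division by sin (s / 2) the integrand is the trigonometric polynomial of
    [sumcos_primitive], so truncation converges to the integral over the period. *)
Lemma cvg_pvcoef_pos (m : nat) : (0 < m)%N -> pvcoef e m @[e --> 0^'+] --> 2 * pi.
Proof.
move=> m0; have [F dF FE] := @sumcos_primitive R m m0.
have cF : continuous F by move=> x; exact: der1_continuous (dF x).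
apply: (@cvg_trans _ (F (2 * pi - e) - F e @[e --> 0^'+])).
  apply: near_eq_cvg; near=> e.
  have e0 : 0 < e by near: e; exact: nbhs_right_gt.
  have epi : e < pi by near: e; apply: nbhs_right_lt; exact: pi_gt0.
  have ep : 0 < e < pi by rewrite e0.
  have cD : continuous (fun s : R => 2 * cos (s / 2) * sumcos m s).
    rewrite (_ : (fun s => _) = fun s => 2 * cos (2^-1 * s) * sumcos m s); last by apply/funext => s; rewrite [s / 2]mulrC.
    apply: continuousMf; last exact: sumcos_continuous.
    apply: continuousMf => x; first exact: cst_continuous.
    exact: der1_continuous (der1_cosM _ _).
  have e2 : e < 2 * pi - e by lra.
  rewrite -(Rintegral_FTC2 e2 dF cD) -(period_cos_le ep) Rintegral_mkcondr /pvcoef.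
  apply: eq_Rintegral => s _; rewrite patchE /truncated_cot.
  have [h|h] := boolP (cos s <= cos e); last first.
    by rewrite ifF ?mul0r//; apply/negbTE; rewrite notin_setE; apply/negP.
  rewrite ifT ?inE//.
  rewrite sin_sumcos; field.
  have := cos_half s; apply: contra_eqN => /eqP ->; rewrite expr0n mulr0 subr0.
  apply/negP => /eqP c1; move: h; rewrite c1 -cos0 leNgt ltr_cos ?e0//; rewrite in_itv/= ?lexx ?pi_ge0//.
  by rewrite !ltW.
have <- : nbhs (F (2 * pi) - F 0) = nbhs (2 * pi) by rewrite FE.
apply: cvgB.
  apply: (@cvg_comp _ _ _ (fun e => 2 * pi - e) F _ (nbhs (2 * pi))); last exact: cF.
  have <- : nbhs (2 * pi - 0 : R) = nbhs (2 * pi) by rewrite subr0.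
  apply: cvgB; first exact: cvg_cst.
  exact: cvg_at_right_filter.
by apply: cvg_at_right_filter; exact: cF.
Unshelve. all: by end_near. Qed.

Lemma near0_pi : \forall e \near (0 : R)^'+, 0 < e < pi.
Proof.
near=> e; apply/andP; split; near: e; first exact: nbhs_right_gt.
by apply: nbhs_right_lt; exact: pi_gt0.
Unshelve. all: by end_near. Qed.

Lemma cvg_pvcoef m : pvcoef e m @[e --> 0^'+] --> 2 * pi * (Num.sg m)%:~R.
Proof.
have [m0|m0|->] := ltrgtP m 0.
- rewrite ltr0_sg// rmorphN1 mulrN1.
  have [n nE] : exists n : nat, m = - (n%:Z) by exists `|m|%N; lia.
  apply: (@cvg_trans _ (- pvcoef e n @[e --> 0^'+])).
    by apply: near_eq_cvg; apply: filterS near0_pi => e ep; rewrite nE pvcoefN.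
  by apply: cvgN; apply: cvg_pvcoef_pos; lia.
- rewrite gtr0_sg// mulr1; have [n nE] : exists n : nat, m = n%:Z by exists `|m|%N; lia.
  by rewrite nE; apply: cvg_pvcoef_pos; lia.
- rewrite sgr0 mulr0; apply: cvg_near_cst; near=> e.
  rewrite /pvcoef; under eq_Rintegral do rewrite mul0r sin0 mulr0.
  by rewrite /Rintegral integral0.
Unshelve. all: by end_near. Qed.

Lemma near_cvgc_eq {T : Type} (F : set_system T) {FF : Filter F} (f h : T -> R[i]) l :
  (\forall x \near F, f x = h x) -> cvgc F h l -> cvgc F f l.
Proof.
move=> fh [h1 h2]; split.
  by apply: cvg_trans h1; apply: near_eq_cvg; apply: filterS fh => x ->.
by apply: cvg_trans h2; apply: near_eq_cvg; apply: filterS fh => x ->.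
Qed.

Lemma cvgcMr_cst {T : Type} (F : set_system T) {FF : Filter F} (f : T -> R[i]) l c :
  cvgc F f l -> cvgc F (fun x => f x * c) (l * c).
Proof.
move=> /(cvgcM_cst c); rewrite mulrC; congr cvgc.
by apply/funext => x; rewrite mulrC.
Qed.

Definition T0symb m : R[i] := (- `|m%:~R|)%:C + (m == 0)%:R * imc.

Lemma cderive_fourier_sum u N z : cderive (fourier_sum u N) z =
  fourier_sum (fun m => (0 +i* m%:~R) * u m) N z.
Proof.
apply: cder_cderive.
have := @cder_sum R _ (index_enum 'I_(2 * N).+1) (fun j t => u (freq j) * expi ((freq j)%:~R * t)) z _ (fun j => cderZ (u (freq j)) (cder_expi (freq j)%:~R z)).
congr cder; rewrite fourier_sumE; apply: eq_bigr => j _.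
by rewrite mulrCA mulrA.
Qed.

(** The derivative contributes i m and the principal value 2 pi i sg m, whose
    product is - 2 pi |m|. *)
Lemma T0E u : T0 u = fun m => T0symb m * u m.
Proof.
apply: extend_multiplier => N t pt.
rewrite /opT0 cintegral_fourier_sum.
pose v m := (0 +i* m%:~R) * u m.
rewrite (@cvgc_clim _ _ _ _ _ (\sum_(j < (2 * N).+1) (imc * (2 * pi * (Num.sg (freq j))%:~R)%:C * v (freq j)) * expi ((freq j)%:~R * t))); last first.
  apply: (@near_cvgc_eq _ _ _ _ (fun e => \sum_(j < (2 * N).+1) (imc * (pvcoef e (freq j))%:C * v (freq j)) * expi ((freq j)%:~R * t))).
    apply: filterS near0_pi => e ep.
    rewrite cintegral_away//.
    transitivity (cintegral period (fun z => (truncated_cot e (- (t - z)))%:C * fourier_sum v N z)).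
      by apply: eq_cintegral => z _; rewrite cderive_fourier_sum opprB.
    have tN : (fun s => truncated_cot e (- s)) = (fun s => - truncated_cot e s) by apply/funext => s; rewrite truncated_cotN.
    rewrite (@cintegral_conv _ (fun s => truncated_cot e (- s))); last 3 first.
    - by rewrite tN; apply: measurable_funN; exact: measurable_truncated_cot.
    - by move=> s; rewrite !truncated_cotN periodic_truncated_cot.
    - rewrite tN; have := integrableZR (-1) (@measurable_period R) (integrable_truncated_cot ep).
      by under eq_fun do rewrite mulN1r.
    by apply: eq_bigr => j _; rewrite fourier_truncated_cot.
  apply: cvgc_sum => j; apply: cvgcMr_cst; apply: cvgcMr_cst; apply: cvgcM_cst.
  by split => /=; [exact: cvg_pvcoef|exact: cvg_cst].
rewrite rmorphV/= ?unitfE ?gt_eqF ?twopi_gt0//.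
rewrite mulrA mulfVK ?twopi_neq0// (sum_freq0 u N imc t) mulr_sumr -big_split/=.
apply: eq_bigr => j _; rewrite /T0symb /v [(2 * pi * _)%:C]rmorphM/=.
rewrite [in RHS]mulrDl [in RHS]mulrDl; congr (_ + _).
have -> : (- `|(freq j)%:~R|)%:C = imc * ((Num.sg (freq j))%:~R)%:C * (0 +i* (freq j)%:~R).
  by rewrite -intr_norm normrEsg rmorphM/=; apply: eq_ReIm; rewrite !(ReM, ImM)/=; ring.
rewrite [imc * (_ * _)]mulrCA !mulrA; congr (_ * _ * _); rewrite -!mulrA mulKf ?twopi_neq0//.
Qed.

End T0_symbol.

(** * Real analytic functions are smooth *)

Section smooth_functions.
Context {R : realType}.
Implicit Types f h : R -> R.

(** Continuous differentiability of order n, unfolded one derivative at a time to suit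
    the inductions below. *)
Fixpoint Cn (n : nat) f : Prop :=
  if n is n'.+1 then (forall x : R, derivable f x 1) /\ Cn n' (derive1 f) else continuous f.

Definition smooth f := forall n, Cn n f.

Lemma derivable1_continuous f : (forall x : R, derivable f x 1) -> continuous f.
Proof. by move=> df x; apply: differentiable_continuous; apply/derivable1_diffP. Qed.

Lemma Cn_continuous n f : Cn n f -> continuous f.
Proof. by case: n => [//|n [df _]]; exact: derivable1_continuous. Qed.

Lemma CnS n f : Cn n.+1 f -> Cn n f.
Proof.
elim: n f => [|n IH] f [df cf]; first exact: derivable1_continuous.
by split => //; exact: IH.
Qed.

Lemma der1_derive1 f (x : R) : derivable f x 1 -> is_derive x 1 f ((derive1 f) x).
Proof. by move=> df; apply: DeriveDef => //; rewrite derive1E. Qed.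

Lemma der1_derivable f (x a : R) : is_derive x 1 f a -> derivable f x 1.
Proof. by case. Qed.

Lemma der1_derive1E f (x a : R) : is_derive x 1 f a -> (derive1 f) x = a.
Proof. by move=> h; rewrite derive1E; exact: derive_val. Qed.

Lemma Cn_cst n (c : R) : Cn n (fun=> c).
Proof.
elim: n c => [|n IH] c; first by move=> x; exact: cst_continuous.
split; first by move=> x; exact: der1_derivable (der1_cst c x).
rewrite (_ : derive1 _ = fun=> 0); first exact: IH.
by apply/funext => x; exact: der1_derive1E (der1_cst c x).
Qed.

Lemma CnD n f h : Cn n f -> Cn n h -> Cn n (fun x => f x + h x).
Proof.
elim: n f h => [|n IH] f h; first exact: continuousDf.
move=> [df cf] [dh ch].
have d x := der1D (der1_derive1 (df x)) (der1_derive1 (dh x)).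
split; first by move=> x; exact: der1_derivable (d x).
rewrite (_ : derive1 _ = fun x => (derive1 f) x + (derive1 h) x); first exact: IH.
by apply/funext => x; exact: der1_derive1E (d x).
Qed.

Lemma CnM n f h : Cn n f -> Cn n h -> Cn n (fun x => f x * h x).
Proof.
elim: n f h => [|n IH] f h; first exact: continuousMf.
move=> cf0 ch0; have cf1 := CnS cf0; have ch1 := CnS ch0.
move: cf0 ch0 => [df cf] [dh ch].
have d x := der1M (der1_derive1 (df x)) (der1_derive1 (dh x)).
split; first by move=> x; exact: der1_derivable (d x).
rewrite (_ : derive1 _ = fun x => (derive1 f) x * h x + f x * (derive1 h) x).
  by apply: CnD; exact: IH.
by apply/funext => x; exact: der1_derive1E (d x).
Qed.

Lemma CnV n f : (forall x, f x != 0) -> Cn n f -> Cn n (fun x => (f x)^-1).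
Proof.
move=> f0; elim: n => [|n IH].
  by move=> cf x; apply: cvgV => //; exact: cf.
move=> cf0; have cf1 := CnS cf0; move: cf0 => [df cf].
have d (x : R) : is_derive x 1 (fun x => (f x)^-1) (-1 * ((derive1 f) x * ((f x)^-1 * (f x)^-1))).
  have := @is_deriveV R f x _ _ (f0 x) (der1_derive1 (df x)).
  congr is_derive; rewrite /GRing.scale/= expr2 invfM; ring.
split; first by move=> x; exact: der1_derivable (d x).
rewrite (_ : derive1 _ = fun x => -1 * ((derive1 f) x * ((f x)^-1 * (f x)^-1))).
  apply: CnM; first exact: Cn_cst.
  by apply: CnM => //; apply: CnM; exact: IH.
by apply/funext => x; exact: der1_derive1E (d x).
Qed.

Lemma smooth_cst (c : R) : smooth (fun=> c). Proof. by move=> n; exact: Cn_cst. Qed.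
Lemma smoothD f h : smooth f -> smooth h -> smooth (fun x => f x + h x).
Proof. by move=> sf sh n; exact: CnD. Qed.
Lemma smoothM f h : smooth f -> smooth h -> smooth (fun x => f x * h x).
Proof. by move=> sf sh n; exact: CnM. Qed.
Lemma smoothN f : smooth f -> smooth (fun x => - f x).
Proof.
move=> sf; rewrite (_ : (fun x => - f x) = fun x => -1 * f x).
  by apply: smoothM => //; exact: smooth_cst.
by apply/funext => x; rewrite mulN1r.
Qed.
Lemma smoothV f : (forall x, f x != 0) -> smooth f -> smooth (fun x => (f x)^-1).
Proof. by move=> f0 sf n; exact: CnV. Qed.
Lemma smooth_derive1 f : smooth f -> smooth (derive1 f).
Proof. by move=> sf n; case: (sf n.+1). Qed.
Lemma smooth_derivable f x : smooth f -> derivable f x 1.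
Proof. by move=> sf; case: (sf 1). Qed.
Lemma smooth_derive1n n f : smooth f -> smooth (derive1n n f).
Proof. by move=> sf; elim: n => [//|n IH]; rewrite derive1nS; exact: smooth_derive1. Qed.
Lemma smooth_continuous f : smooth f -> continuous f.
Proof. by move=> sf; exact: (sf 0). Qed.

Lemma periodic_derive1 f : (forall x : R, derivable f x 1) -> periodic f -> periodic (derive1 f).
Proof.
move=> df pf x.
have d : is_derive (x + 2 * pi) 1 f ((derive1 f) (x + 2 * pi)) by exact: der1_derive1.
have := @der1_comp _ f (fun t => t + 2 * pi) x _ _ d (der1D (der1_id x) (der1_cst (2 * pi) x)).
rewrite addr0 mul1r (_ : (fun t => f _) = f); last by apply/funext => t; exact: pf.
by move/der1_derive1E.
Qed.

Lemma periodic_derive1n n f : smooth f -> periodic f -> periodic (derive1n n f).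
Proof.
move=> sf pf; elim: n => [//|n IH]; rewrite derive1nS; apply: periodic_derive1 => // x.
by apply: smooth_derivable; exact: smooth_derive1n.
Qed.

(** Each of the n + 1 first terms of the geometric series is at least t^n. *)
Lemma natmul_geom_le (t : R) n : 0 <= t < 1 -> n.+1%:R * t ^+ n <= (1 - t)^-1.
Proof.
move=> /andP[t0 t1].
have h : n.+1%:R * t ^+ n <= \sum_(i < n.+1) t ^+ i.
  rewrite mulr_natl -[X in _ *+ X]card_ord -sumr_const; apply: ler_sum => i _.
  by rewrite ler_wiXn2l// ?(ltW t1)// -ltnS.
apply: le_trans h _.
have geom k : (1 - t) * \sum_(i < k) t ^+ i = 1 - t ^+ k.
  elim: k => [|k IH]; first by rewrite big_ord0 mulr0 expr0 subrr.
  by rewrite big_ord_recr/= mulrDr IH exprS; ring.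
rewrite -[leRHS]mul1r ler_pdivlMr ?subr_gt0// mulrC geom.
by rewrite gerBl exprn_ge0.
Qed.

Lemma is_cvg_series_shift (v : nat -> R) : cvgn (series v) -> cvgn (series (fun n => v n.+1)).
Proof.
move=> cv; rewrite (_ : series _ = (fun n => series v n.+1 - v 0%N)).
  apply: is_cvgB; last exact: is_cvg_cst.
  by move/cvg_ex : cv => [l hl]; apply/cvg_ex; exists l; rewrite cvg_shiftS.
by apply/funext => n; rewrite /series/= big_nat_recl// addrAC subrr add0r.
Qed.

(** For |x| < y < |K| the factor n + 1 produced by differentiation is absorbed by
    the ratio (|x| / y)^n ([natmul_geom_le]). *)
Lemma is_cvg_pseries_diffs (a : nat -> R) (K x : R) :
  cvgn (pseries a K) -> `|x| < `|K| -> cvgn (pseries (pseries_diffs a) x).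
Proof.
move=> Ca xK; pose y := (`|x| + `|K|) / 2.
have xy : `|x| < y by rewrite /y; lra.
have y0 : 0 < y by apply: le_lt_trans xy.
have yK : `|y| < `|K| by rewrite gtr0_norm// /y; lra.
have Cy := is_cvg_pseries_inside_norm Ca yK.
have t1 : 0 <= `|x| / y < 1 by rewrite divr_ge0 ?(ltW y0)//= ltr_pdivrMr// mul1r.
apply: normed_cvg.
apply: (@series_le_cvg _ _ (fun n => (1 - `|x| / y)^-1 * y^-1 * (`|a n.+1| * y ^+ n.+1))) => //.
- by move=> n /=.
- move=> n; rewrite !mulr_ge0 ?invr_ge0 ?exprn_ge0 ?(ltW y0)// subr_ge0; case/andP: t1 => _ /ltW //.
- move=> n /=; rewrite /pseries_diffs !normrM normr_nat normrX.
  have := natmul_geom_le n t1; rewrite expr_div_n => h.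
  have -> : (1 - `|x| / y)^-1 / y * (`|a n.+1| * y ^+ n.+1) = `|a n.+1| * (y ^+ n * (1 - `|x| / y)^-1).
    by rewrite exprS; field; rewrite gt_eqF//=; lra.
  rewrite [n.+1%:R * _]mulrC -mulrA ler_wpM2l//.
  rewrite -ler_pdivrMl ?exprn_gt0// mulrC -mulrA//.
- apply: (@is_cvg_seriesZ _ (fun n => `|a n.+1| * y ^+ n.+1) ((1 - `|x| / y)^-1 / y)).
  exact: is_cvg_series_shift Cy.
Qed.

(** Term by term differentiation needs convergence of the twice differentiated
    series at some z > |x|, whence the intermediate radii |x| < z < y < |K|. *)
Lemma pseries_derive (a : nat -> R) (K x : R) :
  cvgn (pseries a K) -> `|x| < `|K| ->
  is_derive x 1 (fun x => limn (pseries a x)) (limn (pseries (pseries_diffs a) x)).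
Proof.
move=> Ca xK; pose y := (`|x| + `|K|) / 2; pose z := (`|x| + y) / 2.
have xy : `|x| < y by rewrite /y; lra.
have y0 : 0 < y by apply: le_lt_trans xy.
have xz : `|x| < z by rewrite /z; lra.
have z0 : 0 < z by apply: le_lt_trans xz.
have yK : `|y| < `|K| by rewrite gtr0_norm// /y; lra.
have zy : `|z| < `|y| by rewrite !gtr0_norm// /z; lra.
have zK := lt_trans zy yK.
apply: (@pseries_snd_diffs _ _ z).
- exact: is_cvg_pseries_inside Ca zK.
- exact: is_cvg_pseries_diffs Ca zK.
- exact: is_cvg_pseries_diffs (is_cvg_pseries_diffs Ca yK) zy.
- by rewrite (gtr0_norm z0).
Qed.

Lemma real_analytic_derive f : real_analytic f ->
  (forall x : R, derivable f x 1) /\ real_analytic (derive1 f).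
Proof.
move=> af.
have key (t0 : R) : exists (a : nat -> R) (r : R), 0 < r /\ forall t : R, `|t - t0| < r ->
    is_derive t 1 f (limn (pseries (pseries_diffs a) (t - t0))) /\
    cvgn (pseries (pseries_diffs a) (t - t0)).
  have [a [r [r0 H]]] := af t0; exists a, r; split => // t tr.
  pose K := (`|t - t0| + r) / 2.
  have K1 : `|t - t0| < K by rewrite /K; lra.
  have K0 : 0 < K by apply: le_lt_trans K1.
  have K2 : K < r by rewrite /K; lra.
  have CK : cvgn (pseries a K).
    apply/cvg_ex; exists (f (t0 + K)).
    have -> : K = t0 + K - t0 by ring.
    have -> : t0 + (t0 + K - t0) = t0 + K by ring.
    by apply: H; rewrite (_ : t0 + K - t0 = K) ?gtr0_norm//; ring.
  have tK : `|t - t0| < `|K| by rewrite (gtr0_norm K0).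
  split; last exact: is_cvg_pseries_diffs CK tK.
  have d := @der1_comp _ (fun x => limn (pseries a x)) (fun t => t - t0) t _ _ (pseries_derive CK tK) (der1B (der1_id t) (der1_cst t0 t)).
  rewrite subr0 mul1r in d.
  apply: near_eq_is_derive d.
  have tn : \forall s \near t, `|s - t0| < r.
    exists (r - `|t - t0|) => /=; first by rewrite subr_gt0.
    move=> s /= hs; rewrite -(subrK t s) -addrA (le_lt_trans (ler_normD _ _))//.
    by rewrite -ltrBrDr distrC.
  by apply: filterS tn => s hs /=; apply/cvg_lim => //; exact: H.
split.
  move=> x; have [a [r [r0 H]]] := key x.
  by have [|d _] := H x; [rewrite subrr normr0|exact: der1_derivable d].
move=> t0; have [a [r [r0 H]]] := key t0; exists (pseries_diffs a), r; split => // t tr.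
by have [d c] := H t tr; rewrite (der1_derive1E d).
Qed.

Lemma real_analytic_smooth f : real_analytic f -> smooth f.
Proof.
move=> af n; elim: n f af => [|n IH] f af; have [df af'] := real_analytic_derive af.
  exact: derivable1_continuous.
by split => //; exact: IH.
Qed.

End smooth_functions.

(** * Decay of Fourier coefficients and convergence of Fourier series *)

Section fourier_series.
Context {R : realType}.
Notation mu := (@lebesgue_measure R).
Notation normc := Normc.normc.
Notation imc := (0 +i* 1 : R[i]).

Lemma periodic_bounded (f : R -> R) : continuous f -> periodic f -> exists M : R, forall x, `|f x| <= M.
Proof.
move=> cf pf.
have cn : {within `[- pi, pi], continuous (fun x => `|f x|)}.
  apply: continuous_subspaceT => x; apply: (@continuous_comp _ _ _ f (fun y : R => `|y|)); first exact: cf.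
  exact: norm_continuous.
have pip : - pi <= pi :> R by have := pi_ge0 R; lra.
have [c _ H] := EVT_max pip cn.
exists `|f c| => x; have [k hk] := periodic_reduce x.
have := periodicz (- k) x pf; rewrite rmorphN mulrN /= => <-.
by apply: H; rewrite in_itv/= -ler_norml.
Qed.

Lemma normc_fourier_coef (f : R -> R[i]) (M : R) m : cmeasurable f -> (forall x, period x -> normc (f x) <= M) ->
  normc (fourier_coef f m) <= 2 * M.
Proof.
move=> mf fM; have mp := @measurable_period R.
have me : cmeasurable (fun t => f t * expi (- (m%:~R * t))).
  apply: cmeasurableM => //; have := cmeasurable_expi (- m%:~R : R); congr cmeasurable.
  by apply/funext => t; rewrite mulNr.
have be t : period t -> normc (f t * expi (- (m%:~R * t))) <= M.
  by move=> pt; rewrite Normc.normcM normc_expi mulr1; exact: fM.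
have ie := cintegrable_bounded mp (@mu_period_fin R) me be.
have := normc_cintegral mp (@mu_period_fin R) ie be.
have -> : fine (mu period) = 2 * pi by rewrite mu_period.
rewrite /fourier_coef Normc.normcM normc_real ger0_norm ?invr_ge0 ?(ltW twopi_gt0)// => h.
rewrite ler_pdivrMl ?twopi_gt0//; apply: le_trans h _.
by rewrite le_eqVlt; apply/orP; left; apply/eqP; ring.
Qed.

Lemma fourier_coef_derive (f : R -> R) m : (forall x : R, derivable f x 1) -> continuous (derive1 f) -> periodic f ->
  fourier_coef (fun t => (derive1 f t)%:C) m = (0 +i* m%:~R) * fourier_coef (fun t => (f t)%:C) m.
Proof.
move=> df cf' pf; have mp := @measurable_period R.
have cf := derivable1_continuous df.
rewrite /fourier_coef mulrCA; congr (_ * _).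
pose F t := (f t)%:C * expi (- m%:~R * t).
pose G t := (derive1 f t)%:C * expi (- m%:~R * t).
have dF x : cder F x (G x + (0 +i* (- m%:~R)) * F x).
  have := cderM (cder_real (der1_derive1 (df x))) (cder_expi (- m%:~R) x).
  by rewrite mulrCA.
have cF : ccontinuous F by apply: ccontinuousM; [exact: ccontinuous_real|exact: ccontinuous_expi].
have cG : ccontinuous G by apply: ccontinuousM; [exact: ccontinuous_real|exact: ccontinuous_expi].
have cZF : ccontinuous (fun x => (0 +i* (- m%:~R)) * F x) by apply: ccontinuousM => //; exact: ccontinuous_cst.
have := cintegral_FTC2 dF (ccontinuousD cG cZF).
have -> : F (2 * pi) - F 0 = 0.
  rewrite /F -[X in f X]add0r pf -rmorphN expi_twopi mulr0 expi0 subrr//.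
rewrite cintegralD//; try exact: ccontinuous_integrable.
rewrite cintegralZ//; last exact: ccontinuous_integrable.
move/eqP; rewrite addr_eq0 => /eqP h.
transitivity (cintegral period G); first by apply: eq_cintegral => t _; rewrite /G mulNr.
rewrite h -mulNr; congr (_ * _); first by apply: eq_ReIm; rewrite /= ?oppr0 ?opprK.
by apply: eq_cintegral => t _; rewrite /F mulNr.
Qed.

(** Decay faster than any power of the weight 1 + m^2 of the Sobolev norms. *)
Definition rapid (c : int -> R[i]) := forall n, exists2 C : R, 0 <= C & forall m, normc (c m) * (1 + m%:~R ^+ 2) ^+ n <= C.

Lemma fourier_decay_pow (n : nat) (f : R -> R) : Cn n f -> periodic f -> exists2 C : R, 0 <= C & forall m,
  normc (fourier_coef (fun t => (f t)%:C) m) * `|m%:~R| ^+ n <= C.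
Proof.
elim: n f => [|n IH] f cf pf.
  have [M HM] := periodic_bounded cf pf.
  have M0 : 0 <= M by apply: le_trans (HM 0).
  exists (2 * M) => [|m]; first by rewrite mulr_ge0.
  rewrite expr0 mulr1; apply: normc_fourier_coef.
    by apply: cmeasurable_real; exact: continuous_measurable_fun.
  by move=> x _; rewrite normc_real.
move: cf => [df cf']; have [C C0 HC] := IH _ cf' (periodic_derive1 df pf).
exists C => // m; have := HC m.
rewrite (fourier_coef_derive m df (Cn_continuous cf') pf).
by rewrite Normc.normcM normc_imag exprS mulrCA mulrA.
Qed.

Lemma smooth_rapid (f : R -> R) : smooth f -> periodic f -> rapid (fourier_coef (fun t => (f t)%:C)).
Proof.
move=> sf pf n.
have [C0 C00 H0] := fourier_decay_pow (sf 0%N) pf.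
have [C1 C10 H1] := fourier_decay_pow (sf (2 * n)%N) pf.
exists (2 ^+ n * (C0 + C1)) => [|m]; first by rewrite mulr_ge0 ?exprn_ge0 ?addr_ge0.
move: (H0 m) (H1 m); rewrite expr0 mulr1 exprM real_normK ?num_real//.
set c := normc _ => h0 h1; set y : R := m%:~R ^+ 2 in h1 *.
have y0 : 0 <= y by exact: sqr_ge0.
have c0 : 0 <= c by exact: normc_ge0.
have hy : (1 + y) ^+ n <= 2 ^+ n * (1 + y ^+ n).
  have [y1|y1] := leP y 1.
    apply: (@le_trans _ _ (2 ^+ n)); first by rewrite lerXn2r ?nnegrE//; lra.
    by rewrite ler_peMr ?exprn_ge0// lerDl exprn_ge0.
  apply: (@le_trans _ _ ((2 * y) ^+ n)); first by rewrite lerXn2r ?nnegrE//; lra.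
  by rewrite exprMn ler_wpM2l ?exprn_ge0// lerDr.
apply: le_trans (ler_wpM2l c0 hy) _.
rewrite mulrCA ler_wpM2l ?exprn_ge0// mulrDr mulr1; exact: lerD.
Qed.

Lemma conjc_expi (a : R) : (expi a)^*%C = expi (- a) :> R[i].
Proof. by rewrite /expi cosN sinN. Qed.

Lemma fourier_coefD (f h : R -> R[i]) m : cintegrable period f -> cintegrable period h ->
  fourier_coef (fun t => f t + h t) m = fourier_coef f m + fourier_coef h m.
Proof.
move=> fi hi; rewrite /fourier_coef -mulrDr -cintegralD; last 3 first.
- exact: measurable_period.
- exact: cintegrable_mul_expiN.
- exact: cintegrable_mul_expiN.
by congr (_ * _); apply: eq_cintegral => t _; rewrite mulrDl.
Qed.

Lemma normc_sqr (z : R[i]) : normc z ^+ 2 = complex.Re z ^+ 2 + complex.Im z ^+ 2.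
Proof. by case: z => a b /=; rewrite sqr_sqrtr// addr_ge0// sqr_ge0. Qed.

Lemma ReJM (z : R[i]) : complex.Re (z^*%C * z) = normc z ^+ 2.
Proof. by rewrite normc_sqr ReM; case: z => a b /=; ring. Qed.

Lemma Re_sum (I : Type) (r : seq I) (F : I -> R[i]) : complex.Re (\sum_(i <- r) F i) = \sum_(i <- r) complex.Re (F i).
Proof. by elim: r => [|i r IH]; rewrite ?big_nil// !big_cons ReD IH. Qed.

Lemma conjc_sum (I : Type) (r : seq I) (F : I -> R[i]) : (\sum_(i <- r) F i)^*%C = \sum_(i <- r) (F i)^*%C.
Proof. exact: rmorph_sum. Qed.

(** With P the partial sum of the Fourier series, the integral of 2 Re (conj P g) -
    |P|^2 over the period is 2 pi times the sum of the squares, because P and g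
    have the same coefficients at the frequencies of P; and pointwise
    2 Re (conj P g) - |P|^2 <= |g|^2 <= B^2. *)
Lemma bessel (g : R -> R[i]) (B : R) N : cmeasurable g -> (forall x, normc (g x) <= B) ->
  \sum_(j < (2 * N).+1) normc (fourier_coef g (freq j)) ^+ 2 <= B ^+ 2.
Proof.
move=> mg gB; have mp := @measurable_period R.
have B0 : 0 <= B by apply: le_trans (gB 0); exact: normc_ge0.
pose c (k : int) := fourier_coef g k.
pose P (t : R) := \sum_(j < (2 * N).+1) c (freq j) * expi ((freq j)%:~R * t).
have ig : cintegrable period g by apply: (cintegrable_bounded mp (@mu_period_fin R) mg) => x _; exact: gB.
have iP : cintegrable period P.
  by apply: cintegrable_sum => // j; apply: cintegrableZ => //; exact: cintegrable_expi.
(* H is conj P * (2 g - P), expanded along the terms of conj P. *)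
pose Q t := (2%:R : R)%:C * g t + (-1 : R)%:C * P t.
have iQ : cintegrable period Q by apply: cintegrableD => //; exact: cintegrableZ.
have Qc (j : 'I_(2 * N).+1) : fourier_coef Q (freq j) = c (freq j).
  rewrite fourier_coefD; [|exact: cintegrableZ..].
  rewrite !fourier_coefZ// /P fourier_coef_trig freq_le -/(c (freq j)) rmorph_nat rmorphN1; ring.
pose H (t : R) := \sum_(j < (2 * N).+1) (c (freq j))^*%C * (Q t * expi (- ((freq j)%:~R * t))).
have iH : cintegrable period H.
  by apply: cintegrable_sum => // j; apply: cintegrableZ => //; exact: cintegrable_mul_expiN.
have HE : cintegral period H = \sum_(j < (2 * N).+1) (2 * pi)%:C * ((c (freq j))^*%C * c (freq j)).
  rewrite cintegral_sum//; last by move=> j; apply: cintegrableZ => //; exact: cintegrable_mul_expiN.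
  apply: eq_bigr => j _; rewrite cintegralZ//; last exact: cintegrable_mul_expiN.
  rewrite mulrCA; congr (_ * _); rewrite -[in RHS]Qc /fourier_coef mulrA -rmorphM mulfV ?mul1r//.
  by rewrite gt_eqF// twopi_gt0.
have ReH t : complex.Re (H t) <= B ^+ 2.
  have -> : H t = (P t)^*%C * Q t.
    rewrite /P conjc_sum mulr_suml; apply: eq_bigr => j _.
    have -> : (c (freq j) * expi ((freq j)%:~R * t))^*%C = (c (freq j))^*%C * expi (- ((freq j)%:~R * t)).
      by rewrite -conjc_expi; exact: rmorphM.
    by rewrite -mulrA; congr (_ * _); rewrite mulrC.
  apply: (@le_trans _ _ (normc (g t) ^+ 2)); last by rewrite lerXn2r ?nnegrE ?normc_ge0.
  rewrite normc_sqr /Q ReM ReD ImD !ReM !ImM.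
  case: (P t) => a b; case: (g t) => a' b' /=.
  have := sqr_ge0 (a - a'); have := sqr_ge0 (b - b'); nra.
have : \int[mu]_(x in period) complex.Re (H x) <= \int[mu]_(x in period) (B ^+ 2).
  apply: le_Rintegral => //; first by case: iH.
  apply: measurable_bounded_integrable => //; first exact: mu_period_fin.
  by apply: (@bounded_by _ _ _ `|B ^+ 2|) => x _; exact: lexx.
rewrite Rintegral_cst//.
have -> : fine ((lebesgue_measure : {measure set _ -> \bar R}) period) = 2 * pi by exact: (congr1 fine (@mu_period R)).
have -> : \int[mu]_(x in period) complex.Re (H x) = complex.Re (cintegral period H) by [].
rewrite HE.
rewrite Re_sum (eq_bigr (fun j => 2 * pi * normc (c (@freq N j)) ^+ 2)).
  by rewrite -mulr_sumr mulrC ler_pM2r ?twopi_gt0.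
by move=> j _; rewrite [LHS]ReM ReJM [complex.Re (2 * pi)%:C]/= [complex.Im (2 * pi)%:C]/= mul0r subr0.
Qed.

Lemma bessel_cvg0 (g : R -> R[i]) (B : R) : cmeasurable g -> (forall x, normc (g x) <= B) ->
  normc (fourier_coef g N%:Z) @[N --> \oo] --> 0 /\ normc (fourier_coef g (- N%:Z)) @[N --> \oo] --> 0.
Proof.
move=> mg gB.
pose a k := normc (fourier_coef g k) ^+ 2.
have a0 k : 0 <= a k by exact: sqr_ge0.
pose s := zpart a.
have sS N : s N.+1 = s N + (a N.+1%:Z + a (- N.+1%:Z)) by exact: zpartS.
have cs : cvgn s.
  apply: nondecreasing_is_cvgn.
    by apply/nondecreasing_seqP => n; rewrite sS lerDl addr_ge0.
  by exists (B ^+ 2) => _ [n _ <-]; exact: bessel.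
have d0 : s N.+1 - s N @[N --> \oo] --> 0.
  rewrite -(subrr (limn s)); apply: cvgB => //.
  by rewrite (@cvg_shiftS _ s).
have sq (b : nat -> R) : (forall n, 0 <= b n) -> (forall n, b n.+1 ^+ 2 <= s n.+1 - s n) -> b n @[n --> \oo] --> 0.
  move=> b0 hb.
  have h2 : b n.+1 ^+ 2 @[n --> \oo] --> 0.
    apply: (squeeze_cvgr _ (cvg_cst _) d0); apply: nearW => n; by rewrite sqr_ge0 hb.
  rewrite -cvg_shiftS /=.
  have := cvg_comp _ _ h2 (@sqrt_continuous R 0); rewrite sqrtr0.
  apply: cvg_trans; apply: near_eq_cvg; apply: nearW => n /=.
  by rewrite sqrtr_sqr ger0_norm.
split; apply: sq => n; try exact: normc_ge0; rewrite sS addrC addKr -/(a _).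
  by rewrite lerDl.
by rewrite lerDr.
Qed.

(** The inverse of exp (i s) - 1 off the multiples of 2 pi. *)
Definition half_cot_kernel (s : R) : R[i] := (- 2^-1) +i* (- (cos (s / 2) / sin (s / 2) / 2)).

Lemma half_cot_kernelP (s : R) : sin (s / 2) != 0 -> (expi s - 1) * half_cot_kernel s = 1.
Proof.
move=> s0; have e : s = s / 2 + s / 2 by field.
have c2 := cos2Dsin2 (s / 2).
have hc : cos s = 1 - 2 * sin (s / 2) ^+ 2 by exact: cos_half.
have hs : sin s = 2 * sin (s / 2) * cos (s / 2) by rewrite {1}e sinD; ring.
have c2' : cos (s / 2) ^+ 2 = 1 - sin (s / 2) ^+ 2 by move: c2; lra.
apply: eq_ReIm; rewrite ?ReM ?ImM ?ReD ?ImD /= hc hs.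
  transitivity (cos (s / 2) ^+ 2 + sin (s / 2) ^+ 2); last exact: c2.
  by field.
by field: c2'.
Qed.

Lemma cmeasurable_half_cot (t0 : R) : cmeasurable (fun t => half_cot_kernel (t - t0)).
Proof.
split => /=; first exact: measurable_cst.
have h (a : R) : continuous (fun t : R => a * t) by move=> x; apply: cvgMr; exact: cvg_id.
have -> : (fun x : R => - (cos ((x - t0) / 2) / sin ((x - t0) / 2) / 2)) =
          (fun x : R => (-2^-1) * (cos (2^-1 * (x - t0)) * (sin (2^-1 * (x - t0)))^-1)).
  by apply/funext => x; rewrite ![_ / 2]mulrC mulNr.
apply: measurable_funM; first exact: measurable_cst.
have m1 : measurable_fun setT (fun x : R => x - t0) by apply: measurable_funB => //; exact: measurable_cst.
apply: measurable_funM.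
  apply: (measurableT_comp (f := fun s : R => cos (2^-1 * s)) _ m1).
  by apply: continuous_measurable_fun => x; exact: der1_continuous (der1_cosM _ _).
apply: (measurableT_comp measurable_invR).
apply: (measurableT_comp (f := fun s : R => sin (2^-1 * s)) _ m1).
by apply: continuous_measurable_fun => x; exact: der1_continuous (der1_sinM _ _).
Qed.

(** The derivative of sin y - y cos y is y sin y >= 0. *)
Lemma mul_cos_le_sin (y : R) : 0 <= y <= pi / 2 -> y * cos y <= sin y.
Proof.
move=> /andP[y0 ypi]; have pip := pi_gt0 R.
pose F (z : R) := sin z - z * cos z.
have dF (z : R) : is_derive z 1 F (z * sin z).
  have := der1B (is_derive_sin z) (der1M (der1_id z) (is_derive_cos z)).
  by congr is_derive; ring.
have := @ger0_derive1_le_cc R F 0 y.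
rewrite -subr_ge0 -/(F y) => H.
have F0 : F 0 = 0 by rewrite /F sin0 mul0r subrr.
rewrite -F0; apply: H.
- by move=> z _; exact: der1_derivable (dF z).
- move=> z; rewrite in_itv/= => /andP[z0 zy]; rewrite (der1_derive1E (dF z)) mulr_ge0 ?(ltW z0)//.
  by rewrite sin_ge0_pi//; apply/andP; split; lra.
- by apply: continuous_subspaceT => z; exact: der1_continuous (dF z).
- by rewrite in_itv/= lexx y0.
- by rewrite in_itv/= y0 lexx.
- by [].
Qed.

Lemma lip_cot_bound (x : R) : `|x| <= pi -> `|x * (cos (x / 2) / sin (x / 2))| <= 2.
Proof.
move=> xpi; have pip := pi_gt0 R.
wlog x0 : x xpi / 0 <= x.
  move=> H; have [|x0] := leP 0 x; first exact: H.
  have := H (- x); rewrite normrN => /(_ xpi).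
  by rewrite oppr_ge0 (ltW x0) [- x / 2]mulNr cosN sinN invrN mulrN mulrNN => /(_ isT).
rewrite (ger0_norm x0) in xpi.
have [->|xn0] := eqVneq x 0; first by rewrite mul0r normr0.
have xp : 0 < x by rewrite lt_neqAle eq_sym xn0.
have sp : 0 < sin (x / 2) by apply: sin_gt0_pi; apply/andP; split; lra.
have cp : 0 <= cos (x / 2) by apply: cos_ge0_pihalf; apply/andP; split; lra.
have := @mul_cos_le_sin (x / 2); rewrite divr_ge0//= => h.
rewrite ger0_norm; last by rewrite mulr_ge0// divr_ge0// ltW.
rewrite mulrA ler_pdivrMr//.
have : x / 2 * cos (x / 2) <= sin (x / 2) by apply: h; lra.
rewrite mulrAC ler_pdivrMr// mulrC. lra.
Qed.

Lemma normc_opp (z : R[i]) : normc (- z) = normc z.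
Proof. by case: z => a b /=; rewrite !sqrrN. Qed.

Lemma cvgn0D (a b : nat -> R) : a n @[n --> \oo] --> 0 -> b n @[n --> \oo] --> 0 ->
  a n + b n @[n --> \oo] --> 0.
Proof.
move=> ha hb; have <- : nbhs (0 + 0 : R) = nbhs 0 by rewrite addr0.
exact: cvgD.
Qed.

Lemma normc_cvgc (f : nat -> R[i]) (l : R[i]) :
  normc (f n - l) @[n --> \oo] --> 0 -> cvgc \oo f l.
Proof.
move=> h; split; apply/cvgrPdist_le => e e0; near=> n.
  rewrite distrC -ReN -ReD (le_trans (normRe _))// -[leLHS]ger0_norm ?normc_ge0//.
  by near: n; move/cvgr0Pnorm_le : h; apply.
rewrite distrC -ImN -ImD (le_trans (normIm _))// -[leLHS]ger0_norm ?normc_ge0//.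
by near: n; move/cvgr0Pnorm_le : h; apply.
Unshelve. all: by end_near. Qed.

(** Divide f - f t0 by exp (i (t - t0)) - 1: the Lipschitz condition at t0 makes the
    quotient g bounded. On coefficients, multiplication by exp (i (t - t0)) - 1 is
    a difference of neighbours, so the partial sum at t0 minus f t0 telescopes to
    two coefficients of g, at the frequencies - N - 1 and N, which tend to 0 by
    Bessel's inequality. *)
Lemma fourier_series_cvg (f : R -> R[i]) (M B : R) (t0 : R) :
  cmeasurable f -> periodic f -> (forall t, normc (f t) <= B) ->
  (forall t, normc (f t - f t0) <= M * `|t - t0|) ->
  cvgc \oo (fun N => fourier_sum (fourier_coef f) N t0) (f t0).
Proof.
move=> mf pf fB fM; have mp := @measurable_period R; have pip := pi_gt0 R.
have M0 : 0 <= M.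
  have := fM (t0 + 1); rewrite (_ : t0 + 1 - t0 = 1) ?normr1 ?mulr1; last by ring.
  by apply: le_trans; exact: normc_ge0.
(* Where the division is by 0, f t = f t0 by periodicity and g t = 0. *)
pose g t := (f t - f t0) * half_cot_kernel (t - t0).
have fk (t : R) (k : int) : f (t - 2 * pi * k%:~R) = f t.
  by rewrite -(periodicz (- k) t pf) rmorphN mulrN.
have gB t : normc (g t) <= M * (pi + 1).
  have [k hk] := periodic_reduce (t - t0).
  set x := t - t0 - 2 * pi * k%:~R in hk.
  have fx : normc (f t - f t0) <= M * `|x|.
    rewrite -(fk t k); have := fM (t - 2 * pi * k%:~R).
    by congr (_ <= _ * `|_|); rewrite /x; ring.
  have cx : cos ((t - t0) / 2) / sin ((t - t0) / 2) = cos (x / 2) / sin (x / 2).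
    have := periodicz (- k) (t - t0) periodic_cot.
    by rewrite rmorphN mulrN => <-.
  rewrite /g Normc.normcM.
  have hn : normc (half_cot_kernel (t - t0)) <= 2^-1 + `|cos (x / 2) / sin (x / 2)| / 2.
    apply: le_trans (normc_leReIm _) _; rewrite /= cx !normrN normrM [`|2^-1|]ger0_norm//.
  apply: le_trans (ler_pM (normc_ge0 _) (normc_ge0 _) fx hn) _.
  have := lip_cot_bound hk; rewrite normrM => h2.
  rewrite -mulrA ler_wpM2l// mulrDr mulrA; lra.
have mg : cmeasurable g.
  apply: cmeasurableM; last exact: cmeasurable_half_cot.
  by apply: cmeasurableD => //; exact: cmeasurable_cst.
have hg t : f t - f t0 = (expi (t - t0) - 1) * g t.
  have [s0|s0] := eqVneq (sin ((t - t0) / 2)) 0; last first.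
    by rewrite mulrCA half_cot_kernelP// mulr1.
  have [k hk] := periodic_reduce (t - t0).
  set x := t - t0 - 2 * pi * k%:~R in hk.
  have cx : cos x = 1.
    have <- : cos (t - t0) = cos x.
      by have := periodicz (- k) (t - t0) (@periodic_cos R); rewrite rmorphN mulrN => <-.
    by rewrite cos_half s0 expr0n mulr0 subr0.
  have x0 : x = 0.
    apply/eqP; rewrite -normr_le0 leNgt; apply/negP => xp.
    have : cos `|x| < cos 0.
      by rewrite ltr_cos// in_itv/= ?normr_ge0 ?lexx ?pi_ge0.
    have -> : cos `|x| = cos x.
      by have [h|h] := leP 0 x; [rewrite ger0_norm|rewrite ltr0_norm// cosN].
    by rewrite cx cos0 ltxx.
  have tx : t - 2 * pi * k%:~R = x + t0 by rewrite /x; ring.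
  have ft : f t = f t0 by rewrite -(fk t k) tx x0 add0r.
  by rewrite /g ft subrr mul0r mulr0.
have ig : cintegrable period g by apply: (cintegrable_bounded mp (@mu_period_fin R) mg) => t _; exact: gB.
have if_ : cintegrable period f by apply: (cintegrable_bounded mp (@mu_period_fin R) mf) => t _; exact: fB.
pose G k := fourier_coef g k * expi (k%:~R * t0).
have hcoef k : (fourier_coef f k - f t0 * (k == 0)%:R) * expi (k%:~R * t0) = G (k - 1) - G k.
  have i1 : cintegrable period (fun t => g t * expi (1%:~R * t)) by exact: cintegrable_mul_expi.
  have e1 : fourier_coef (fun t => f t + (- f t0) * expi (0%:~R * t)) k = fourier_coef f k - f t0 * (k == 0)%:R.
    rewrite fourier_coefD//; last by apply: cintegrableZ => //; exact: cintegrable_expi.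
    by rewrite fourier_coefZ ?fourier_coef_expi ?mulNr 1?eq_sym//; exact: cintegrable_expi.
  have e2 : fourier_coef (fun t => f t + (- f t0) * expi (0%:~R * t)) k = expi (- t0) * fourier_coef g (k - 1) - fourier_coef g k.
    transitivity (fourier_coef (fun t => expi (- t0) * (g t * expi (1%:~R * t)) + (-1) * g t) k).
      apply: eq_fourier_coef => t _; rewrite !mul0r expi0 mulr1 hg mul1r expiD; ring.
    rewrite fourier_coefD; [|exact: cintegrableZ..].
    by rewrite !fourier_coefZ// fourier_coef_mul_expi mulN1r.
  rewrite -e1 e2 /G mulrBl; congr (_ - _).
  by rewrite -mulrA mulrCA -expiD rmorphB/=; congr (_ * expi _); ring.
have tele N : fourier_sum (fourier_coef f) N t0 - f t0 = G (- N.+1%:Z) - G N%:Z.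
  have -> : f t0 = \sum_(j < (2 * N).+1) f t0 * (freq j == 0)%:R * expi ((freq j)%:~R * t0).
    rewrite -[RHS](eq_bigr _ (fun j _ => _ : f t0 * expi ((freq j)%:~R * t0) * (freq j == 0)%:R = _)).
      by rewrite (sum_freq_eq (fun k => f t0 * expi (k%:~R * t0))) /= mul0r expi0 mulr1.
    by move=> j _; rewrite mulrAC.
  rewrite fourier_sumE -sumrB.
  under eq_bigr do rewrite -mulrBl hcoef.
  have T (F : nat -> R[i]) n : \sum_(j < n) (F j - F j.+1) = F 0%N - F n.
    elim: n => [|n IH]; first by rewrite big_ord0 subrr.
    by rewrite big_ord_recr/= IH addrA subrK.
  have := T (fun j => G (j%:Z - N%:Z - 1)) (2 * N).+1.
  rewrite (_ : (0%N%:Z - N%:Z - 1) = - N.+1%:Z); last by lia.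
  rewrite (_ : ((2 * N).+1%:Z - N%:Z - 1) = N%:Z); last by lia.
  move=> <-; apply: eq_bigr => j _; congr (G _ - G _); rewrite /freq; lia.
have [h1 h2] := bessel_cvg0 mg gB.
apply: normc_cvgc.
have h3 : normc (fourier_coef g (- N.+1%:Z)) + normc (fourier_coef g N%:Z) @[N --> \oo] --> 0.
  have h2' : normc (fourier_coef g (- N.+1%:Z)) @[N --> \oo] --> 0.
    rewrite -(@cvg_shiftS _ (fun N : nat => normc (fourier_coef g (- N%:Z)))) in h2; exact: h2.
  exact: (cvgn0D h2' h1).
apply: (squeeze_cvgr _ (cvg_cst _) h3); apply: nearW => N.
rewrite normc_ge0 andTb tele (le_trans (le_normcD _ _))// normc_opp.
by rewrite /G !Normc.normcM !normc_expi !mulr1.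
Qed.

End fourier_series.

(** * Weighted sums over the integers *)

Section weighted_sums.
Context {R : realType}.
Notation normc := Normc.normc.
Local Open Scope ereal_scope.
Implicit Types (a b : int -> \bar R).

Definition zsum a : \bar R := \esum_(m in [set: int]) a m.

Lemma zsum_ge0 a : (forall m, 0 <= a m) -> 0 <= zsum a.
Proof. by move=> a0; apply: esum_ge0 => m _. Qed.

Lemma le_zsum a b : (forall m, a m <= b m) -> zsum a <= zsum b.
Proof. by move=> ab; apply: le_esum => m _. Qed.

Lemma eq_zsum a b : (forall m, a m = b m) -> zsum a = zsum b.
Proof. by move=> ab; apply: eq_esum => m _. Qed.

Lemma zsumD a b : (forall m, 0 <= a m) -> (forall m, 0 <= b m) ->
  zsum (fun m => a m + b m) = zsum a + zsum b.
Proof. by move=> a0 b0; apply: esumD. Qed.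

Lemma zsumZ (c : R) a : (0 <= c)%R -> (forall m, 0 <= a m) ->
  zsum (fun m => c%:E * a m) = c%:E * zsum a.
Proof.
have le (d : R) b : (0 <= d)%R -> (forall m, 0 <= b m) -> zsum (fun m => d%:E * b m) <= d%:E * zsum b.
  move=> d0 b0; apply: ge_ereal_sup => _ [A [finA _] <-].
  rewrite -ge0_mule_fsumr// lee_wpmul2l ?lee_fin//.
  by apply: ereal_sup_ubound; exists A.
move=> c0 a0; apply/eqP; rewrite eq_le le//=.
have [->|cn0] := eqVneq c 0%R.
  by rewrite mul0e; apply: zsum_ge0 => m; rewrite mul0e.
have cp : (0 < c)%R by rewrite lt_neqAle eq_sym cn0.
rewrite -[leRHS]mul1e -(mulfV cn0) EFinM -muleA lee_wpmul2l ?lee_fin//.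
have := @le c^-1%R (fun m => c%:E * a m); rewrite invr_ge0 => /(_ c0).
move=> /(_ (fun m => mule_ge0 (c0 : 0 <= c%:E) (a0 m))); apply: le_trans.
by apply: le_zsum => m; rewrite muleA -EFinM mulVf// mul1e.
Qed.

Lemma zsum_term a m : (forall k, 0 <= a k) -> a m <= zsum a.
Proof.
move=> a0; apply: esum_ge; exists [set m]; first by split.
by rewrite fsbig_set1.
Qed.

Lemma zsum_reflect a (m : int) : zsum (fun k => a (m - k)%R) = zsum a.
Proof.
rewrite /zsum -(@reindex_esum R int int setT setT (fun k => (m - k)%R) a)//.
split => //.
- by move=> x y _ _ /addrI /oppr_inj.
- by move=> y _; exists (m - y)%R => //; rewrite subKr.
Qed.

Lemma zsum_shift a (k : int) : zsum (fun m => a (m - k)%R) = zsum a.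
Proof.
rewrite /zsum -(@reindex_esum R int int setT setT (fun m => (m - k)%R) a)//.
split => //.
- by move=> x y _ _ /addIr.
- by move=> y _; exists (y + k)%R => //; rewrite addrK.
Qed.

Lemma exchange_zsum (a : int -> int -> \bar R) : (forall m k, 0 <= a m k) ->
  zsum (fun m => zsum (a m)) = zsum (fun k => zsum (a ^~ k)).
Proof.
move=> a0; rewrite /zsum !esum_esum//.
rewrite (@reindex_esum R _ _ (setT `*`` (fun=> setT)) (setT `*`` (fun=> setT)) (fun x : int * int => (x.2, x.1)))//.
split => //.
- by move=> [x1 x2] [y1 y2] _ _ [-> ->].
- by move=> [y1 y2] _; exists (y2, y1).
Qed.

Lemma window_le_zsum a N : (forall m, 0 <= a m) -> \sum_(j < (2 * N).+1) a (freq j) <= zsum a.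
Proof.
move=> a0; pose s := [seq freq j | j <- enum 'I_(2 * N).+1].
have us : uniq s by rewrite map_inj_uniq ?enum_uniq//; exact: freq_inj.
apply: esum_ge; exists [set` s]; first by split => //; exact: finite_seq.
by rewrite -fsbig_seq// big_map big_enum.
Qed.

Lemma zsum_le_window a (C : \bar R) : (forall m, 0 <= a m) ->
  (forall N, \sum_(j < (2 * N).+1) a (freq j) <= C) -> zsum a <= C.
Proof.
move=> a0 H; apply: ge_ereal_sup => _ [X [finX _] <-].
move/finite_seqP : finX => [s ->].
pose N := (\max_(x <- s) `|x|)%N.
apply: le_trans (H N).
pose w := [seq freq j | j <- enum 'I_(2 * N).+1].
have uw : uniq w by rewrite map_inj_uniq ?enum_uniq//; exact: freq_inj.
have -> : \sum_(j < (2 * N).+1) a (freq j) = \sum_(i \in [set` w]) a i.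
  by rewrite -fsbig_seq// big_map big_enum.
apply: lee_fsum_nneg_subset => //; try exact: finite_seq.
move=> x; rewrite !inE /= => xs.
have [j <-] := @freqP N x (leq_bigmax_seq _ xs isT).
by apply/mapP; exists j => //; rewrite mem_enum.
Qed.

Definition wt (m : int) : R := (1 + m%:~R ^+ 2)%R.

Lemma wt_ge1 m : (1 <= wt m)%R.
Proof. by rewrite /wt lerDl sqr_ge0. Qed.

Lemma wt_gt0 m : (0 < wt m)%R.
Proof. exact: lt_le_trans (wt_ge1 m). Qed.

(** Peetre's inequality; it lets the weight at m be shared between k and m - k in a
    convolution. *)
Lemma peetre m k : (wt m <= 2 * wt k * wt (m - k))%R.
Proof.
rewrite /wt rmorphB/=; set x : R := k%:~R; set y : R := m%:~R.
have := sqr_ge0 (x + x - y)%R; have := sqr_ge0 (x * (y - x))%R; nra.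
Qed.

(** The constant comes from the telescoping bound 5 - 4 / (N + 1) of the partial
    sums. *)
Lemma zsum_wtV : zsum (fun m => (wt m)^-1%:E) <= 5%:E.
Proof.
apply: zsum_le_window => [m|N]; first by rewrite lee_fin invr_ge0 ltW// wt_gt0.
apply: (@le_trans _ _ (5 - 4 / N.+1%:R)%:E); last by rewrite lee_fin gerBl divr_ge0.
rewrite sumEFin lee_fin.
have sS n : (\sum_(j < (2 * n.+1).+1) (wt (freq j))^-1 =
    \sum_(j < (2 * n).+1) (wt (freq j))^-1 + 2 / wt n.+1%:Z)%R.
  have := zpartS (fun k => (wt k)^-1)%R n; rewrite /zpart => ->.
  have -> : wt (- n.+1%:Z) = wt n.+1%:Z by rewrite /wt rmorphN sqrrN.
  by ring.
elim: N => [|N IH].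
  rewrite big_ord1 (_ : freq _ = 0%R)//.
  by rewrite /wt mulr0z expr0n /= addr0 invr1; lra.
rewrite sS; apply: le_trans (lerD IH (lexx _)) _.
rewrite /wt -[(N.+2)%:R]natr1 -[(N.+1)%:R]natr1 -[N.+1%:Z%:~R]/(N.+1%:R) -[(N.+1)%:R]natr1.
set x : R := N%:R; have x0 : (0 <= x)%R by [].
rewrite -subr_ge0.
rewrite (_ : (_ - _)%R = (2 * (x ^+ 2 + x + 2) / ((x + 1) * (x + 1 + 1) * (1 + (x + 1) ^+ 2)))%R).
  by rewrite divr_ge0 ?mulr_ge0 ?addr_ge0 ?sqr_ge0//.
field.
by rewrite !gt_eqF.
Qed.

End weighted_sums.

(** * Symmetric partial sums *)

Section series.
Context {R : realType}.
Notation normc := Normc.normc.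
Implicit Types (w u v : int -> R[i]) (f h : int -> R).

Lemma zpart_mono f : (forall m, 0 <= f m) -> nondecreasing_seq (zpart f).
Proof.
by move=> f0; apply/nondecreasing_seqP => N; rewrite zpartS lerDl addr_ge0.
Qed.

Lemma zpart_le_zsum f N : (forall m, 0 <= f m) ->
  ((zpart f N)%:E <= zsum (fun m => (f m)%:E))%E.
Proof.
move=> f0; rewrite /zpart -sumEFin; apply: window_le_zsum => m.
by rewrite lee_fin.
Qed.

Lemma zsum_fin f (S : R) : (forall m, 0 <= f m) -> (zsum (fun m => (f m)%:E) <= S%:E)%E ->
  exists2 S' : R, zsum (fun m => (f m)%:E) = S'%:E & zpart f N @[N --> \oo] --> S'.
Proof.
move=> f0 fS; have z0 : (0 <= zsum (fun m => (f m)%:E))%E by apply: zsum_ge0 => m; rewrite lee_fin.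
have ff : zsum (fun m => (f m)%:E) \is a fin_num.
  by rewrite ge0_fin_numE// (le_lt_trans fS)// ltry.
set Z := fine (zsum (fun m => (f m)%:E)).
have ZE : zsum (fun m => (f m)%:E) = Z%:E by rewrite fineK.
exists Z => //.
have up N : zpart f N <= Z by rewrite -lee_fin -ZE zpart_le_zsum.
have ub : has_ubound (range (zpart f)) by exists Z => _ [N _ <-].
have cv := nondecreasing_cvgn (zpart_mono f0) ub.
suff -> : Z = sup (range (zpart f)) by [].
apply/eqP; rewrite eq_le; apply/andP; split; last first.
  by apply: ge_sup; [exists (zpart f 0), 0%N|move=> _ [N _ <-]].
rewrite -lee_fin -ZE; apply: zsum_le_window => [m|N]; first by rewrite lee_fin.
rewrite sumEFin lee_fin -/(zpart f N); apply: ub_le_sup => //; by exists N.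
Qed.

(** The part of the sum beyond the frequency N is what the N-th partial sum
    misses. *)
Lemma zsum_tail_le f (S : R) : (forall m, 0 <= f m) -> (zsum (fun m => (f m)%:E) <= S%:E)%E ->
  (forall N, exists2 T : R, zsum (fun m => (f m * (N < `|m|)%N%:R)%:E) = T%:E &
     T <= fine (zsum (fun m => (f m)%:E)) - zpart f N).
Proof.
move=> f0 fS N.
have [Z ZE cvZ] := zsum_fin f0 fS.
have g0 m : 0 <= f m * (N < `|m|)%N%:R by rewrite mulr_ge0.
have h0 m : 0 <= f m * (`|m| <= N)%N%:R by rewrite mulr_ge0.
have spl : (zsum (fun m => (f m)%:E) = zsum (fun m => (f m * (N < `|m|)%N%:R)%:E) + zsum (fun m => (f m * (`|m| <= N)%N%:R)%:E))%E.
  rewrite -zsumD; try by move=> m; rewrite lee_fin.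
  by apply: eq_zsum => m; rewrite -EFinD -mulrDr ltnNge; case: leqP => _; rewrite /= ?add0r ?addr0 mulr1.
have lo : ((zpart f N)%:E <= zsum (fun m => (f m * (`|m| <= N)%N%:R)%:E))%E.
  have := zpart_le_zsum N h0; congr (_ <= _)%E; congr EFin.
  by apply: eq_bigr => j _; rewrite freq_le mulr1.
have /(zsum_fin g0) [T TE _] : (zsum (fun m => (f m * (N < `|m|)%N%:R)%:E) <= S%:E)%E.
  apply: le_trans fS; apply: le_zsum => m.
  by rewrite lee_fin ler_piMr//; case: leqP.
exists T => //; rewrite lerBrDr -lee_fin EFinD -TE ZE /= -ZE spl.
exact: leeD.
Qed.

Lemma cvgc_normc {T : Type} (F : set_system T) {FF : ProperFilter F} (f : T -> R[i]) l :
  cvgc F f l -> normc (f x) @[x --> F] --> normc l.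
Proof.
move=> [h1 h2].
have nE (z : R[i]) : normc z = Num.sqrt (complex.Re z ^+ 2 + complex.Im z ^+ 2) by case: z.
rewrite nE; under eq_fun do rewrite nE.
apply: continuous_cvg; first exact: sqrt_continuous.
by apply: cvgD; [under eq_fun do rewrite expr2; rewrite expr2; exact: cvgM..].
Qed.

(** Absolute convergence; real and imaginary parts are differences of the
    nonnegative families |p| + p and |p|. *)
Lemma zseries_cvg w (S : R) : (zsum (fun k => (normc (w k))%:E) <= S%:E)%E ->
  exists2 L : R[i], cvgc \oo (zpart w) L & normc L <= S.
Proof.
move=> wS.
have part (p : R[i] -> R) (pD : {morph p : x y / x + y}) (p0 : p 0 = 0) (pn : forall z, `|p z| <= normc z) :
   exists l : R, p (zpart w N) @[N --> \oo] --> l.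
  pose f1 m : R := `|p (w m)| + p (w m); pose f2 m : R := `|p (w m)|.
  have b2 : (zsum (fun m => (f2 m)%:E) <= S%:E)%E.
    by apply: le_trans wS; apply: le_zsum => m; rewrite lee_fin; exact: pn.
  have b1 : (zsum (fun m => (f1 m)%:E) <= (2 * S)%:E)%E.
    apply: (@le_trans _ _ (2%:E * zsum (fun k => (normc (w k))%:E))%E); last first.
      by rewrite EFinM lee_wpmul2l.
    rewrite -zsumZ//; last by move=> m; rewrite lee_fin normc_ge0.
    apply: le_zsum => m; rewrite -EFinM lee_fin /f1.
    have := pn (w m); have := ler_norm (p (w m)); lra.
  have f10 m : 0 <= f1 m by rewrite /f1; have := ler_norm (- p (w m)); rewrite normrN; lra.
  have [l1 _ c1] := zsum_fin f10 b1.
  have [l2 _ c2] := zsum_fin (f := f2) (fun m => normr_ge0 _) b2.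
  exists (l1 - l2).
  rewrite (_ : (fun N => p (zpart w N)) = (fun N => zpart f1 N - zpart f2 N)); first exact: cvgB.
  apply/funext => N; rewrite /zpart (big_morph p pD p0) -sumrB.
  by apply: eq_bigr => j _; rewrite /f1 /f2; ring.
have [a ha] := part (@complex.Re R) (@ReD R) erefl (@normRe R).
have [b hb] := part (@complex.Im R) (@ImD R) erefl (@normIm R).
exists (a +i* b) => //.
have hn : normc (zpart w N) @[N --> \oo] --> normc (a +i* b) by exact: cvgc_normc.
have <- := cvg_lim (@Rhausdorff R) hn; apply: limr_le; first by apply/cvg_ex; exists (normc (a +i* b)).
near=> N.
rewrite -lee_fin; apply: le_trans wS.
apply: le_trans (zpart_le_zsum N (fun m => normc_ge0 (w m))).
by rewrite lee_fin; exact: normc_sum.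
Unshelve. all: by end_near.
Qed.

End series.

(** * Bounded operators between Sobolev spaces *)

Section sobolev_estimates.
Context {R : realType}.
Notation normc := Normc.normc.
Implicit Types (u v w : int -> R[i]) (q r s : R) (A B : (int -> R[i]) -> int -> R[i]).

Lemma sqnormE q u : sobolev_sqnorm q u = zsum (fun m => (wt m `^ q * normc (u m) ^+ 2)%:E).
Proof. by []. Qed.

Lemma term_ge0 q u m : 0 <= wt m `^ q * normc (u m) ^+ 2.
Proof. by rewrite mulr_ge0 ?powR_ge0 ?sqr_ge0. Qed.

Lemma sqnorm_ge0 q u : (0 <= sobolev_sqnorm q u)%E.
Proof. by apply: zsum_ge0 => m; rewrite lee_fin; exact: term_ge0. Qed.

Lemma in_sobolevP q u : reflect (sobolev_sqnorm q u < +oo)%E (u \in in_sobolev q).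
Proof. exact: asboolP. Qed.

Lemma in_sobolev_fin q u : u \in in_sobolev q -> exists2 S : R, 0 <= S & sobolev_sqnorm q u = S%:E.
Proof.
move=> /in_sobolevP h; exists (fine (sobolev_sqnorm q u)); first by rewrite fine_ge0// sqnorm_ge0.
by rewrite fineK// ge0_fin_numE// sqnorm_ge0.
Qed.

(** The Cauchy-Schwarz inequality with the weight b, for a number y bounded by the
    sum of b x. From 2 x <= y / K + (K / y) x^2, weighted and summed,
    2 y <= y + (K / y) * (sum of b x^2); this avoids square roots of infinite
    sums. *)
Lemma cauchy_schwarz_zsum (b x : int -> R) (y K : R) : 0 < K -> 0 <= y ->
  (forall k, 0 <= b k) -> (forall k, 0 <= x k) ->
  (zsum (fun k => (b k)%:E) <= K%:E)%E ->
  (y%:E <= zsum (fun k => (b k * x k)%:E))%E ->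
  ((y ^+ 2)%:E <= K%:E * zsum (fun k => (b k * x k ^+ 2)%:E))%E.
Proof.
move=> K0 y0 b0 x0 bK yS.
have bx0 k : (0 <= (b k * x k ^+ 2)%:E)%E by rewrite lee_fin mulr_ge0 ?sqr_ge0.
have [->|yn0] := eqVneq y 0.
  by rewrite expr0n; apply: mule_ge0; [rewrite lee_fin ltW|exact: zsum_ge0].
have yp : 0 < y by rewrite lt_neqAle eq_sym yn0.
have yK : 0 <= y / K by rewrite divr_ge0// ltW.
have Ky : 0 <= K / y by rewrite divr_ge0// ltW.
have h1 : ((2 * y)%:E <= y%:E + (K / y)%:E * zsum (fun k => (b k * x k ^+ 2)%:E))%E.
  apply: (@le_trans _ _ ((y / K)%:E * zsum (fun k => (b k)%:E) + (K / y)%:E * zsum (fun k => (b k * x k ^+ 2)%:E))%E).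
    have bk m : (0 <= (b m)%:E)%E by rewrite lee_fin.
    rewrite -!zsumZ//.
    rewrite -zsumD; last 2 first.
    - by move=> m; rewrite -EFinM lee_fin mulr_ge0.
    - by move=> m; rewrite mule_ge0.
    apply: (@le_trans _ _ (zsum (fun k => 2%:E * (b k * x k)%:E)%E)).
      rewrite zsumZ//; last by move=> m; rewrite lee_fin mulr_ge0.
      by rewrite EFinM lee_wpmul2l.
    apply: le_zsum => k; rewrite -!EFinM -EFinD lee_fin -subr_ge0.
    rewrite (_ : _ - _ = b k * (y - K * x k) ^+ 2 / (K * y)).
      by apply: divr_ge0; apply: mulr_ge0; rewrite ?sqr_ge0//; exact: ltW.
    by field; rewrite !gt_eqF.
  rewrite leeD2r//; apply: (@le_trans _ _ ((y / K)%:E * K%:E)%E).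
    by rewrite lee_wpmul2l.
  by rewrite -EFinM divfK// gt_eqF.
have h2 : (y%:E <= (K / y)%:E * zsum (fun k => (b k * x k ^+ 2)%:E))%E.
  move: h1; rewrite [(2 * y)%R](_ : _ = (y + y)%R); last by ring.
  by rewrite EFinD leeD2lE.
rewrite expr2 EFinM; apply: (@le_trans _ _ (y%:E * ((K / y)%:E * zsum (fun k => (b k * x k ^+ 2)%:E)))%E).
  by rewrite lee_wpmul2l// lee_fin.
by rewrite muleA -EFinM mulrCA divff// mulr1.
Qed.

Lemma powR_peetre q m k : 0 <= q -> wt m `^ q <= 2 `^ q * wt k `^ q * wt (m - k) `^ q :> R.
Proof.
move=> q0; have w0 n : 0 <= wt n :> R by rewrite ltW// wt_gt0.
rewrite -!powRM ?mulr_ge0//; apply: ge0_ler_powR => //.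
- by rewrite nnegrE.
- by rewrite nnegrE !mulr_ge0.
- exact: peetre.
Qed.

Lemma powR_wt_ge1 q m : 0 <= q -> 1 <= wt m `^ q :> R.
Proof.
move=> q0; have := ge0_ler_powR q0 (_ : 1 \in Num.nneg) (_ : wt m \in Num.nneg) (wt_ge1 m).
by rewrite powR1; apply; rewrite nnegrE// ltW// wt_gt0.
Qed.

(** Schur's test with Peetre's inequality: Cauchy-Schwarz bounds the square of v at
    m by K times the sum over k of b_(m-k) |u_k|^2, the weight at m is shared
    between k and m - k, and the sums are exchanged. *)
Lemma convolution_sobolev (b : int -> R) q (K : R) u v : 0 <= q -> 0 < K ->
  (forall j, 0 <= b j) ->
  (zsum (fun j => (b j * wt j `^ q)%:E) <= K%:E)%E ->
  (forall m, ((normc (v m))%:E <= zsum (fun k => (b (m - k) * normc (u k))%:E))%E) ->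
  (sobolev_sqnorm q v <= (2 `^ q * K ^+ 2)%:E * sobolev_sqnorm q u)%E.
Proof.
move=> q0 K0 b0 bK vu.
have bK1 : (zsum (fun j => (b j)%:E) <= K%:E)%E.
  apply: le_trans bK; apply: le_zsum => j; rewrite lee_fin ler_peMr//; exact: powR_wt_ge1.
pose T m k := wt k `^ q * normc (u k) ^+ 2 * (b (m - k) * wt (m - k) `^ q).
have T0 m k : 0 <= T m k by rewrite mulr_ge0 ?term_ge0// mulr_ge0// powR_ge0.
have step m : ((wt m `^ q * normc (v m) ^+ 2)%:E <= (2 `^ q * K)%:E * zsum (fun k => (T m k)%:E))%E.
  have cs := @cauchy_schwarz_zsum (fun k => b (m - k)) (fun k => normc (u k)) (normc (v m)) K K0 (normc_ge0 _) (fun k => b0 _) (fun k => normc_ge0 _).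
  rewrite EFinM; apply: (@le_trans _ _ ((wt m `^ q)%:E * (K%:E * zsum (fun k => (b (m - k) * normc (u k) ^+ 2)%:E)))%E).
    rewrite lee_wpmul2l ?lee_fin ?powR_ge0//; apply: cs => //.
    by rewrite (@zsum_reflect _ (fun j => (b j)%:E)).
  rewrite muleCA [(2 `^ q * K)%R]mulrC [(K * _)%:E]EFinM -muleA; apply: lee_wpmul2l; first by rewrite lee_fin ltW.
  rewrite -!zsumZ ?powR_ge0//; last 2 first.
  - by move=> k; rewrite lee_fin.
  - by move=> k; rewrite lee_fin mulr_ge0// sqr_ge0.
  apply: le_zsum => k; rewrite -!EFinM lee_fin.
  rewrite (_ : 2 `^ q * T m k = (2 `^ q * wt k `^ q * wt (m - k) `^ q) * (b (m - k) * normc (u k) ^+ 2)); last by rewrite /T; ring.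
  by rewrite ler_wpM2r ?powR_peetre// mulr_ge0// sqr_ge0.
rewrite [leLHS]sqnormE; apply: (le_trans (le_zsum step)).
have zT0 m : (0 <= zsum (fun k => (T m k)%:E))%E by apply: zsum_ge0 => k; rewrite lee_fin.
rewrite zsumZ//; last by rewrite mulr_ge0 ?powR_ge0// ltW.
rewrite expr2 mulrA [leRHS](_ : _ = (2 `^ q * K)%:E * (K%:E * sobolev_sqnorm q u))%E; last first.
  by rewrite muleA -EFinM.
apply: lee_wpmul2l; first by rewrite lee_fin mulr_ge0 ?powR_ge0// ltW.
rewrite exchange_zsum; last by move=> m k; rewrite lee_fin.
rewrite sqnormE -zsumZ; last 2 first.
- exact: ltW.
- by move=> k; rewrite lee_fin term_ge0.
apply: le_zsum => k.
rewrite /T; under eq_fun do rewrite EFinM.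
rewrite zsumZ ?term_ge0//; last by move=> m; rewrite lee_fin mulr_ge0// powR_ge0.
rewrite (@zsum_shift _ (fun j => (b j * wt j `^ q)%:E)) muleC lee_wpmul2r ?lee_fin ?term_ge0//.
Qed.

(** Multiplication operators are defined by limits that exist only on some H^q, so
    linearity is asked on that space only. *)
Definition lin_on q A := forall (a : R[i]) u v, u \in in_sobolev q -> v \in in_sobolev q ->
  A (fun m => a * u m + v m) = fun m => a * A u m + A v m.

Definition bounded_on q r A := exists2 M : R, 0 <= M &
  forall u, u \in in_sobolev q -> (sobolev_sqnorm r (A u) <= M%:E * sobolev_sqnorm q u)%E.

(** A sequence operator that maps H^q linearly and boundedly to H^r; this calculus
    of orders replaces bounded operators between the types [sobolev q]. *)
Definition opr q r A := lin_on q A /\ bounded_on q r A.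

Lemma opr_in q r A u : opr q r A -> u \in in_sobolev q -> A u \in in_sobolev r.
Proof.
move=> [_ [M M0 HM]] uq; have [S S0 SE] := in_sobolev_fin uq.
apply/in_sobolevP; apply: le_lt_trans (HM _ uq) _.
by rewrite SE -EFinM ltry.
Qed.

Lemma sqnorm_le q r u : q <= r -> (sobolev_sqnorm q u <= sobolev_sqnorm r u)%E.
Proof.
move=> qr; apply: le_zsum => m; rewrite lee_fin ler_wpM2r ?sqr_ge0//.
by apply: ler_powR => //; exact: wt_ge1.
Qed.

Lemma in_sobolev_le q r u : q <= r -> u \in in_sobolev r -> u \in in_sobolev q.
Proof. by move=> qr /in_sobolevP h; apply/in_sobolevP; exact: le_lt_trans (sqnorm_le _ qr) h. Qed.

Lemma opr_weaken q q' r r' A : q <= q' -> r' <= r -> opr q r A -> opr q' r' A.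
Proof.
move=> qq rr [lA [M M0 HM]]; split.
  by move=> a u v /(in_sobolev_le qq) hu /(in_sobolev_le qq) hv; exact: lA.
exists M => // u uq; apply: le_trans (sqnorm_le _ rr) _.
apply: le_trans (HM _ (in_sobolev_le qq uq)) _.
by rewrite lee_wpmul2l// sqnorm_le.
Qed.

Lemma opr_ext q r A B : (forall u, u \in in_sobolev q -> A u = B u) -> opr q r A -> opr q r B.
Proof.
move=> AB [lA [M M0 HM]]; split.
  move=> a u v uq vq; rewrite -!AB//; first exact: lA.
  by have := rpredD (rpredZ a uq) vq.
by exists M => // u uq; rewrite -AB//; exact: HM.
Qed.

Lemma opr_comp q r s A B : opr q r A -> opr r s B -> opr q s (fun u => B (A u)).
Proof.
move=> oA oB; have [lA [M M0 HM]] := oA; have [lB [N N0 HN]] := oB; split.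
  by move=> a u v uq vq; rewrite lA// lB// (opr_in oA).
exists (N * M); first exact: mulr_ge0.
move=> u uq; apply: le_trans (HN _ (opr_in oA uq)) _.
by rewrite EFinM -muleA lee_wpmul2l// HM.
Qed.

Lemma sqnormD q u v : (sobolev_sqnorm q (fun m => u m + v m)%R <=
  2%:E * sobolev_sqnorm q u + 2%:E * sobolev_sqnorm q v)%E.
Proof.
rewrite !sqnormE -!zsumZ//; try by move=> m; rewrite lee_fin term_ge0.
rewrite -zsumD; try by move=> m; rewrite mule_ge0// lee_fin term_ge0.
apply: le_zsum => m; rewrite -!EFinM -EFinD lee_fin.
have n1 := normc_ge0 (u m); have n2 := normc_ge0 (v m); have n3 := normc_ge0 (u m + v m).
have t := le_normcD (u m) (v m).
have w0 : 0 <= wt m `^ q :> R by exact: powR_ge0.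
rewrite !(mulrCA 2) -mulrDr ler_wpM2l//.
have := sqr_ge0 (normc (u m) - normc (v m)); nra.
Qed.

Lemma opr_add q r A B : opr q r A -> opr q r B -> opr q r (fun u m => A u m + B u m).
Proof.
move=> [lA [M M0 HM]] [lB [N N0 HN]]; split.
  by move=> a u v uq vq; apply/funext => m; rewrite lA// lB//; ring.
exists (2 * M + 2 * N); first by rewrite addr_ge0// mulr_ge0.
move=> u uq; apply: le_trans (sqnormD _ _ _) _.
rewrite [(2 * M + _)%:E]EFinD ge0_muleDl ?lee_fin ?mulr_ge0// [(2 * M)%:E]EFinM [(2 * N)%:E]EFinM -!muleA.
by apply: leeD; rewrite lee_wpmul2l//; [exact: HM|exact: HN].
Qed.

Lemma opr_multiplier (mu : int -> R[i]) q r (C : R) : 0 <= C ->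
  (forall m, wt m `^ r * normc (mu m) ^+ 2 <= C * wt m `^ q) ->
  opr q r (fun u m => mu m * u m).
Proof.
move=> C0 H; split.
  by move=> a u v _ _; apply/funext => m; ring.
exists C => // u uq; rewrite !sqnormE -zsumZ//; last by move=> m; rewrite lee_fin term_ge0.
apply: le_zsum => m; rewrite -EFinM lee_fin Normc.normcM exprMn [leLHS]mulrA [leRHS]mulrA.
by rewrite ler_wpM2r ?sqr_ge0.
Qed.

Lemma opr_scale q r A (c : R[i]) : opr q r A -> opr q r (fun u m => c * A u m).
Proof.
move=> oA; apply: (@opr_comp q r r A (fun u m => c * u m) oA); apply: (@opr_multiplier (fun=> c) r r (normc c ^+ 2)); first exact: sqr_ge0.
by move=> m; rewrite mulrC.
Qed.

Lemma opr_id q : opr q q id.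
Proof. by split => //; exists 1 => // u _; rewrite mul1e. Qed.

Lemma opr_sub q r A B : opr q r A -> opr q r B -> opr q r (fun u m => A u m - B u m).
Proof.
move=> oA oB; apply: opr_ext (opr_add oA (opr_scale (-1) oB)) => u _.
by apply/funext => m; rewrite mulN1r.
Qed.

End sobolev_estimates.

(** * Multiplication operators *)

Section matrices.
Context {R : realType}.
Notation normc := Normc.normc.
Implicit Types (u v w c : int -> R[i]) (q r s : R).

(** Decay with an exponent larger than s + 1 leaves a factor 1 / (1 + m^2), which is
    summable. *)
Lemma rapid_summable c s : rapid c ->
  exists2 K : R, 0 < K & (zsum (fun j => (normc (c j) * wt j `^ s)%:E) <= K%:E)%E.
Proof.
move=> rc; pose n := (Num.truncn s).+1.
have [C C0 HC] := rc n.+1.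
exists (C * 5 + 1); first by rewrite ltr_wpDl// mulr_ge0.
apply: (@le_trans _ _ (zsum (fun j => C%:E * ((wt j)^-1)%:E)%E)).
  apply: le_zsum => j; rewrite -EFinM lee_fin ler_pdivlMr ?wt_gt0//.
  apply: le_trans (HC j); rewrite -mulrA ler_wpM2l ?normc_ge0//.
  rewrite exprSr ler_wpM2r ?(ltW (wt_gt0 _))// -powR_mulrn ?(ltW (wt_gt0 _))//.
  apply: ler_powR; first exact: wt_ge1.
  by apply/ltW; exact: truncnS_gt.
rewrite zsumZ//; last by move=> m; rewrite lee_fin invr_ge0 ltW// wt_gt0.
apply: (@le_trans _ _ (C%:E * 5%:E)%E); first by rewrite lee_wpmul2l// zsum_wtV.
by rewrite -EFinM lee_fin lerDl.
Qed.

Lemma normc_le_sqnorm u : u \in in_sobolev 0 -> exists2 U : R, 0 <= U & forall k, normc (u k) <= U.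
Proof.
move=> /in_sobolev_fin [S S0 SE]; exists (1 + S); first by rewrite addr_ge0.
move=> k; have := @zsum_term _ (fun m => (wt m `^ 0 * normc (u m) ^+ 2)%:E) k.
rewrite -sqnormE SE => /(_ (fun m => _)) h.
have {h} : normc (u k) ^+ 2 <= S.
  rewrite -lee_fin; apply: le_trans (h _); first by rewrite powRr0 mul1r.
  by move=> m; rewrite lee_fin term_ge0.
by have := sqr_ge0 (normc (u k) - 1); have := normc_ge0 (u k); nra.
Qed.

Lemma cvgc_unique (f : nat -> R[i]) (l l' : R[i]) : cvgc \oo f l -> cvgc \oo f l' -> l = l'.
Proof. by move=> /cvgc_clim <- /cvgc_clim <-. Qed.

Section bounded_matrix.
Variables (b : int -> R) (q K : R) (A : int -> int -> R[i]).
Hypotheses (q0 : 0 <= q) (K0 : 0 < K) (b0 : forall j, 0 <= b j).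
Hypothesis bK : (zsum (fun j => (b j * wt j `^ q)%:E) <= K%:E)%E.
Hypothesis Ab : forall m k, normc (A m k) <= b (m - k).

Lemma matrix_row_summable u m : u \in in_sobolev q ->
  exists S : R, (zsum (fun k => (b (m - k) * normc (u k))%:E) <= S%:E)%E.
Proof.
move=> uq; have [U U0 HU] := normc_le_sqnorm (in_sobolev_le q0 uq).
exists (U * K); rewrite EFinM.
apply: (@le_trans _ _ (U%:E * zsum (fun j => (b j)%:E))%E).
  rewrite -(zsum_reflect (fun j => (b j)%:E) m) -zsumZ//; last by move=> k; rewrite lee_fin.
  by apply: le_zsum => k; rewrite -EFinM lee_fin mulrC ler_wpM2r.
rewrite lee_wpmul2l//; apply: le_trans bK; apply: le_zsum => j.
by rewrite lee_fin ler_peMr// powR_wt_ge1.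
Qed.

Lemma matrix_row_cvg u m : u \in in_sobolev q ->
  exists2 L, cvgc \oo (zpart (fun k => A m k * u k)) L &
    ((normc L)%:E <= zsum (fun k => (b (m - k) * normc (u k))%:E))%E.
Proof.
move=> uq; have [S HS] := matrix_row_summable m uq.
have [|Z ZE _] := @zsum_fin _ (fun k => b (m - k) * normc (u k)) S _ HS.
  by move=> k; rewrite mulr_ge0// normc_ge0.
have [|L cL nL] := @zseries_cvg _ (fun k => A m k * u k) Z.
  rewrite -ZE; apply: le_zsum => k; rewrite lee_fin Normc.normcM.
  by rewrite ler_wpM2r// normc_ge0.
by exists L => //; rewrite ZE lee_fin.
Qed.

(** The operator of an infinite matrix whose entries are dominated by a rapidly
    decaying function of m - k. *)
Lemma opr_matrix (B : (int -> R[i]) -> int -> R[i]) :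
  (forall u m, u \in in_sobolev q -> cvgc \oo (zpart (fun k => A m k * u k)) (B u m)) ->
  opr q q B.
Proof.
move=> HB; split.
  move=> a u v uq vq; apply/funext => m.
  have auvq := rpredD (rpredZ a uq) vq.
  apply: cvgc_unique (HB _ m auvq) _.
  rewrite (_ : zpart _ = fun N => a * zpart (fun k => A m k * u k) N + zpart (fun k => A m k * v k) N).
    by apply: cvgcD; [apply: cvgcM_cst|]; exact: HB.
  apply/funext => N; rewrite /zpart mulr_sumr -big_split; apply: eq_bigr => j _ /=.
  by rewrite mulrDr; congr (_ + _); rewrite !mulrA [a * _]mulrC.
exists (2 `^ q * K ^+ 2); first by rewrite mulr_ge0 ?powR_ge0 ?sqr_ge0.
move=> u uq; apply: (convolution_sobolev q0 K0 b0 bK) => m.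
have [L cL nL] := matrix_row_cvg m uq.
by rewrite (cvgc_unique (HB u m uq) cL).
Qed.

End bounded_matrix.

Lemma lipschitz_der1 (h h' : R -> R) (M : R) : (forall x : R, is_derive x 1 h (h' x)) ->
  (forall x, `|h' x| <= M) -> forall s t : R, `|h t - h s| <= M * `|t - s|.
Proof.
move=> dh hM s t; wlog st : s t / s <= t.
  by move=> H; have [/H//|/ltW/H] := leP s t; rewrite distrC [`|s - t|]distrC.
have cs : {within `[s, t], continuous h}.
  by apply: continuous_subspaceT => x; exact: der1_continuous.
have [c _ ->] := MVT_segment st (fun x _ => dh x) cs.
by rewrite normrM ler_wpM2r.
Qed.

Lemma lipschitz_expi (a s t : R) : normc (expi (a * t) - expi (a * s)) <= 2 * `|a| * `|t - s|.
Proof.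
apply: le_trans (normc_leReIm _) _; rewrite mulrAC -mulrA mulr_natl mulr2n [`|_| * `|a|]mulrC ReD ReN ImD ImN.
apply: lerD.
  apply: (lipschitz_der1 (fun x => der1_cosM a x)) => x.
  by rewrite ?normrM ?normrN ?normrM ler_piMr// sin_max.
apply: (lipschitz_der1 (fun x => der1_sinM a x)) => x.
by rewrite ?normrM ler_piMr// cos_max.
Qed.

(** Products of a smooth function and an exponential; they cover both the
    exponentials themselves and their products with the coefficient functions. *)
Definition modulated (h : R -> R) (k : int) (t : R) : R[i] := (h t)%:C * expi (k%:~R * t).

Lemma modulated_ccontinuous h k : smooth h -> ccontinuous (modulated h k).
Proof.
move=> sh; apply: ccontinuousM; last exact: ccontinuous_expi.
by apply: ccontinuous_real; exact: smooth_continuous.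
Qed.

Lemma modulated_periodic h k : periodic h -> periodic (modulated h k).
Proof. by move=> ph t; rewrite /modulated ph periodic_expi. Qed.

Lemma modulated_bounded h k : smooth h -> periodic h -> exists B : R, forall t, normc (modulated h k t) <= B.
Proof.
move=> sh ph; have [B hB] := periodic_bounded (smooth_continuous sh) ph.
by exists B => t; rewrite /modulated Normc.normcM normc_expi mulr1 normc_real.
Qed.

Lemma modulated_lipschitz h k : smooth h -> periodic h ->
  exists M : R, forall s t, normc (modulated h k t - modulated h k s) <= M * `|t - s|.
Proof.
move=> sh ph; have [B hB] := periodic_bounded (smooth_continuous sh) ph.
have [B' hB'] := periodic_bounded (smooth_continuous (smooth_derive1 sh)) (periodic_derive1 (fun x => @smooth_derivable _ _ x sh) ph).
have dh (x : R) : is_derive x 1 h (derive1 h x) by exact: der1_derive1 (@smooth_derivable _ _ x sh).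
exists (B' + B * (2 * `|k%:~R|)) => s t; rewrite /modulated.
rewrite (_ : _ - _ = (h t - h s)%:C * expi (k%:~R * t) + (h s)%:C * (expi (k%:~R * t) - expi (k%:~R * s))); last first.
  by rewrite rmorphB/=; ring.
apply: le_trans (le_normcD _ _) _; rewrite !Normc.normcM normc_expi mulr1 !normc_real mulrDl.
apply: lerD; first exact: lipschitz_der1 dh hB' s t.
by rewrite -mulrA ler_pM// ?normc_ge0// lipschitz_expi.
Qed.

Lemma fourier_coef_modulated h k m : fourier_coef (modulated h k) m = fourier_coef (fun t => (h t)%:C) (m - k).
Proof. exact: fourier_coef_mul_expi. Qed.

Lemma ccontinuous_fourier_sum u N : ccontinuous (fourier_sum u N).
Proof.
rewrite (_ : fourier_sum u N = fun t => \sum_(j < (2 * N).+1) u (freq j) * expi ((freq j)%:~R * t)); last first.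
  by apply/funext => t; rewrite fourier_sumE.
elim: (index_enum _) => [|j s IH].
  rewrite (_ : (fun t => _) = fun=> 0); first exact: ccontinuous_cst.
  by apply/funext => t; rewrite big_nil.
rewrite (_ : (fun t => _) = fun t => u (freq j) * expi ((freq j)%:~R * t) + \sum_(j <- s) u (freq j) * expi ((freq j)%:~R * t)); last first.
  by apply/funext => t; rewrite big_cons.
apply: ccontinuousD => //; apply: ccontinuousM; first exact: ccontinuous_cst.
exact: ccontinuous_expi.
Qed.

Section mulop.
Variable a : R -> R.
Hypotheses (sa : smooth a) (pa : periodic a).
Let ahat := fourier_coef (fun t => (a t)%:C).

Let cont_a : ccontinuous (fun t => (a t)%:C).
Proof. by apply: ccontinuous_real; exact: smooth_continuous. Qed.

Lemma fourier_coef_mul_sum u N m :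
  fourier_coef (fun t => (a t)%:C * fourier_sum u N t) m = zpart (fun k => ahat (m - k) * u k) N.
Proof.
have ia k : cintegrable period (fun t => (a t)%:C * expi (k%:~R * t)).
  by apply: ccontinuous_integrable; apply: ccontinuousM => //; exact: ccontinuous_expi.
transitivity (fourier_coef (fun t => \sum_(j < (2 * N).+1) u (freq j) * ((a t)%:C * expi ((freq j)%:~R * t))) m).
  by apply: eq_fourier_coef => t _; rewrite fourier_sumE mulr_sumr; apply: eq_bigr => j _; rewrite mulrCA.
rewrite fourier_coef_sum => [|j]; last by apply: cintegrableZ => //; exact: measurable_period.
by apply: eq_bigr => j _; rewrite fourier_coefZ// fourier_coef_mul_expi mulrC.
Qed.

Let ahat_rapid : rapid ahat. Proof. exact: smooth_rapid. Qed.

(** The coefficient of frequency m of a times a trigonometric polynomial is a finite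
    row sum of the matrix a_(m-k). *)
Lemma mulop_cvg q u m : 0 <= q -> u \in in_sobolev q ->
  cvgc \oo (zpart (fun k => ahat (m - k) * u k)) (mulop a u m).
Proof.
move=> q0 uq; have [K K0 HK] := rapid_summable q ahat_rapid.
have [L cL _] := @matrix_row_cvg (fun j => normc (ahat j)) q K (fun m k => ahat (m - k)) q0 (fun j => normc_ge0 _) HK (fun m k => lexx _) u m uq.
suff -> : mulop a u m = L by [].
by apply: cvgc_clim; under eq_fun do rewrite fourier_coef_mul_sum.
Qed.

Lemma opr_mulop q : 0 <= q -> opr q q (mulop a).
Proof.
move=> q0; have [K K0 HK] := rapid_summable q ahat_rapid.
apply: (@opr_matrix (fun j => normc (ahat j)) q K (fun m k => ahat (m - k))) => //.
  by move=> j; exact: normc_ge0.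
by move=> u m uq; exact: mulop_cvg uq.
Qed.

(** The entries of the commutator are (mu_m - mu_k) a_(m-k). The first factor is
    absorbed by the rapid decay of the second. The hypothesis with r makes both
    products of operators defined. *)
Lemma opr_commutator (mu : int -> R[i]) q r : 0 <= q -> 0 <= r ->
  opr q r (fun u m => mu m * u m) ->
  (forall m k, normc (mu m - mu k) <= wt (m - k)) ->
  opr q q (fun u m => mu m * mulop a u m - mulop a (fun k => mu k * u k) m).
Proof.
move=> q0 r0 omu Hmu; have [K K0 HK] := rapid_summable (1 + q) ahat_rapid.
apply: (@opr_matrix (fun j => normc (ahat j) * wt j) q K (fun m k => (mu m - mu k) * ahat (m - k))) => //.
- by move=> j; rewrite mulr_ge0 ?normc_ge0// ltW// wt_gt0.
- apply: le_trans HK; apply: le_zsum => j; rewrite lee_fin -mulrA ler_wpM2l ?normc_ge0//.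
  rewrite powRD ?powRr1 ?(ltW (wt_gt0 _))//.
  by rewrite gt_eqF ?implybT ?wt_gt0// ltr_pwDl.
- by move=> m k; rewrite Normc.normcM mulrC ler_wpM2l ?normc_ge0.
move=> u m uq; have h1 := mulop_cvg m q0 uq.
have h2 := mulop_cvg m r0 (opr_in omu uq).
rewrite (_ : zpart _ = fun N => mu m * zpart (fun k => ahat (m - k) * u k) N + (-1) * zpart (fun k => ahat (m - k) * (mu k * u k)) N).
  have e : mu m * mulop a u m - mulop a (fun k => mu k * u k) m = mu m * mulop a u m + (-1) * mulop a (fun k => mu k * u k) m by rewrite mulN1r.
  by rewrite e; exact: (cvgcD (cvgcM_cst (mu m) h1) (cvgcM_cst (-1) h2)).
apply/funext => N; rewrite /zpart !mulr_sumr -big_split; apply: eq_bigr => j _ /=.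
by ring.
Qed.

Lemma zpart_normc_sub (w : int -> R[i]) N d :
  normc (zpart w (N + d)%N - zpart w N) <= zpart (fun k => normc (w k)) (N + d)%N - zpart (fun k => normc (w k)) N.
Proof.
elim: d => [|d IH]; first by rewrite addn0 !subrr Normc.normc0.
rewrite addnS !zpartS addrAC [leRHS]addrAC.
by apply: le_trans (le_normcD _ _) _; apply: lerD => //; exact: le_normcD.
Qed.

(** The partial sums converge to f, and the distance between two of them is at most
    the corresponding increment of the partial sums of |f_k|; the bound is uniform
    in t. *)
Lemma fourier_sum_approx (f : R -> R[i]) (M B Z : R) N t : cmeasurable f -> periodic f ->
  (forall t, normc (f t) <= B) -> (forall s, normc (f s - f t) <= M * `|s - t|) ->
  (zsum (fun k => (normc (fourier_coef f k))%:E) = Z%:E) ->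
  normc (fourier_sum (fourier_coef f) N t - f t) <= Z - zpart (fun k => normc (fourier_coef f k)) N.
Proof.
move=> mf pf fB fM fZ.
have cf := fourier_series_cvg mf pf fB fM.
pose w k := fourier_coef f k * expi (k%:~R * t).
have nw : (fun k => normc (w k)) = fun k => normc (fourier_coef f k).
  by apply/funext => k; rewrite Normc.normcM normc_expi mulr1.
have sE N' : fourier_sum (fourier_coef f) N' t = zpart w N' by rewrite fourier_sumE.
have cw : normc (zpart w n - zpart w N) @[n --> \oo] --> normc (f t - zpart w N).
  apply: (@cvgc_normc _ _ _ _ (fun n => zpart w n - zpart w N)).
  have cw : cvgc \oo (zpart w) (f t) by rewrite (_ : zpart w = fun n => fourier_sum (fourier_coef f) n t)//; apply/funext => n; rewrite sE.
  exact: (cvgcD cw (cvgc_cst _)).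
rewrite sE -normc_opp opprB.
have <- := cvg_lim (@Rhausdorff R) cw; apply: limr_le; first by apply/cvg_ex; eexists; exact: cw.
exists N => // n /= Nn; rewrite -(subnKC Nn).
apply: le_trans (zpart_normc_sub _ _ _) _; rewrite nw lerD2r -lee_fin -fZ.
by apply: zpart_le_zsum => k; exact: normc_ge0.
Qed.

(** Multiplication of sequences agrees with multiplication of functions. The partial
    sums converge uniformly, so the coefficients of a times the partial sums
    converge to those of a f. *)
Lemma mulop_fourier_coef h k m : smooth h -> periodic h ->
  mulop a (fourier_coef (modulated h k)) m = fourier_coef (fun t => (a t)%:C * modulated h k t) m.
Proof.
move=> sh ph; set f := modulated h k.
have [B fB] := modulated_bounded k sh ph; have [M fM] := modulated_lipschitz k sh ph.
have cf := modulated_ccontinuous k sh; have pf := modulated_periodic k ph.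
have [A hA] := periodic_bounded (smooth_continuous sa) pa.
have A0 : 0 <= A by apply: le_trans (hA 0).
have [K K0 HK] := rapid_summable 0 (smooth_rapid sh ph).
have [|Z fZ cZ] := @zsum_fin _ (fun j => normc (fourier_coef f j)) K (fun j => normc_ge0 _).
  rewrite (eq_zsum (b := fun j => (normc (fourier_coef (fun t => (h t)%:C) (j - k)))%:E)); last first.
    by move=> j; rewrite fourier_coef_modulated.
  rewrite (@zsum_shift _ (fun j => (normc (fourier_coef (fun t => (h t)%:C) j))%:E)).
  by apply: le_trans HK; apply: le_zsum => j; rewrite powRr0 mulr1.
apply: cvgc_clim; apply: normc_cvgc.
apply: (@squeeze_cvgr _ _ _ _ (fun=> 0) (fun N => 2 * (A * (Z - zpart (fun j => normc (fourier_coef f j)) N)))); last 2 first.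
- exact: cvg_cst.
- have <- : nbhs (2 * (A * (Z - Z))) = nbhs (0 : R) by rewrite subrr !mulr0.
  by apply: cvgMr; apply: cvgMr; apply: cvgB => //; exact: cvg_cst.
near=> N; apply/andP; split; first exact: normc_ge0.
have cs : ccontinuous (fourier_sum (fourier_coef f) N) by exact: ccontinuous_fourier_sum.
have -> : fourier_coef (fun t => (a t)%:C * fourier_sum (fourier_coef f) N t) m - fourier_coef (fun t => (a t)%:C * f t) m
   = fourier_coef (fun t => (a t)%:C * (fourier_sum (fourier_coef f) N t - f t)) m.
  transitivity (fourier_coef (fun t => (a t)%:C * fourier_sum (fourier_coef f) N t + (-1) * ((a t)%:C * f t)) m).
    rewrite fourier_coefD ?fourier_coefZ ?mulN1r//.
    + by apply: ccontinuous_integrable; exact: ccontinuousM.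
    + by apply: ccontinuous_integrable; exact: ccontinuousM.
    + by apply: cintegrableZ; [exact: measurable_period|apply: ccontinuous_integrable; exact: ccontinuousM].
  by apply: eq_fourier_coef => t _; ring.
apply: normc_fourier_coef.
  apply: ccontinuous_measurable; apply: ccontinuousM => //; apply: ccontinuousD => //.
  rewrite (_ : (fun t => - f t) = fun t => (-1) * f t); last by apply/funext => t; rewrite mulN1r.
  by apply: ccontinuousM => //; exact: ccontinuous_cst.
move=> t _; rewrite Normc.normcM normc_real.
apply: ler_pM => //; first exact: normc_ge0.
by apply: (@fourier_sum_approx f M B) => //; exact: ccontinuous_measurable.
Unshelve. all: by end_near.
Qed.

End mulop.

Definition delta (k : int) : int -> R[i] := fun m => (m == k)%:R.

Lemma delta_modulated k : delta k = fourier_coef (modulated (fun=> 1) k).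
Proof.
apply/funext => m; rewrite /delta eq_sym -fourier_coef_expi.
by apply: eq_fourier_coef => t _; rewrite /modulated mul1r.
Qed.

Lemma delta_in_sobolev q k : delta k \in in_sobolev q.
Proof.
apply/in_sobolevP; apply: (@le_lt_trans _ _ (wt k `^ q)%:E); last exact: ltry.
rewrite sqnormE /zsum (@esumID _ _ [set k]); last by move=> m _; rewrite lee_fin term_ge0.
rewrite setTI esum_set1 ?lee_fin ?term_ge0// [X in (_ + X)%E]esum1 ?adde0.
  by rewrite /delta eqxx Normc.normc1 expr1n mulr1.
by move=> m [_ /= mk]; rewrite /delta (negbTE (introN eqP mk)) Normc.normc0 expr0n mulr0.
Qed.

(** Finite combinations of the sequences [delta] are dense. *)
Lemma opr_eq0 q r D : opr q r D -> (forall k m, D (delta k) m = 0) ->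
  forall u, u \in in_sobolev q -> D u = fun=> 0.
Proof.
move=> oD D0 u uq; have [lD [M M0 HM]] := oD.
have D00 : D (fun=> 0) = fun=> 0.
  have z0 : (fun=> 0) \in @in_sobolev R q by exact: rpred0.
  have := lD 1 _ _ z0 z0; rewrite (_ : (fun m => 1 * 0 + 0) = fun=> 0); last by apply/funext => m; rewrite mulr0 addr0.
  move=> e; apply/funext => m; move/(congr1 (@^~ m)) : e => /eqP.
  by rewrite mul1r -subr_eq0 opprD addrA subrr sub0r oppr_eq0 => /eqP.
pose lc (s : seq int) : int -> R[i] := fun m => \sum_(k <- s) u k * delta k m.
have Dlc (s : seq int) : lc s \in in_sobolev q /\ D (lc s) = fun=> 0.
  elim: s => [|k s [IH1 IH2]].
    rewrite (_ : lc [::] = fun=> 0); last by apply/funext => m; rewrite /lc big_nil.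
    by split => //; exact: rpred0.
  rewrite (_ : lc (k :: s) = fun m => u k * delta k m + lc s m); last by apply/funext => m; rewrite /lc big_cons.
  split; first by have := rpredD (rpredZ (u k) (delta_in_sobolev q k)) IH1.
  rewrite lD//; last exact: delta_in_sobolev.
  by apply/funext => m; rewrite D0 mulr0 IH2 addr0.
have [S S0 SE] := in_sobolev_fin uq.
pose f m : R := wt m `^ q * normc (u m) ^+ 2.
have f0 m : 0 <= f m by exact: term_ge0.
have fS : (zsum (fun m => (f m)%:E) <= S%:E)%E by rewrite -SE.
have [S' SE' cf] := zsum_fin f0 fS.
have SS : S' = S by apply: EFin_inj; rewrite -SE -SE'.
rewrite {}SS in SE' cf.
have bnd N : (sobolev_sqnorm r (D u) <= (M * (S - zpart f N))%:E)%E.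
  have [T TE TN] := zsum_tail_le f0 fS N.
  pose s := [seq freq j | j <- enum 'I_(2 * N).+1].
  have [ls Ds] := Dlc s.
  have lcE m : lc s m = u m * (`|m| <= N)%N%:R.
    rewrite /lc big_map big_enum/=.
    rewrite (eq_bigr (fun j => u (freq j) * (freq j == m)%:R)); last first.
      by move=> j _; rewrite /delta eq_sym.
    rewrite -[RHS](_ : (if (`|m| <= N)%N then u m else 0) = _); last by case: ifP; rewrite ?mulr1 ?mulr0.
    by rewrite -sum_freq_eq; apply: eq_bigl => j; rewrite inE.
  pose v m := -1 * lc s m + u m.
  have vq : v \in in_sobolev q by have := rpredD (rpredZ (-1) ls) uq.
  have Dv : D v = D u by rewrite lD// Ds; apply/funext => m; rewrite mulr0 add0r.
  rewrite -Dv; apply: le_trans (HM _ vq) _.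
  rewrite EFinM lee_wpmul2l//; apply: le_trans (_ : T%:E <= _)%E; last first.
    rewrite lee_fin; apply: le_trans TN _; rewrite lerD2r.
    by rewrite -[zsum _]/(sobolev_sqnorm q u) SE.
  rewrite -TE; apply: le_zsum => m; rewrite lee_fin /v lcE /f ltnNge.
  by case: leqP => _ /=; rewrite ?mulr1 ?mulr0 ?add0r// mulN1r addNr Normc.normc0 expr0n mulr0.
apply/funext => m; apply: Normc.eq0_normc; apply/eqP; rewrite -sqrf_eq0 eq_le sqr_ge0 andbT.
have c0 : M * (S - zpart f N) @[N --> \oo] --> (0 : R).
  have <- : nbhs (M * (S - S)) = nbhs (0 : R) by rewrite subrr mulr0.
  by apply: cvgMr; apply: cvgB => //; exact: cvg_cst.
have : wt m `^ r * normc (D u m) ^+ 2 <= 0.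
  have <- := cvg_lim (@Rhausdorff R) c0; apply: limr_ge; first by apply/cvg_ex; exists 0.
  near=> N; rewrite -lee_fin; apply: le_trans (bnd N).
  rewrite sqnormE; apply: (@zsum_term _ (fun m => (wt m `^ r * normc (D u m) ^+ 2)%:E)) => j.
  by rewrite lee_fin term_ge0.
by rewrite pmulr_rle0// powR_gt0// wt_gt0.
Unshelve. all: by end_near.
Qed.

(** By density it suffices to treat the exponentials, for which the product of
    functions can be used. *)
Lemma mulop_inverse (a b : R -> R) q u : smooth a -> periodic a -> smooth b -> periodic b ->
  (forall t, a t * b t = 1) -> 0 <= q -> u \in in_sobolev q -> mulop a (mulop b u) = u.
Proof.
move=> sa pa sb pb ab q0 uq.
have oD : opr q q (fun u m => mulop a (mulop b u) m - u m).
  apply: (@opr_sub _ q q (fun u => mulop a (mulop b u)) id); last exact: opr_id.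
  by apply: (@opr_comp _ q q q (mulop b) (mulop a)); exact: opr_mulop.
have D0 k m : mulop a (mulop b (delta k)) m - delta k m = 0.
  have s1 := smooth_cst (1 : R).
  have -> : mulop b (delta k) = fourier_coef (modulated b k).
    apply/funext => j; rewrite delta_modulated mulop_fourier_coef//.
    by apply: eq_fourier_coef => t _; rewrite /modulated mul1r.
  rewrite mulop_fourier_coef// delta_modulated; apply/eqP; rewrite subr_eq0; apply/eqP.
  by apply: eq_fourier_coef => t _; rewrite /modulated mulrA -rmorphM ab.
have := opr_eq0 oD D0 uq => e.
by apply/funext => m; move/(congr1 (@^~ m)) : e => /eqP; rewrite subr_eq0 => /eqP.
Qed.

End matrices.

(** * Compactness of the Sobolev embedding *)

Section compact_embedding.
Context {R : realType}.
Notation normc := Normc.normc.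
Implicit Types (q r s c : R).

Lemma fmap_ultra {T U : Type} (F : set_system T) (f : T -> U) :
  UltraFilter F -> UltraFilter (f @ F).
Proof.
move=> UF; split; first exact: fmap_proper_filter.
move=> G PG FG; apply/seteqP; split => // A GA.
have [//|nA] := in_ultra_setVsetC (f @^-1` A) UF.
exfalso; apply: (@filter_not_empty _ G).
have /(filterI GA) : G (~` A) by exact: FG.
by rewrite setICr.
Qed.

Lemma ultra_bounded_cvg {T : Type} (F : set_system T) (f : T -> R) (B : R) :
  UltraFilter F -> F [set x | `|f x| <= B] -> exists l : R, f x @[x --> F] --> l.
Proof.
move=> UF FB; have := @segment_compact R (- B) B; rewrite compact_ultra.
move=> /(_ _ (fmap_ultra f UF)) [|l [_ fl]]; last by exists l.
change (F (f @^-1` `[- B, B]%classic)); apply: filterS FB => x fx.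
change (is_true (f x \in `[- B, B])).
by rewrite in_itv /= -ler_norml.
Qed.

(** Partial sums of a family cut off at N stop growing at N. *)
Lemma zpart_low (t : int -> R) N M : (forall m, 0 <= t m) ->
  zpart (fun m => t m * (`|m| <= N)%N%:R) M <= zpart t N.
Proof.
move=> t0; have [MN|/ltnW NM] := leqP M N.
  apply: (@le_trans _ _ (zpart t M)); last exact: zpart_mono.
  by apply: ler_sum => j _; rewrite ler_piMr//; case: (_ <= _)%N.
rewrite -(subnKC NM); elim: (M - N)%N => [|d IH].
  by rewrite addn0; apply: ler_sum => j _; rewrite freq_le mulr1.
rewrite addnS zpartS (_ : (`|(N + d).+1%:Z| <= N)%N = false); last by lia.
by rewrite !mulr0 !addr0.
Qed.

Lemma cvg_sumr {T I : Type} (F : set_system T) {FF : Filter F} (r : seq I)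
    (f : I -> T -> R) (l : I -> R) : (forall i, f i x @[x --> F] --> l i) ->
  \sum_(i <- r) f i x @[x --> F] --> \sum_(i <- r) l i.
Proof.
move=> fl; elim: r => [|i r IH].
  by rewrite big_nil; under eq_fun do rewrite big_nil; exact: cvg_cst.
by rewrite big_cons; under eq_fun do rewrite big_cons; exact: cvgD.
Qed.

(** Along an ultrafilter every bounded coordinate converges. Frequencies above N
    contribute at most 4 c / N to the squared distance in H^r, because the weight
    gains a factor at least N between the orders r and s >= r + 1; the finitely
    many others converge. *)
Lemma ultra_sobolev_limit {T : Type} (F : set_system T) (u : T -> int -> R[i]) s (c : R) :
  UltraFilter F -> 0 <= s -> F [set x | (sobolev_sqnorm s (u x) <= c%:E)%E] ->
  exists2 L : int -> R[i], (sobolev_sqnorm s L <= c%:E)%E &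
    forall r (e : R), r + 1 <= s -> 0 < e ->
      F [set x | (sobolev_sqnorm r (fun m => L m - u x m)%R <= e%:E)%E].
Proof.
move=> UF s0 Fc.
have term_le x m : (sobolev_sqnorm s (u x) <= c%:E)%E -> wt m `^ s * normc (u x m) ^+ 2 <= c.
  move=> h; rewrite -lee_fin; apply: le_trans h.
  apply: (@zsum_term _ (fun m => (wt m `^ s * normc (u x m) ^+ 2)%:E)) => j.
  by rewrite lee_fin term_ge0.
have norm_le m : F [set x | normc (u x m) <= 1 + c].
  apply: filterS Fc => x /= /(term_le _ m) h.
  have w1 := powR_wt_ge1 m s0; have n0 := normc_ge0 (u x m).
  have : normc (u x m) ^+ 2 <= c by apply: le_trans h; rewrite ler_peMl// sqr_ge0.
  by have := sqr_ge0 (normc (u x m) - 1); nra.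
have /choice [L HL] m : exists l : R[i], cvgc F (fun x => u x m) l.
  have [a ha] : exists a : R, complex.Re (u x m) @[x --> F] --> a.
    apply: (@ultra_bounded_cvg _ _ _ (1 + c)); apply: filterS (norm_le m) => x /=.
    exact: le_trans (normRe _).
  have [b hb] : exists b : R, complex.Im (u x m) @[x --> F] --> b.
    apply: (@ultra_bounded_cvg _ _ _ (1 + c)); apply: filterS (norm_le m) => x /=.
    exact: le_trans (normIm _).
  by exists (a +i* b).
have Lc : (sobolev_sqnorm s L <= c%:E)%E.
  rewrite sqnormE; apply: zsum_le_window => [m|N]; first by rewrite lee_fin term_ge0.
  rewrite sumEFin lee_fin.
  have cv : \sum_(j < (2 * N).+1) wt (freq j) `^ s * normc (u x (freq j)) ^+ 2 @[x --> F]
       --> \sum_(j < (2 * N).+1) wt (freq j) `^ s * normc (L (freq j)) ^+ 2.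
    apply: cvg_sumr => j; apply: cvgMr; under eq_fun do rewrite expr2; rewrite expr2.
    by apply: cvgM; exact: cvgc_normc.
  have <- := cvg_lim (@Rhausdorff R) cv; apply: limr_le.
    by apply/cvg_ex; eexists; exact: cv.
  apply: filterS Fc => x /= h; rewrite -lee_fin; apply: le_trans h; rewrite sqnormE.
  by apply: (zpart_le_zsum N) => m; exact: term_ge0.
exists L => // r e rs e0.
have c0 : 0 <= c by rewrite -lee_fin; apply: le_trans Lc; exact: sqnorm_ge0.
pose N := (Num.truncn (8 * c / e)).+1.
have N0 : 0 < N%:R :> R by rewrite ltr0n.
have Ne : 4 * c / N%:R <= e / 2.
  have : 8 * c / e <= N%:R by apply/ltW; exact: truncnS_gt.
  by rewrite ler_pdivrMr// ler_pdivrMr// => h; nra.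
pose t x m : R := wt m `^ r * normc (L m - u x m) ^+ 2.
have t0 x m : 0 <= t x m by rewrite /t mulr_ge0 ?powR_ge0 ?sqr_ge0.
have low : F [set x | zpart (t x) N <= e / 2].
  have cv : zpart (t x) N @[x --> F] --> (0 : R).
    have <- : nbhs (\sum_(j < (2 * N).+1) (wt (freq j) `^ r * (0 * 0) : R)) = nbhs (0 : R).
      by rewrite big1// => j _; rewrite !mulr0.
    apply: cvg_sumr => j; apply: cvgMr; rewrite /t; under eq_fun do rewrite expr2.
    have cn : normc (L (freq j) - u x (freq j)) @[x --> F] --> (0 : R).
      have <- : nbhs (normc (L (freq j) + (-1) * L (freq j))) = nbhs (0 : R) by rewrite mulN1r subrr Normc.normc0.
      apply: cvgc_normc; under eq_fun do rewrite -mulN1r.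
      exact: (cvgcD (cvgc_cst _) (cvgcM_cst (-1) (HL _))).
    exact: cvgM.
  have e2 : 0 < e / 2 by rewrite divr_gt0.
  exact: (cvgr_le (0 : R) cv _ e2).
apply: filterS (filterI Fc low) => x [/= uc lowx].
rewrite sqnormE; apply: zsum_le_window => [m|M]; first by rewrite lee_fin mulr_ge0 ?powR_ge0 ?sqr_ge0.
rewrite sumEFin lee_fin.
apply: (@le_trans _ _ (zpart (fun m => t x m * (`|m| <= N)%N%:R) M + zpart (fun m => t x m * (N < `|m|)%N%:R) M)).
  rewrite -big_split; apply: ler_sum => j _ /=; rewrite -mulrDr ltnNge.
  by case: leqP => _; rewrite /= ?add0r ?addr0 mulr1.
rewrite [e]splitr; apply: lerD; first exact: le_trans (zpart_low _ _ _) lowx.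
apply: le_trans Ne; rewrite -lee_fin.
have hi0 m : 0 <= t x m * (N < `|m|)%N%:R by rewrite mulr_ge0.
apply: le_trans (zpart_le_zsum M hi0) _.
apply: (@le_trans _ _ ((N%:R)^-1%:E * sobolev_sqnorm s (fun m => L m - u x m)%R)%E).
  rewrite sqnormE -zsumZ ?invr_ge0//; last first.
    by move=> m; rewrite lee_fin mulr_ge0 ?powR_ge0 ?sqr_ge0.
  apply: le_zsum => m; rewrite -EFinM lee_fin.
  have [_|Nm] := leqP; first by rewrite mulr0 mulr_ge0 ?invr_ge0// mulr_ge0 ?powR_ge0 ?sqr_ge0.
  rewrite mulr1 [leRHS]mulrA ler_wpM2r ?sqr_ge0// mulrC ler_pdivlMr//.
  have w0 : 0 <= wt m :> R by rewrite ltW// wt_gt0.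
  apply: (@le_trans _ _ (wt m `^ (r + 1))); last by apply: ler_powR => //; exact: wt_ge1.
  rewrite powRD; last by rewrite (gt_eqF (wt_gt0 m)) implybT.
  rewrite powRr1// ler_wpM2l ?powR_ge0// /wt.
  have : (N%:R : R) <= `|m%:~R|.
    by rewrite -intr_norm -abszE -[N%:R]/(N%:Z%:~R) ler_int lez_nat ltnW.
  rewrite -[m%:~R ^+ 2]real_normK ?num_real//; set z := `|_|; have : 1 <= N%:R :> R by rewrite ler1n.
  nra.
rewrite mulrC EFinM lee_wpmul2l ?lee_fin ?invr_ge0//.
apply: (@le_trans _ _ (2%:E * sobolev_sqnorm s L + 2%:E * sobolev_sqnorm s (u x))%E).
  apply: le_trans (sqnormD _ _ _) _; rewrite leeD2l// lee_wpmul2l//.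
  by apply: le_zsum => m; rewrite normc_opp.
rewrite (_ : 4 * c = 2 * c + 2 * c); last by ring.
rewrite [(2 * c + 2 * c)%:E]EFinD [(2 * c)%:E]EFinM.
by rewrite leeD// lee_wpmul2l.
Qed.

Lemma sobolev_norm_sqr q (u : sobolev q) : ((sobolev_norm q u) ^+ 2)%:E = sobolev_sqnorm q u.
Proof.
have [S S0 SE] := in_sobolev_fin (fourierP u).
by rewrite /sobolev_norm SE /= sqr_sqrtr.
Qed.

Lemma le_sobolev_norm q (u : sobolev q) (M : R) : 0 <= M ->
  (sobolev_norm q u <= M) = (sobolev_sqnorm q u <= (M ^+ 2)%:E)%E.
Proof.
by move=> M0; rewrite -sobolev_norm_sqr lee_fin ler_sqr ?nnegrE// sobolev_norm_ge0.
Qed.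

Lemma norm_sobolev q (u : sobolev q) : `|u| = (sobolev_norm q u)%:C.
Proof. by []. Qed.

Lemma norm_sobolev2 q (x : sobolev2 q) : `|x| = (sobolev_norm q x.1 + sobolev_norm q x.2)%:C.
Proof. by rewrite rmorphD. Qed.

Lemma compact_sobolev_ball r s c : 0 <= s -> r + 1 <= s ->
  compact [set x : sobolev2 r | (sobolev_sqnorm s x.1 <= c%:E)%E /\ (sobolev_sqnorm s x.2 <= c%:E)%E].
Proof.
move=> s0 rs; rewrite compact_ultra => F UF FK.
have FK1 : F [set x : sobolev2 r | (sobolev_sqnorm s x.1 <= c%:E)%E] by apply: filterS FK => x [].
have FK2 : F [set x : sobolev2 r | (sobolev_sqnorm s x.2 <= c%:E)%E] by apply: filterS FK => x [].
have [L1 L1c H1] := @ultra_sobolev_limit _ F (fun x : sobolev2 r => fourier x.1) s c UF s0 FK1.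
have [L2 L2c H2] := @ultra_sobolev_limit _ F (fun x : sobolev2 r => fourier x.2) s c UF s0 FK2.
have rs' : r <= s by apply: le_trans rs; rewrite lerDl.
have inr L : (sobolev_sqnorm s L <= c%:E)%E -> L \in @in_sobolev R r.
  move=> Lc; apply: (in_sobolev_le rs'); apply/in_sobolevP.
  by apply: le_lt_trans Lc _; exact: ltry.
pose L : sobolev2 r := (Sobolev (inr L1 L1c), Sobolev (inr L2 L2c)).
exists L; split; first by split.
apply/cvgrPdist_le => e e0.
have [e' e'0 ->] : exists2 e' : R, 0 < e' & e = e'%:C.
  by case: e e0 => a b; rewrite ltcE /= => /andP[/eqP b0 a0]; exists a; rewrite // b0.
have e2 : 0 < (e' / 2) ^+ 2 by rewrite exprn_gt0// divr_gt0.
apply: filterS (filterI (H1 r _ rs e2) (H2 r _ rs e2)) => x [/= h1 h2].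
rewrite norm_sobolev2 lecR [e']splitr.
have e2' : 0 <= e' / 2 by rewrite divr_ge0// ltW.
by apply: lerD; rewrite le_sobolev_norm.
Qed.

(** Bounded sets are mapped into a ball of H^s, which is compact in H^r. *)
Lemma compact_operator_gain q r s (f : {linear sobolev2 q -> sobolev2 r}) (C : R) :
  0 <= s -> r + 1 <= s -> 0 <= C ->
  (forall x, (sobolev_sqnorm s (f x).1 <= C%:E * (sobolev_sqnorm q x.1 + sobolev_sqnorm q x.2))%E) ->
  (forall x, (sobolev_sqnorm s (f x).2 <= C%:E * (sobolev_sqnorm q x.1 + sobolev_sqnorm q x.2))%E) ->
  compact_operator f.
Proof.
move=> s0 rs C0 f1 f2 B [M0 [M0r BM]].
have [M M0' HM] : exists2 M : R, 0 <= M & forall x, B x -> `|x| <= M%:C.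
  exists (`|complex.Re M0| + 1); first by rewrite addr_ge0.
  move=> x Bx; apply: BM => //; move: M0r; case: (M0) => a b.
  rewrite realE !lecE ltcE /= => h; have -> : b = 0 by case/orP : h => /andP[/eqP].
  by rewrite eqxx ltr_pwDr// ler_norm.
apply: precompact_subset (compact_precompact (@norm_hausdorff _ _) (@compact_sobolev_ball r s (C * (M ^+ 2 + M ^+ 2)) s0 rs)).
move=> _ [x Bx <-] /=.
have := HM x Bx; rewrite norm_sobolev2 lecR => xM.
have n1 := sobolev_norm_ge0 q x.1; have n2 := sobolev_norm_ge0 q x.2.
have x1 : (sobolev_sqnorm q x.1 <= (M ^+ 2)%:E)%E by rewrite -le_sobolev_norm//; apply: le_trans xM; rewrite lerDl.
have x2 : (sobolev_sqnorm q x.2 <= (M ^+ 2)%:E)%E by rewrite -le_sobolev_norm//; apply: le_trans xM; rewrite lerDr.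
by split; [apply: le_trans (f1 x) _|apply: le_trans (f2 x) _]; rewrite EFinM lee_wpmul2l// EFinD leeD.
Qed.

End compact_embedding.

(** * Orders of the symbols *)

Section symbols.
Context {R : realType}.
Notation normc := Normc.normc.
Notation imc := ((0 : R) +i* 1).
Implicit Types (q r s : R) (m : int).

Lemma opr_gain (mu : int -> R[i]) (n : nat) q (C : R) : 0 <= C ->
  (forall m, normc (mu m) ^+ 2 * wt m ^+ n <= C) -> opr q (q + n%:R) (fun u m => mu m * u m).
Proof.
move=> C0 H; apply: (@opr_multiplier _ _ _ _ C) => // m.
rewrite powRD; last by rewrite (gt_eqF (wt_gt0 m)) implybT.
rewrite powR_mulrn ?(ltW (wt_gt0 m))// -mulrA mulrC ler_wpM2r ?powR_ge0// mulrC.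
exact: H.
Qed.

Lemma opr_loss (mu : int -> R[i]) q (C : R) : 0 <= C ->
  (forall m, normc (mu m) ^+ 2 <= C * wt m) -> opr (q + 1) q (fun u m => mu m * u m).
Proof.
move=> C0 H; apply: (@opr_multiplier _ _ _ _ C) => // m.
rewrite powRD; last by rewrite (gt_eqF (wt_gt0 m)) implybT.
by rewrite powRr1 ?(ltW (wt_gt0 m))// [leRHS]mulrCA ler_wpM2l ?powR_ge0.
Qed.

Lemma bounded_outside_window (f : int -> R) (C : R) : (forall m, 0 <= f m) ->
  (forall m, (3 <= `|m|)%N -> f m <= C) -> exists2 C' : R, 0 <= C' & forall m, f m <= C'.
Proof.
move=> f0 fC; exists (`|C| + \sum_(j < 5) f (@freq 2 j)).
  by rewrite addr_ge0// sumr_ge0.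
move=> m; have [/fC h|] := leqP 3 `|m|.
  by apply: le_trans h _; rewrite ler_wpDr ?ler_norm// sumr_ge0.
rewrite ltnS => /(@freqP 2) [j <-]; rewrite (bigD1 j)//=.
have : 0 <= \sum_(i < 5 | i != j) f (@freq 2 i) by exact: sumr_ge0.
have := normr_ge0 C; lra.
Qed.

Lemma logcoefN m : logcoef (- m) = logcoef m :> R.
Proof. by rewrite /logcoef oppr_eq0 rmorphN normrN. Qed.

Lemma logcoef_pos m : 0 < m -> logcoef m = (m%:~R)^-1 :> R.
Proof. by move=> m0; rewrite /logcoef gt_eqF// gtr0_norm// ltr0z. Qed.

Lemma wtN m : wt (- m) = wt m :> R. Proof. by rewrite /wt rmorphN sqrrN. Qed.

(** Only large frequencies matter for the order, and by symmetry only positive ones.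
    Beyond 3 no argument of [logcoef] in the symbols below meets 0, so that all
    formulas are rational functions of m. *)
Lemma opr_even_symbol (mu : int -> R[i]) (n : nat) q (C : R) :
  (forall m, normc (mu (- m)) = normc (mu m)) ->
  (forall m, 3 <= m -> normc (mu m) ^+ 2 * wt m ^+ n <= C) -> opr q (q + n%:R) (fun u m => mu m * u m).
Proof.
move=> muN H.
have [|m m3|C' C'0 HC'] := @bounded_outside_window (fun m => normc (mu m) ^+ 2 * wt m ^+ n) C.
- by move=> m; rewrite mulr_ge0 ?sqr_ge0// exprn_ge0// ltW// wt_gt0.
- have [m0|m0] := leP 0 m; first by apply: H; lia.
  by rewrite -muN -wtN; apply: H; lia.
exact: opr_gain HC'.
Qed.

Lemma S0symbN m : S0symb (- m) = S0symb m :> R[i].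
Proof. by rewrite /S0symb logcoefN oppr_eq0. Qed.

Lemma S2symbN m : S2symb (- m) = S2symb m :> R.
Proof.
rewrite /S2symb logcoefN (_ : - m - 2 = - (m + 2)); last by lia.
by rewrite (_ : - m + 2 = - (m - 2)) ?logcoefN; [ring|lia].
Qed.

Lemma S1symbN m : S1symb (- m) = - S1symb m :> R[i].
Proof.
rewrite /S1symb (_ : - m - 1 = - (m + 1)); last by lia.
rewrite (_ : - m + 1 = - (m - 1)) ?logcoefN; last by lia.
by rewrite -mulrN -rmorphN opprB.
Qed.

Lemma T0symbN m : T0symb (- m) = T0symb m :> R[i].
Proof. by rewrite /T0symb [(- m)%:~R]rmorphN normrN oppr_eq0. Qed.

Lemma wt_ge3 m : 3 <= m -> [/\ 3 <= m%:~R :> R, wt m = 1 + m%:~R ^+ 2 :> R & m != 0].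
Proof. by move=> m3; split => //; [rewrite (ler_int R 3 m)|lia]. Qed.

Lemma opr_S0 q : opr q (q + 1) S0.
Proof.
apply: (opr_ext (A := fun u m => S0symb m * u m)) => [u _|]; first by rewrite S0E.
apply: (@opr_even_symbol _ 1 q 2) => [m|m m3]; first by rewrite S0symbN.
have [x3 -> m0] := wt_ge3 m3; set x := m%:~R : R in x3 *.
rewrite /S0symb (negbTE m0) mul0r addr0 logcoef_pos ?normc_real; last by lia.
rewrite real_normK ?num_real// expr1 -/x exprVn.
rewrite mulrC ler_pdivrMr ?exprn_gt0//; nra.
Qed.

Lemma S1symb_pos m : 3 <= m -> normc (S1symb m) = (2 * (m%:~R ^+ 2 - 1))^-1 :> R.
Proof.
move=> m3; have [x3 _ _] := wt_ge3 m3.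
rewrite /S1symb !logcoef_pos; [|lia..].
have -> : (m - 1)%:~R = m%:~R - 1 :> R by rewrite rmorphB.
have -> : (m + 1)%:~R = m%:~R + 1 :> R by rewrite rmorphD.
set x := m%:~R : R in x3 *.
have -> : imc / 4 * ((x - 1)^-1 - (x + 1)^-1)%:C = 0 +i* (2 * (x ^+ 2 - 1))^-1.
  have -> : 4 = (4 : R)%:C by rewrite rmorph_nat.
  rewrite -fmorphV; apply: eq_ReIm; rewrite !(ReM, ImM) /=; (field; by rewrite !gt_eqF//; nra).
by rewrite normc_imag ger0_norm// invr_ge0; nra.
Qed.

Lemma opr_S1 q : opr q (q + 2) S1.
Proof.
apply: (opr_ext (A := fun u m => S1symb m * u m)) => [u _|]; first by rewrite S1E.
apply: (@opr_even_symbol _ 2 q 1) => [m|m m3]; first by rewrite S1symbN normc_opp.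
have [x3 -> m0] := wt_ge3 m3; rewrite S1symb_pos//; set x := m%:~R : R in x3 *.
have d0 : 0 < 2 * (x ^+ 2 - 1) by nra.
rewrite exprVn mulrC ler_pdivrMr ?exprn_gt0// mul1r.
by apply: lerXn2r; rewrite ?nnegrE; nra.
Qed.

Lemma S2symb_pos m : 3 <= m -> S2symb m = - (2 * m%:~R * (m%:~R ^+ 2 - 4))^-1 :> R.
Proof.
move=> m3; have [x3 _ _] := wt_ge3 m3.
rewrite /S2symb !logcoef_pos; [|lia..].
rewrite rmorphB rmorphD /=; set x := m%:~R : R in x3 *.
by field; rewrite !gt_eqF//; nra.
Qed.

Lemma opr_S2 q : opr q (q + 3) S2.
Proof.
apply: (opr_ext (A := fun u m => (S2symb m)%:C * u m)) => [u _|]; first by rewrite S2E.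
apply: (@opr_even_symbol _ 3 q 2) => [m|m m3]; first by rewrite S2symbN.
have [x3 -> m0] := wt_ge3 m3; rewrite S2symb_pos// normc_real; set x := m%:~R : R in x3 *.
rewrite real_normK ?num_real// sqrrN exprVn mulrC ler_pdivrMr; last by rewrite exprn_gt0//; nra.
have -> : 2 * (2 * x * (x ^+ 2 - 4)) ^+ 2 = (2 * x ^+ 2) * (2 * (x ^+ 2 - 4)) ^+ 2 by ring.
rewrite exprS; apply: ler_pM; [nra|by rewrite sqr_ge0|nra|].
by apply: lerXn2r; rewrite ?nnegrE; nra.
Qed.

(** The symbol of S2 T0 - S0 S0 / 2. *)
Definition Dsymb m : R[i] := (S2symb m)%:C * T0symb m - 2^-1 * (S0symb m * S0symb m).

(** For m >= 3 the two symbols are 1 / (2 (m^2 - 4)) and 1 / (2 m^2); their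
    difference has order - 4. *)
Lemma opr_D q : opr q (q + 3) (fun u m => Dsymb m * u m).
Proof.
apply: (@opr_even_symbol _ 3 q 32) => [m|m m3].
  by rewrite /Dsymb S2symbN T0symbN S0symbN.
have [x3 -> m0] := wt_ge3 m3.
have -> : Dsymb m = (2 / (m%:~R ^+ 2 * (m%:~R ^+ 2 - 4)))%:C.
  rewrite /Dsymb S2symb_pos// /T0symb /S0symb (negbTE m0) !mul0r !addr0 logcoef_pos; last by lia.
  rewrite ger0_norm; last by lra.
  have -> : 2^-1 = (2^-1 : R)%:C by rewrite fmorphV rmorph_nat.
  rewrite -!rmorphM -rmorphB /=; congr (_%:C); set x := m%:~R : R in x3 *.
  by field; rewrite !gt_eqF//; nra.
rewrite normc_real; set x := m%:~R : R in x3 *.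
have d0 : 0 < x ^+ 2 * (x ^+ 2 - 4) by apply: mulr_gt0; nra.
rewrite real_normK ?num_real// expr_div_n mulrAC ler_pdivrMr ?exprn_gt0//.
have -> : 32 * (x ^+ 2 * (x ^+ 2 - 4)) ^+ 2 = 4 * ((2 * x ^+ 4) * (2 * (x ^+ 2 - 4)) ^+ 2) by ring.
rewrite (_ : 2 ^+ 2 = 4) ?ler_wpM2l//; last by ring.
rewrite exprS; apply: ler_pM; [nra|by rewrite sqr_ge0|nra|].
by apply: lerXn2r; rewrite ?nnegrE; nra.
Qed.

Lemma normc_T0symb m : normc (T0symb m) ^+ 2 <= 1 * wt m :> R.
Proof.
rewrite normc_sqr /T0symb /wt ReD ImD !(ReM, ImM) /=.
have := sqr_ge0 (m%:~R : R); rewrite -[m%:~R ^+ 2]real_normK ?num_real//.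
by case: (m == 0); rewrite /=; nra.
Qed.

Lemma opr_T0 q : opr (q + 1) q T0.
Proof.
apply: (opr_ext (A := fun u m => T0symb m * u m)) => [u _|]; first by rewrite T0E.
by apply: (opr_loss _ _ normc_T0symb).
Qed.

(** Both |m| and the indicator of 0 vary by at most |m - k| between distinct m and k,
    and 2 |m - k| <= 1 + (m - k)^2. *)
Lemma T0symb_lipschitz m k : normc (T0symb m - T0symb k) <= wt (m - k) :> R.
Proof.
have [->|mk] := eqVneq m k; first by rewrite !subrr Normc.normc0 ltW// wt_gt0.
have -> : T0symb m - T0symb k = (`|k%:~R| - `|m%:~R|)%:C + (0 +i* ((m == 0)%:R - (k == 0)%:R)) :> R[i].
  rewrite /T0symb; case: (m == 0); case: (k == 0); apply: eq_ReIm;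
  rewrite !(ReD, ImD, ReN, ImN, ReM, ImM)/=; ring.
apply: le_trans (le_normcD _ _) _; rewrite normc_real normc_imag.
have h1 : `|(`|k%:~R| - `|m%:~R| : R)| <= `|(m - k)%:~R|.
  by rewrite distrC rmorphB/=; exact: ler_dist_dist.
have h2 : 1 <= `|(m - k)%:~R : R|.
  by rewrite -intr_norm (ler_int R 1); lia.
rewrite /wt -[(m - k)%:~R ^+ 2]real_normK ?num_real//.
set y : R := `|(m - k)%:~R| in h1 h2 *.
apply: (@le_trans _ _ (y + 1)); last by nra.
apply: lerD => //.
by case: (m == 0); case: (k == 0); rewrite /= ?mulr1 ?mul1r ?mul0r ?mulr0 ?addr0 ?add0r ?subr0 ?subrr ?sub0r ?normrN ?normr0 ?normr1.
Qed.

Lemma S0T0symb m : S0symb m * T0symb m = -1 :> R[i].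
Proof.
rewrite /S0symb /T0symb /logcoef; have [->|m0] := eqVneq m 0.
  rewrite normr0 oppr0; apply: eq_ReIm; rewrite !(ReM, ImM, ReD, ImD)/=; ring.
rewrite !mul0r !addr0 -rmorphM mulrN mulVf ?rmorphN//.
by rewrite normr_eq0 intr_eq0.
Qed.

End symbols.

(** * The square of N *)

Section square.
Context {R : realType}.
Notation normc := Normc.normc.
Implicit Types (q r s p : R) (u v x y : int -> R[i]).

Lemma oprD q r A u v : opr q r A -> u \in in_sobolev q -> v \in in_sobolev q ->
  A (u + v) = A u + A v.
Proof.
move=> [lA _] uq vq; have := lA 1 u v uq vq.
rewrite (_ : (fun m => 1 * u m + v m) = u + v); last by apply/funext => m; rewrite mul1r.
by move=> ->; apply/funext => m; rewrite mul1r.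
Qed.

Lemma oprZ q r A (c : R[i]) u : opr q r A -> u \in in_sobolev q -> A (c *: u) = c *: A u.
Proof.
move=> oA uq; have z0 : 0 \in @in_sobolev R q by exact: rpred0.
have A0 : A 0 = 0 by apply: (addrI (A 0)); rewrite -(oprD oA)// !addr0.
have [lA _] := oA; have := lA c u 0 uq z0.
rewrite (_ : (fun m => c * u m + 0 m) = c *: u); last by apply/funext => m; rewrite addr0.
by move=> ->; rewrite A0; apply/funext => m; rewrite addr0.
Qed.

Lemma oprN q r A u : opr q r A -> u \in in_sobolev q -> A (- u) = - A u.
Proof. by move=> oA uq; rewrite -[- u]scaleN1r (oprZ _ oA)// scaleN1r. Qed.

Lemma S0T0 u : S0 (T0 u) = - u.
Proof. by rewrite S0E T0E; apply/funext => m; rewrite mulrA S0T0symb mulN1r. Qed.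

Lemma T0S0 u : T0 (S0 u) = - u.
Proof. by rewrite S0E T0E; apply/funext => m; rewrite mulrA [T0symb _ * _]mulrC S0T0symb mulN1r. Qed.

Lemma S2T0 u : S2 (T0 u) = T0 (S2 u).
Proof. by rewrite !S2E !T0E; apply/funext => m; rewrite mulrCA. Qed.

(** Only mapping properties and four identities between the operators enter the
    computation, so it is done for arbitrary operators; lower case letters stand
    for the operators of the same name, and dd for the operator of symbol
    [Dsymb]. *)
Section entries.
Variables (t0 s0 s1 s2 dd e1 e2 e3 e6 : (int -> R[i]) -> int -> R[i]).
Hypotheses (oE1 : forall q, 0 <= q -> opr q q e1) (oE2 : forall q, 0 <= q -> opr q q e2).
Hypotheses (oE3 : forall q, 0 <= q -> opr q q e3) (oE6 : forall q, 0 <= q -> opr q q e6).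
Hypotheses (ot0 : forall q, opr (q + 1) q t0) (os0 : forall q, opr q (q + 1) s0).
Hypotheses (os1 : forall q, opr q (q + 2) s1) (os2 : forall q, opr q (q + 3) s2).
Hypotheses (odd : forall q, opr q (q + 3) dd).
Hypotheses (s0t0 : forall u, s0 (t0 u) = - u) (t0s0 : forall u, t0 (s0 u) = - u).
Hypotheses (s2t0 : forall u, s2 (t0 u) = t0 (s2 u)).
Hypotheses (ddE : forall u, dd u = s2 (t0 u) - 2^-1 *: s0 (s0 u)).

Definition T0comm (E : (int -> R[i]) -> int -> R[i]) u := t0 (E u) - E (t0 u).
Hypotheses (oC1 : forall q, 1 <= q -> opr q q (T0comm e1)).
Hypotheses (oC2 : forall q, 1 <= q -> opr q q (T0comm e2)).

(** The notation of the computation: N maps (x, y) to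
    (x + P x + B y, T0 x - y + F x - P y), where P, B and F have the orders - 3,
    - 1 and - 1. *)
Definition opP u := e2 (s2 u).
Definition opB u := s0 u + e1 (s2 u).
Definition opF u := 2^-1 *: e1 (s0 u) + e3 (s1 u) + e6 (s2 u).

Lemma opr_P q : -1 <= q -> opr q (q + 3) opP.
Proof. by move=> q1; apply: (@opr_comp _ q (q + 3)); [exact: os2|apply: oE2; lra]. Qed.

Lemma opr_E1S2 q : -1 <= q -> opr q (q + 3) (fun u => e1 (s2 u)).
Proof. by move=> q1; apply: (@opr_comp _ q (q + 3)); [exact: os2|apply: oE1; lra]. Qed.

Lemma opr_B q : -1 <= q -> opr q (q + 1) opB.
Proof.
move=> q1; apply: opr_add; first exact: os0.
by apply: (opr_weaken _ _ (opr_E1S2 q1)) => //; lra.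
Qed.

Lemma opr_E6S2 q : -1 <= q -> opr q (q + 3) (fun u => e6 (s2 u)).
Proof. by move=> q1; apply: (@opr_comp _ q (q + 3)); [exact: os2|apply: oE6; lra]. Qed.

Lemma opr_E3S1 q : -1 <= q -> opr q (q + 2) (fun u => e3 (s1 u)).
Proof. by move=> q1; apply: (@opr_comp _ q (q + 2)); [exact: os1|apply: oE3; lra]. Qed.

Lemma opr_F q : -1 <= q -> opr q (q + 1) opF.
Proof.
move=> q1; apply: opr_add; first apply: opr_add.
- apply: (opr_scale (A := fun u => e1 (s0 u))).
  by apply: (@opr_comp _ q (q + 1)); [exact: os0|apply: oE1; lra].
- by apply: (opr_weaken _ _ (opr_E3S1 q1)) => //; lra.
- by apply: (opr_weaken _ _ (opr_E6S2 q1)) => //; lra.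
Qed.

(** The entries of N^2 - U, arranged so that every summand visibly gains three
    orders. *)
Definition J11 u := opP u + opP u + opP (opP u) + e1 (dd u) + 2^-1 *: s0 (T0comm e1 (s0 (s0 u)))
  + s0 (e3 (s1 u)) + s0 (e6 (s2 u)) + e1 (s2 (opF u)).
Definition J12 u := opP (s0 u) + opP (e1 (s2 u)) - s0 (opP u) - e1 (s2 (opP u)).
Definition J21 u := T0comm e2 (s2 u) + opF (opP u) - opP (opF u).
Definition J22 u := T0comm e1 (s2 u) + e1 (dd u) + e3 (s1 (s0 u)) + e6 (s2 (s0 u))
  + opF (e1 (s2 u)) + opP u + opP u + opP (opP u).

Lemma compw q r r' s s' A B : r' <= r -> s <= s' -> opr q r A -> opr r' s' B -> opr q s (fun u => B (A u)).
Proof.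
by move=> rr ss oA oB; apply: (opr_comp oA); apply: (opr_weaken rr ss oB).
Qed.

Lemma opr_J11 p : 0 <= p -> opr p (p + 3) J11.
Proof.
move=> p0; have p1 : -1 <= p by lra.
have oP := opr_P p1.
have oPP : opr p (p + 3) (fun u => opP (opP u)).
  by apply: (compw (r' := p) _ _ oP oP); lra.
apply: opr_add; first apply: opr_add; first apply: opr_add; first apply: opr_add; first apply: opr_add; first apply: opr_add; first apply: opr_add.
- exact: oP.
- exact: oP.
- exact: oPP.
- by apply: (compw (r' := p + 3) _ _ (odd p) (oE1 _)); lra.
- apply: (opr_scale (A := fun u => s0 (T0comm e1 (s0 (s0 u))))).
  have oSS := compw (s := p + 2) (lexx _) _ (os0 p) (os0 (p + 1)).
  apply: (compw (r := p + 2) (r' := p + 2) _ _ _ (os0 _)); [lra|lra|].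
  by apply: (compw (r := p + 2) (r' := p + 2) _ _ (oSS _) (oC1 _)); lra.
- by apply: (compw (r' := p + 2) _ _ (opr_E3S1 p1) (os0 _)); lra.
- by apply: (compw (r' := p + 3) _ _ (opr_E6S2 p1) (os0 _)); lra.
- by apply: (compw (r' := p) _ _ (opr_F p1) (opr_E1S2 p1)); lra.
Qed.

Lemma opr_J12 p : 0 <= p -> opr p (p + 3) J12.
Proof.
move=> p0; have p1 : -1 <= p by lra.
have oP := opr_P p1.
apply: opr_sub; first apply: opr_sub; first apply: opr_add.
- by apply: (compw (r' := p) _ _ (os0 p) oP); lra.
- by apply: (compw (r' := p) _ _ (opr_E1S2 p1) oP); lra.
- by apply: (compw (r' := p + 3) _ _ oP (os0 _)); lra.
- by apply: (compw (r' := p) _ _ oP (opr_E1S2 p1)); lra.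
Qed.

Lemma opr_J21 p : 0 <= p -> opr p (p + 3) J21.
Proof.
move=> p0; have p1 : -1 <= p by lra.
have oP := opr_P p1.
apply: opr_sub; first apply: opr_add.
- by apply: (compw (r' := p + 3) _ _ (os2 p) (oC2 _)); lra.
- by apply: (compw (r' := p + 3) _ _ oP (opr_F _)); lra.
- by apply: (compw (r' := p + 1) _ _ (opr_F p1) (opr_P _)); lra.
Qed.

Lemma opr_J22 p : 0 <= p -> opr p (p + 3) J22.
Proof.
move=> p0; have p1 : -1 <= p by lra.
have oP := opr_P p1.
apply: opr_add; first apply: opr_add; first apply: opr_add; first apply: opr_add; first apply: opr_add; first apply: opr_add; first apply: opr_add.
- by apply: (compw (r' := p + 3) _ _ (os2 p) (oC1 _)); lra.
- by apply: (compw (r' := p + 3) _ _ (odd p) (oE1 _)); lra.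
- by apply: (compw (r' := p + 1) _ _ (os0 p) (opr_E3S1 _)); lra.
- by apply: (compw (r' := p + 1) _ _ (os0 p) (opr_E6S2 _)); lra.
- by apply: (compw (r' := p + 3) _ _ (opr_E1S2 p1) (opr_F _)); lra.
- exact: oP.
- exact: oP.
- by apply: (compw (r' := p) _ _ oP oP); lra.
Qed.

Definition opU u := e1 (s0 (s0 u)).

Lemma opr_U p : 0 <= p -> opr p (p + 2) opU.
Proof.
move=> p0; have oSS := compw (s := p + 2) (lexx _) _ (os0 p) (os0 (p + 1)).
by apply: (compw (r' := p + 2) _ _ (oSS _) (oE1 _)); lra.
Qed.

Definition opN1 x y := x + opP x + opB y.
Definition opN2 x y := t0 x - y + (opF x - opP y).

(** The entries of N applied to (x, y) and all their images lie in H^w for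
    w = p - 1, the space of T0 x; there P, B and F still make sense, because the
    multiplications only act on images of S0, S1 and S2, which lie in H^0. After expansion the two identities s0 t0 = t0 s0 = - I
    remove the identity on the diagonal, and the other terms of order at least
    - 1 cancel in pairs. Half of E1 S0 S0 comes out of S0 F and F S0, and the
    other half is the difference between S2 T0 and dd. *)
Lemma square_entries p x y : 0 <= p -> x \in in_sobolev p -> y \in in_sobolev p ->
  opN1 (opN1 x y) (opN2 x y) = opU x + J11 x + J12 y /\
  opN2 (opN1 x y) (opN2 x y) = J21 x + (opU y + J22 y).
Proof.
move=> p0 xp yp; pose w := p - 1.
have w1 : -1 <= w by rewrite /w; lra.
have wp : w <= p by rewrite /w; lra.
have wS A (c : R) u : 0 <= c -> opr w (w + c) A -> u \in in_sobolev w -> A u \in in_sobolev w.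
  by move=> c0 oA uw; apply: in_sobolev_le (opr_in oA uw); rewrite lerDl.
have oP := opr_P w1; have oB := opr_B w1; have oF := opr_F w1.
have oS0 := os0 w; have oS2 := os2 w; have oS1 := os1 w.
have oT0 : opr p w t0 by have := ot0 w; rewrite /w subrK.
have in0 c u A : opr w (w + c) A -> 1 <= c -> u \in in_sobolev w -> A u \in in_sobolev 0.
  by move=> oA c1 uw; apply: in_sobolev_le (opr_in oA uw); rewrite /w; lra.
have wopp u : u \in in_sobolev w -> - u \in in_sobolev w by move=> h; rewrite rpredN.
have E1D u v : u \in in_sobolev 0 -> v \in in_sobolev 0 -> e1 (u + v) = e1 u + e1 v by exact: oprD (oE1 (lexx 0)).
have E1Z (c : R[i]) u : u \in in_sobolev 0 -> e1 (c *: u) = c *: e1 u by exact: oprZ (oE1 (lexx 0)).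
have PD u v : u \in in_sobolev w -> v \in in_sobolev w -> opP (u + v) = opP u + opP v by exact: oprD oP.
have PN u : u \in in_sobolev w -> opP (- u) = - opP u by exact: oprN oP.
have BD u v : u \in in_sobolev w -> v \in in_sobolev w -> opB (u + v) = opB u + opB v by exact: oprD oB.
have BN u : u \in in_sobolev w -> opB (- u) = - opB u by exact: oprN oB.
have FD u v : u \in in_sobolev w -> v \in in_sobolev w -> opF (u + v) = opF u + opF v by exact: oprD oF.
have S0D u v : u \in in_sobolev w -> v \in in_sobolev w -> s0 (u + v) = s0 u + s0 v by exact: oprD oS0.
have S0Z (c : R[i]) u : u \in in_sobolev w -> s0 (c *: u) = c *: s0 u by exact: oprZ oS0.
have TD u v : u \in in_sobolev p -> v \in in_sobolev p -> t0 (u + v) = t0 u + t0 v by exact: oprD oT0.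
have xw := in_sobolev_le wp xp; have yw := in_sobolev_le wp yp.
have Tw u : u \in in_sobolev p -> t0 u \in in_sobolev w by exact: (opr_in oT0).
have Pw u : u \in in_sobolev w -> opP u \in in_sobolev w by apply: wS oP; lra.
have Bw u : u \in in_sobolev w -> opB u \in in_sobolev w by exact: wS oB.
have Fw u : u \in in_sobolev w -> opF u \in in_sobolev w by exact: wS oF.
have S0w u : u \in in_sobolev w -> s0 u \in in_sobolev w by exact: wS oS0.
have wD u v : u \in in_sobolev w -> v \in in_sobolev w -> u + v \in in_sobolev w by exact: rpredD.
have E12w u : u \in in_sobolev w -> e1 (s2 u) \in in_sobolev w by apply: wS (opr_E1S2 w1); lra.
have inp c u A : opr w (w + c) A -> 1 <= c -> u \in in_sobolev w -> A u \in in_sobolev p.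
  by move=> oA c1 uw; apply: in_sobolev_le (opr_in oA uw); rewrite /w; lra.
have E10w u : u \in in_sobolev w -> e1 (s0 u) \in in_sobolev w.
  move=> uw; apply: (in_sobolev_le wp); apply: (opr_in (oE1 p0)).
  by apply: inp uw; [exact: oS0|].
have S00 u : u \in in_sobolev w -> s0 u \in in_sobolev 0 by exact: in0 oS0 _.
have S20 u : u \in in_sobolev w -> s2 u \in in_sobolev 0 by apply: in0 oS2 _; lra.
have E1dd u : u \in in_sobolev p -> e1 (dd u) = e1 (s2 (t0 u)) - 2^-1 *: e1 (s0 (s0 u)).
  move=> up; have uw := in_sobolev_le wp up.
  have h1 := S20 _ (Tw _ up); have h2 := S00 _ (S0w _ uw).
  have h3 : - 2^-1 *: s0 (s0 u) \in in_sobolev 0 by apply: rpredZ.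
  by rewrite ddE -scaleNr E1D// E1Z// scaleNr.
have comm1 : s0 (T0comm e1 (s0 (s0 x))) = s0 (e1 (s0 x)) - e1 (s0 (s0 x)).
  have h : e1 (- s0 x) = - e1 (s0 x) by rewrite -[- s0 x]scaleN1r E1Z ?S00// scaleN1r.
  rewrite /T0comm t0s0 h opprK S0D ?s0t0; [by rewrite addrC| |exact: E10w].
  apply: Tw; apply: (opr_in (oE1 p0)); apply: inp (S0w _ xw); [exact: oS0|by []].
have E3w u : u \in in_sobolev w -> e3 (s1 u) \in in_sobolev w by apply: wS (opr_E3S1 w1); lra.
have E6w u : u \in in_sobolev w -> e6 (s2 u) \in in_sobolev w by apply: wS (opr_E6S2 w1); lra.
have P1 : opP (opN1 x y) = opP x + opP (opP x) + (opP (s0 y) + opP (e1 (s2 y))).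
  have [m1 m2 m3] := And3 (Pw _ xw) (S0w _ yw) (E12w _ yw).
  by rewrite /opN1 /opB (PD _ _ (wD _ _ xw m1) (wD _ _ m2 m3)) (PD _ _ xw m1) (PD _ _ m2 m3).
have P2 : opP (opN2 x y) = e2 (t0 (s2 x)) - opP y + (opP (opF x) - opP (opP y)).
  have [m1 m2 m3 m4] := And4 (Tw _ xp) (wopp _ yw) (Fw _ xw) (wopp _ (Pw _ yw)).
  rewrite /opN2 (PD _ _ (wD _ _ m1 m2) (wD _ _ m3 m4)) (PD _ _ m1 m2) (PD _ _ m3 m4) !PN//; last exact: Pw.
  by rewrite {1}/opP s2t0.
have B2 : opB (opN2 x y) = - x + e1 (s2 (t0 x)) - opB y
    + (2^-1 *: s0 (e1 (s0 x)) + s0 (e3 (s1 x)) + s0 (e6 (s2 x)) + e1 (s2 (opF x)) - opB (opP y)).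
  have [m1 m2 m3 m4] := And4 (Tw _ xp) (wopp _ yw) (Fw _ xw) (wopp _ (Pw _ yw)).
  have [m5 m6 m7] := And3 (E10w _ xw) (E3w _ xw) (E6w _ xw).
  have m8 : 2^-1 *: e1 (s0 x) \in in_sobolev w by exact: rpredZ.
  rewrite /opN2 (BD _ _ (wD _ _ m1 m2) (wD _ _ m3 m4)) (BD _ _ m1 m2) (BD _ _ m3 m4) !BN//; last exact: Pw.
  rewrite {1}/opB s0t0; congr (_ + (_ - _)).
  by rewrite {1}/opB {1}/opF (S0D _ _ (wD _ _ m8 m6) m7) (S0D _ _ m8 m6) S0Z.
have T1 : t0 (opN1 x y) = t0 x + t0 (opP x) + (- y + t0 (e1 (s2 y))).
  have m1 : opP x \in in_sobolev p by apply: inp xw; [exact: oP|lra].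
  have m2 : s0 y \in in_sobolev p by apply: inp yw; [exact: oS0|].
  have m3 : e1 (s2 y) \in in_sobolev p by apply: (inp _ _ (fun u => e1 (s2 u))) yw; [exact: opr_E1S2 w1|lra].
  have m4 : x + opP x \in in_sobolev p by exact: rpredD.
  have m5 : s0 y + e1 (s2 y) \in in_sobolev p by exact: rpredD.
  by rewrite /opN1 /opB (TD _ _ m4 m5) (TD _ _ xp m1) (TD _ _ m2 m3) t0s0.
have F1 : opF (opN1 x y) = opF x + opF (opP x)
    + (2^-1 *: e1 (s0 (s0 y)) + e3 (s1 (s0 y)) + e6 (s2 (s0 y)) + opF (e1 (s2 y))).
  have [m1 m2 m3] := And3 (Pw _ xw) (S0w _ yw) (E12w _ yw).
  by rewrite /opN1 /opB (FD _ _ (wD _ _ xw m1) (wD _ _ m2 m3)) (FD _ _ xw m1) (FD _ _ m2 m3).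
split.
  rewrite {1}/opN1 P1 B2 /J11 /J12 /opU comm1 E1dd// /opN1 /opB /opP.
  apply/funext => m; rewrite !fctE.
  have sE (c z : R[i]) : c *: (z : R[i]^o) = c * z by [].
  by rewrite !sE; field.
rewrite {1}/opN2 T1 P2 F1 /J21 /J22 /opU E1dd// /T0comm s2t0 /opN2 /opP.
apply/funext => m; rewrite !fctE.
have sE (c z : R[i]) : c *: (z : R[i]^o) = c * z by [].
by rewrite !sE; field.
Qed.

End entries.
End square.

(** * Operators on pairs *)

Section block_operators.
Context {R : realType}.
Variables (p r : R) (A B C D : (int -> R[i]) -> int -> R[i]).
Hypotheses (oA : opr p r A) (oB : opr p r B) (oC : opr p r C) (oD : opr p r D).

Lemma block_in (F G : (int -> R[i]) -> int -> R[i]) (x : sobolev2 p) :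
  opr p r F -> opr p r G -> F x.1 + G x.2 \in in_sobolev r.
Proof. by move=> oF oG; apply: rpredD; apply: opr_in (fourierP _). Qed.

Definition block_map (x : sobolev2 p) : sobolev2 r :=
  (Sobolev (block_in x oA oB), Sobolev (block_in x oC oD)).

Lemma block_map_linear : linear block_map.
Proof.
have lin F G (oF : opr p r F) (oG : opr p r G) (a : R[i]) (x y : sobolev2 p) :
    F (a *: x + y).1 + G (a *: x + y).2 = a *: (F x.1 + G x.2) + (F y.1 + G y.2).
  have e1 : F (a *: x + y).1 = a *: F x.1 + F y.1.
    by have := oF.1 a _ _ (fourierP x.1) (fourierP y.1).
  have e2 : G (a *: x + y).2 = a *: G x.2 + G y.2.
    by have := oG.1 a _ _ (fourierP x.2) (fourierP y.2).
  by rewrite e1 e2 scalerDr addrACA.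
move=> a x y; congr (_, _); apply: val_inj; [exact: (lin A B)|exact: (lin C D)].
Qed.

HB.instance Definition _ := GRing.isLinear.Build R[i] (sobolev2 p) (sobolev2 r) *:%R block_map block_map_linear.

Lemma block_operator : exists L : {linear sobolev2 p -> sobolev2 r},
  forall x, fourier2 (L x) = (A x.1 + B x.2, C x.1 + D x.2).
Proof. by exists block_map. Qed.

End block_operators.

Section block_bounds.
Context {R : realType}.

Lemma opr0 (p r : R) : opr p r (fun=> 0).
Proof.
split; first by move=> a u v _ _; apply/funext => m; rewrite mulr0 addr0.
exists 0 => // u _; rewrite mul0e sqnormE /zsum esum1// => m _.
by rewrite Normc.normc0 expr0n mulr0.
Qed.

Lemma block_bound (p r : R) A B : opr p r A -> opr p r B -> exists2 C : R, 0 <= C &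
  forall x : sobolev2 p, (sobolev_sqnorm r (A x.1 + B x.2)%R <= C%:E * (sobolev_sqnorm p x.1 + sobolev_sqnorm p x.2))%E.
Proof.
move=> [_ [M M0 HM]] [_ [N N0 HN]]; exists (2 * (M + N)); first by rewrite mulr_ge0// addr_ge0.
move=> x; apply: le_trans (sqnormD _ _ _) _.
rewrite EFinM -muleA -muleDr ?ge0_adde_def ?inE ?sqnorm_ge0// lee_wpmul2l//.
rewrite muleDr ?ge0_adde_def ?inE ?sqnorm_ge0//.
apply: leeD; [apply: le_trans (HM _ (fourierP _)) _|apply: le_trans (HN _ (fourierP _)) _];
  by rewrite lee_wpmul2r ?sqnorm_ge0// lee_fin ?lerDl ?lerDr.
Qed.

Lemma opr_norm_bound (p r : R) A : opr p r A -> exists2 M : R, 0 <= M &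
  forall (x : sobolev p) (y : sobolev r), fourier y = A x -> `|y| <= M%:C * `|x|.
Proof.
move=> [_ [M M0 HM]]; exists (Num.sqrt M); first exact: sqrtr_ge0.
move=> x y yA; rewrite !norm_sobolev -rmorphM lecR.
have s0 : 0 <= Num.sqrt M * sobolev_norm p x by rewrite mulr_ge0 ?sqrtr_ge0 ?sobolev_norm_ge0.
rewrite le_sobolev_norm// exprMn sqr_sqrtr// EFinM sobolev_norm_sqr yA.
exact: HM (fourierP x).
Qed.

Lemma diagonal_bounded (p r : R) A (f : sobolev2 p -> sobolev2 r) : opr p r A ->
  (forall x, fourier2 (f x) = (A x.1, A x.2)) -> bounded_operator f.
Proof.
move=> /opr_norm_bound [M M0 HM] fA; exists M%:C => x.
have [h1 h2] : fourier (f x).1 = A x.1 /\ fourier (f x).2 = A x.2.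
  by move: (fA x); rewrite /fourier2 => -[].
rewrite -[`|x|]/(`|x.1| + `|x.2|) -[`|f x|]/(`|(f x).1| + `|(f x).2|) mulrDr.
by apply: lerD; exact: HM.
Qed.

Lemma fourier2_inj (p : R) : injective (@fourier2 R p).
Proof.
move=> [x1 x2] [y1 y2]; rewrite /fourier2 /= => -[h1 h2].
by congr (_, _); apply: val_inj.
Qed.

End block_bounds.

(** * The coefficients of the curve *)

Section coefficients.
Context {R : realType}.

Definition smooth_periodic (f : R -> R) := smooth f /\ periodic f.
Lemma smooth_periodicM f h : smooth_periodic f -> smooth_periodic h -> smooth_periodic (fun t => f t * h t).
Proof. by move=> [f1 f2] [h1 h2]; split; [exact: smoothM|move=> t; rewrite f2 h2]. Qed.
Lemma smooth_periodicD f h : smooth_periodic f -> smooth_periodic h -> smooth_periodic (fun t => f t + h t).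
Proof. by move=> [f1 f2] [h1 h2]; split; [exact: smoothD|move=> t; rewrite f2 h2]. Qed.
Lemma smooth_periodicN f : smooth_periodic f -> smooth_periodic (fun t => - f t).
Proof. by move=> [f1 f2]; split; [exact: smoothN|move=> t; rewrite f2]. Qed.
Lemma smooth_periodic_cst (c : R) : smooth_periodic (fun=> c).
Proof. by split => //; exact: smooth_cst. Qed.

Lemma smooth_periodic_dot (g h : R -> R * R) : smooth_periodic (fun t => (g t).1) -> smooth_periodic (fun t => (g t).2) ->
  smooth_periodic (fun t => (h t).1) -> smooth_periodic (fun t => (h t).2) -> smooth_periodic (fun t => dot (g t) (h t)).
Proof. by move=> g1 g2 h1 h2; apply: smooth_periodicD; exact: smooth_periodicM. Qed.

Lemma smooth_periodic_curve_deriv n (g : R -> R * R) : analytic_closed_curve g ->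
  smooth_periodic (fun t => (curve_deriv n g t).1) /\ smooth_periodic (fun t => (curve_deriv n g t).2).
Proof.
move=> [[g1 g2] gp _ _].
have s1 := real_analytic_smooth g1; have s2 := real_analytic_smooth g2.
split; split.
- exact: (smooth_derive1n n s1).
- by apply: (periodic_derive1n n s1) => t; rewrite /= gp.
- exact: (smooth_derive1n n s2).
- by apply: (periodic_derive1n n s2) => t; rewrite /= gp.
Qed.

Lemma enorm_sqr (x : R * R) : enorm x ^+ 2 = dot x x.
Proof. by rewrite /enorm sqr_sqrtr// addr_ge0// -expr2 sqr_ge0. Qed.

Lemma opr_mulop_smooth_periodic a q : smooth_periodic a -> 0 <= q -> opr q q (mulop a).
Proof. by move=> [sa pa] q0; exact: opr_mulop. Qed.

Lemma opr_T0comm a q : smooth_periodic a -> 1 <= q -> opr q q (T0comm T0 (mulop a)).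
Proof.
move=> [sa pa] q1.
apply: (opr_ext (A := fun u m => T0symb m * mulop a u m - mulop a (fun k => T0symb k * u k) m)).
  by move=> u _; apply/funext => m; rewrite /T0comm !T0E.
apply: (@opr_commutator _ a sa pa T0symb q (q - 1)); [lra|lra| |exact: T0symb_lipschitz].
apply: (opr_ext (A := T0)) => [u _|]; first by rewrite T0E.
by have := opr_T0 (q - 1); rewrite subrK.
Qed.

Variables (kappa : R) (g : R -> R * R).
Hypotheses (kappa_gt0 : 0 < kappa) (g_curve : analytic_closed_curve g).

Let sp1 := smooth_periodic_curve_deriv 1 g_curve.
Let sp2 := smooth_periodic_curve_deriv 2 g_curve.
Let sp3 := smooth_periodic_curve_deriv 3 g_curve.

Lemma smooth_periodic_coef1 : smooth_periodic (fun t => kappa ^+ 2 * enorm (curve_deriv 1 g t) ^+ 2).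
Proof.
rewrite (_ : (fun t => _) = fun t => kappa ^+ 2 * dot (curve_deriv 1 g t) (curve_deriv 1 g t)); last first.
  by apply/funext => t; rewrite enorm_sqr.
by apply: smooth_periodicM; [exact: smooth_periodic_cst|case: sp1 => *; exact: smooth_periodic_dot].
Qed.

Lemma smooth_periodic_coef2 : smooth_periodic (fun t => kappa ^+ 2 * dot (normal_vector g t) (curve_deriv 2 g t)).
Proof.
case: sp1 => h1 h2; case: sp2 => h3 h4.
by apply: smooth_periodicM; [exact: smooth_periodic_cst|apply: smooth_periodic_dot => //; exact: smooth_periodicN].
Qed.

Lemma smooth_periodic_coef3 : smooth_periodic (fun t => kappa ^+ 2 * dot (curve_deriv 1 g t) (curve_deriv 2 g t)).
Proof.
case: sp1 => h1 h2; case: sp2 => h3 h4.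
by apply: smooth_periodicM; [exact: smooth_periodic_cst|exact: smooth_periodic_dot].
Qed.

(** The common form of the coefficients of E4 and E5. *)
Lemma smooth_periodic_coef45 (c d : R) : smooth_periodic (fun t => - (c * enorm (curve_deriv 1 g t) ^+ 4) + d * dot (curve_deriv 1 g t) (curve_deriv 3 g t)).
Proof.
case: sp1 => h1 h2; case: sp3 => h3 h4.
have h := smooth_periodic_dot h1 h2 h1 h2.
rewrite (_ : (fun t => _) = fun t => - (c * (dot (curve_deriv 1 g t) (curve_deriv 1 g t) * dot (curve_deriv 1 g t) (curve_deriv 1 g t))) + d * dot (curve_deriv 1 g t) (curve_deriv 3 g t)); last first.
  by apply/funext => t; rewrite -!enorm_sqr -exprD.
apply: smooth_periodicD; last by apply: smooth_periodicM; [exact: smooth_periodic_cst|exact: smooth_periodic_dot].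
by apply: smooth_periodicN; apply: smooth_periodicM; [exact: smooth_periodic_cst|exact: smooth_periodicM].
Qed.

Lemma opr_E1 q : 0 <= q -> opr q q (E1 kappa g). Proof. exact: opr_mulop_smooth_periodic smooth_periodic_coef1. Qed.
Lemma opr_E2 q : 0 <= q -> opr q q (E2 kappa g). Proof. exact: opr_mulop_smooth_periodic smooth_periodic_coef2. Qed.
Lemma opr_E3 q : 0 <= q -> opr q q (E3 kappa g). Proof. exact: opr_mulop_smooth_periodic smooth_periodic_coef3. Qed.
Lemma opr_E6 q : 0 <= q -> opr q q (E6 kappa g).
Proof.
move=> q0; have h4 := smooth_periodic_coef45 (kappa ^+ 4) (2 * kappa ^+ 2).
have h5 := smooth_periodic_coef45 (3 / 4 * kappa ^+ 4) (kappa ^+ 2).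
apply: (opr_ext (A := fun u m => E4 kappa g u m - E5 kappa g u m)) => //.
exact: (opr_sub (opr_mulop_smooth_periodic h4 q0) (opr_mulop_smooth_periodic h5 q0)).
Qed.

(** * Inversion of U *)

Let a1 (t : R) := kappa ^+ 2 * enorm (curve_deriv 1 g t) ^+ 2.
Let a1_neq0 t : a1 t != 0.
Proof.
have [_ _ _ h] := g_curve.
by rewrite mulf_neq0// expf_neq0// gt_eqF.
Qed.

Definition E1inv := mulop (fun t => (a1 t)^-1).

Let smooth_periodic_coef1V : smooth_periodic (fun t => (a1 t)^-1).
Proof.
have [s1 p1] := smooth_periodic_coef1; split; first exact: smoothV.
by move=> t; congr (_^-1); exact: p1.
Qed.

Lemma E1K q u : 0 <= q -> u \in in_sobolev q -> E1inv (E1 kappa g u) = u.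
Proof.
move=> q0 uq; have [s1 p1] := smooth_periodic_coef1; have [s2 p2] := smooth_periodic_coef1V.
by apply: (mulop_inverse s2 p2 s1 p1 _ q0 uq) => t; exact: mulVf (a1_neq0 t).
Qed.

Lemma E1VK q u : 0 <= q -> u \in in_sobolev q -> E1 kappa g (E1inv u) = u.
Proof.
move=> q0 uq; have [s1 p1] := smooth_periodic_coef1; have [s2 p2] := smooth_periodic_coef1V.
by apply: (mulop_inverse s1 p1 s2 p2 _ q0 uq) => t; exact: mulfV (a1_neq0 t).
Qed.

(** Here S0 S0 T0 T0 = T0 T0 S0 S0 = I, and E1 is inverted by [mulop_inverse]. *)
Definition opUinv u := T0 (T0 (E1inv u)).

Lemma opr_Uinv p : 0 <= p -> opr (p + 2) p opUinv.
Proof.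
move=> p0; have o1 : opr (p + 2) (p + 1 + 1) E1inv.
  apply: (opr_weaken (q := p + 2) (r := p + 2)) => //; first by lra.
  by apply: opr_mulop_smooth_periodic => //; lra.
exact: (opr_comp (opr_comp o1 (opr_T0 _)) (opr_T0 _)).
Qed.

Let fE1 := E1 kappa g.
Let fE2 := E2 kappa g.
Let fE3 := E3 kappa g.
Let fE6 := E6 kappa g.

Lemma calNE x y : calN kappa g (x, y) =
  (opN1 S0 S2 fE1 fE2 x y, opN2 T0 S0 S1 S2 fE1 fE2 fE3 fE6 x y).
Proof.
transitivity ((x + 0) + (fE2 (S2 x) + (S0 y + fE1 (S2 y))),
  (T0 x - y) + ((2^-1 *: fE1 (S0 x) + fE3 (S1 x) + fE6 (S2 x)) - fE2 (S2 y))); first by [].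
congr (_, _).
have regroup (V : zmodType) (u v w : V) : u + 0 + (v + w) = u + v + w by rewrite addr0 addrA.
exact: regroup.
Qed.

Lemma calUE x y : calU kappa g (x, y) = (opU S0 fE1 x, opU S0 fE1 y).
Proof.
transitivity ((x + S0 (T0 x) + fE1 (S0 (S0 x))) + 0, 0 + (y + T0 (S0 y) + fE1 (S0 (S0 y)))); first by [].
have cancel (V : zmodType) (u v w : V) : v = - u -> u + v + w = w.
  by move=> ->; rewrite subrr add0r.
have cancel1 := cancel _ _ _ (fE1 (S0 (S0 x))) (S0T0 x).
have cancel2 := cancel _ _ _ (fE1 (S0 (S0 y))) (T0S0 y).
by congr (_, _); [exact: etrans (addr0 _) cancel1|exact: etrans (add0r _) cancel2].
Qed.

Definition opD (u : int -> R[i]) : int -> R[i] := fun m => Dsymb m * u m.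

Lemma opDE u : opD u = S2 (T0 u) - 2^-1 *: S0 (S0 u).
Proof.
rewrite S2E T0E !S0E; apply/funext => m.
change (Dsymb m * u m = (S2symb m)%:C * (T0symb m * u m) - 2^-1 * (S0symb m * (S0symb m * u m))).
rewrite /Dsymb; ring.
Qed.

Lemma opUinvK p u : 0 <= p -> u \in in_sobolev p -> opUinv (opU S0 fE1 u) = u.
Proof.
move=> p0 up; have uS : S0 (S0 u) \in in_sobolev p.
  apply: (in_sobolev_le (r := p + 1 + 1)); first by lra.
  exact: (opr_in (opr_S0 _) (opr_in (opr_S0 p) up)).
have e1 : E1inv (fE1 (S0 (S0 u))) = S0 (S0 u) := E1K p0 uS.
have e2 : T0 (- S0 u) = - T0 (S0 u) := oprN (opr_T0 p) (opr_in (opr_S0 p) up).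
have e3 : - T0 (S0 u) = u := etrans (congr1 (fun v => - v) (T0S0 u)) (opprK u).
exact: etrans (congr1 (fun v => T0 (T0 v)) e1) (etrans (congr1 T0 (T0S0 (S0 u))) (etrans e2 e3)).
Qed.

Lemma opUK p u : 0 <= p -> u \in in_sobolev (p + 2) -> opU S0 fE1 (opUinv u) = u.
Proof.
move=> p0 up; have p20 : 0 <= p + 2 by lra.
have := opr_mulop_smooth_periodic smooth_periodic_coef1V p20 => o1.
have vp : E1inv u \in in_sobolev (p + 1 + 1) by apply: (in_sobolev_le _ (opr_in o1 up)); lra.
have Tv : T0 (E1inv u) \in in_sobolev (p + 1) by exact: opr_in (opr_T0 (p + 1)) vp.
have e1 : S0 (- T0 (E1inv u)) = - S0 (T0 (E1inv u)) := oprN (opr_S0 (p + 1)) Tv.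
have e2 : fE1 (E1inv u) = u := E1VK p20 up.
have e3 : - S0 (T0 (E1inv u)) = E1inv u := etrans (congr1 (fun v => - v) (S0T0 (E1inv u))) (opprK _).
have e4 : S0 (S0 (opUinv u)) = E1inv u := etrans (congr1 S0 (S0T0 (T0 (E1inv u)))) (etrans e1 e3).
exact: etrans (congr1 fE1 e4) e2.
Qed.

End coefficients.

Theorem theorem3p2 (R : realType) (kappa : R) (g : R -> R * R)
    (kappa_gt0 : 0 < kappa) (g_curve : analytic_closed_curve g)
    (p : R) (p_ge0 : 0 <= p) :
  exists NN U J : {linear sobolev2 p -> sobolev2 (p + 2)},
    [/\ forall psi, fourier2 (NN psi) = calN kappa g (calN kappa g (fourier2 psi)),
        forall psi, fourier2 (U psi) = calU kappa g (fourier2 psi),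
        isomorphism U,
        compact_operator J &
        forall psi, NN psi = U psi + J psi].
Proof.
have oE1 := opr_E1 kappa g_curve; have oE2 := opr_E2 kappa g_curve.
have oE3 := opr_E3 kappa g_curve; have oE6 := opr_E6 kappa g_curve.
have oC1 q : 1 <= q -> opr q q (T0comm T0 (E1 kappa g)) by exact: opr_T0comm (smooth_periodic_coef1 kappa g_curve).
have oC2 q : 1 <= q -> opr q q (T0comm T0 (E2 kappa g)) by exact: opr_T0comm (smooth_periodic_coef2 kappa g_curve).
have o11 := opr_J11 oE1 oE2 oE3 oE6 opr_S0 opr_S1 opr_S2 opr_D oC1 p_ge0.
have o12 := opr_J12 oE1 oE2 opr_S0 opr_S2 p_ge0.
have o21 := opr_J21 oE1 oE2 oE3 oE6 opr_S0 opr_S1 opr_S2 oC2 p_ge0.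
have o22 := opr_J22 oE1 oE2 oE3 oE6 opr_S0 opr_S1 opr_S2 opr_D oC1 p_ge0.
have oU := opr_U oE1 opr_S0 p_ge0.
have sq x y := @square_entries R T0 S0 S1 S2 opD _ _ _ _ oE1 oE2 oE3 oE6 opr_T0 opr_S0 opr_S1 opr_S2
  S0T0 T0S0 S2T0 opDE p x y p_ge0.
have oG := opr_Uinv kappa_gt0 g_curve p_ge0.
move: oU sq o11 o12 o21 o22 oG (fun u => opUinvK kappa_gt0 g_curve p_ge0 (u := u)) (fun u => opUK kappa_gt0 g_curve p_ge0 (u := u)).
(* The operators are replaced by variables, so that unification cannot unfold the
   limits and integrals that define them. *)
have cN := calNE kappa g; have cU := calUE kappa g; move: cN cU.
move: (opN1 _ _ _ _) (opN2 _ _ _ _ _ _ _ _) (opU _ _) (opUinv kappa g) => N1 N2 U G.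
move: (J11 _ _ _ _ _ _ _ _ _) (J12 _ _ _ _) (J21 _ _ _ _ _ _ _ _) (J22 _ _ _ _ _ _ _ _ _) => A B C D.
move=> cN cU oU sq oA oB oC oD oG UK GK.
have p23 : p + 2 <= p + 3 by lra.
have oA2 := opr_weaken (lexx p) p23 oA; have oB2 := opr_weaken (lexx p) p23 oB.
have oC2' := opr_weaken (lexx p) p23 oC; have oD2 := opr_weaken (lexx p) p23 oD.
have z := @opr0 R p (p + 2).
have [NN hNN] := block_operator (opr_add oU oA2) oB2 oC2' (opr_add oU oD2).
have [UU hU] := block_operator oU z z oU.
have [JJ hJ] := block_operator oA2 oB2 oC2' oD2.
have [GG hG] := block_operator oG (opr0 _ _) (opr0 _ _) oG.
have hU' x : fourier2 (UU x) = (U x.1, U x.2).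
  by rewrite hU; congr (_, _); [exact: addr0|exact: add0r].
have hG' x : fourier2 (GG x) = (G x.1, G x.2).
  by rewrite hG; congr (_, _); [exact: addr0|exact: add0r].
exists NN, UU, JJ; split.
- move=> psi; rewrite hNN /fourier2 cN cN.
  have [e1 e2] := sq _ _ (fourierP psi.1) (fourierP psi.2).
  by rewrite e1 e2.
- by move=> psi; rewrite hU' /fourier2 cU.
- split; first exact: diagonal_bounded oU hU'.
  exists GG; split; last exact: diagonal_bounded oG hG'.
  + move=> x; apply: fourier2_inj; rewrite hG'; move: (hU' x); rewrite {1}/fourier2 => -[-> ->].
    by rewrite !UK ?fourierP.
  + move=> x; apply: fourier2_inj; rewrite hU'; move: (hG' x); rewrite {1}/fourier2 => -[-> ->].
    by rewrite !GK ?fourierP.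
- have [C1 C10 H1] := block_bound oA oB; have [C2 C20 H2] := block_bound oC oD.
  have C0 : 0 <= C1 + C2 by exact: addr_ge0.
  have p3 : 0 <= p + 3 by lra.
  have p21 : p + 2 + 1 <= p + 3 by lra.
  apply: (compact_operator_gain p3 p21 C0) => x.
  + have [-> _] : fourier (JJ x).1 = A x.1 + B x.2 /\ fourier (JJ x).2 = C x.1 + D x.2.
      by move: (hJ x); rewrite /fourier2 => -[].
    apply: le_trans (H1 x) _; rewrite lee_wpmul2r ?adde_ge0 ?sqnorm_ge0// lee_fin lerDl//.
  + have [_ ->] : fourier (JJ x).1 = A x.1 + B x.2 /\ fourier (JJ x).2 = C x.1 + D x.2.
      by move: (hJ x); rewrite /fourier2 => -[].
    apply: le_trans (H2 x) _; rewrite lee_wpmul2r ?adde_ge0 ?sqnorm_ge0// lee_fin lerDr//.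
- move=> psi; apply: fourier2_inj; rewrite hNN.
  have -> : fourier2 (UU psi + JJ psi) = (fourier (UU psi).1 + fourier (JJ psi).1, fourier (UU psi).2 + fourier (JJ psi).2) by [].
  move: (hU' psi) (hJ psi); rewrite /fourier2 => -[-> ->] [-> ->].
  congr (_, _); apply/funext => m; rewrite !fctE.
    by rewrite addrA.
  by rewrite addrCA.
Qed.
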